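(* Let $k\ge 2$ and let $M$ be a finite-dimensional Malcev algebra over the field $\mathbb{C}$ of complex numbers belonging to the variety $NL_k$. Then: (1) $M$ may be embedded into a splitting Malcev algebra, namely its splitting $\hat M = S\oplus T\oplus N$, with $\hat M\in NL_k$, where $S$ is a semisimple Lie subalgebra, $T$ is a toroidal subalgebra and $N$ is a nilpotent ideal. (2) $N = N_{00}\oplus [S\oplus T,N]$, where $N_{00}$ is a Malcev subalgebra of $N$, and the ideal $M_1$ of $\hat M$ generated by $S+T+\sum_{\alpha\in\Delta\setminus 0}N_\alpha+[S,N]$ is contained in the Lie center $Lie(\hat M)$. (3) There exists a Malcev algebra $\tilde M = N_{00}\oplus M_1$ of the variety $NL_k$, which is a decomposable extension of the nilpotent Malcev algebra $N_{00}$ and the Lie subalgebra $M_1$, such that there exists an epimorphism of Malcev algebras $\pi:\tilde M\to\hat M$.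
   Context: A Malcev algebra is an algebra with product $[\cdot,\cdot]$ satisfying $[x,x]=0$ and $[J(x,y,z),x]=J(x,y,[x,z])$, where $J(x,y,z)=[[x,y],z]+[[y,z],x]+[[z,x],y]$. $J(A)$ denotes the ideal of $A$ generated by all $J(x,y,z)$, $x,y,z\in A$. The Lie center is $Lie(A)=\{x\in A : J(x,A,A)=0\}$. Set $A^1=A$, $A^n=\sum_{i+j=n,\ i,j>0}[A^i,A^j]$. $NL_k$ is the variety of Malcev algebras defined by the identities $J([x_1,\dots,x_k],y,z)=0$ for all distributions of parentheses in $[x_1,\dots,x_k]$; equivalently $A^k\subseteq Lie(A)$. Splitting algebras. Write $R_a:x\mapsto [x,a]$. An element $t$ is semisimple if $R_t$ is diagonalizable, and $n$ is nilpotent if $R_n$ is nilpotent. An element $g$ is splitting if $g=t+n$ with $t$ semisimple, $n$ nilpotent, and $R_t,R_n$ commuting. A Malcev algebra is splitting if all its elements are splitting. Every finite-dimensional Malcev algebra $M$ in characteristic $0$ is contained in a splitting Malcev algebra; if such an algebra $\hat M\supseteq M$ contains no intermediate (proper) splitting subalgebra containing $M$, it is called a splitting of $M$. A toroidal subalgebra is an abelian subalgebra all of whose elements are semisimple. A finite-dimensional splitting Malcev algebra in characteristic $0$ is known to have a decomposition $S\oplus T\oplus N$ (direct sum of vector spaces), where $S$ is a semisimple Levi factor, $T$ is a toroidal subalgebra, $N$ is the nilpotent radical, $[S,T]=0$, and $N=\bigoplus_{\alpha\in\Delta}N_\alpha$ with $\Delta\subset T^*$, $N_\alpha=\{x\in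 N : [x,t]=\alpha(t)x\ \ \forall t\in T\}$. Here $\Delta\setminus 0$ is the set of nonzero weights. Each $N_\alpha$ is an $S$-module, and $N_0=N_{01}\oplus N_{00}$ with $N_{01}=[S,N_0]$ and $N_{00}=\{x\in N_0 : [S,x]=0\}$, i.e. $N_{00}=\{x\in N : [S\oplus T,x]=0\}$. Decomposable extension. Let $A$ be a Malcev algebra with $A=\tilde N+L$, where $\tilde N$ is a subalgebra, $L\subseteq Lie(A)$ is an ideal, and there is an ideal $I\subseteq\tilde N$ with $J(\tilde N)\subseteq I$ and $[I,L]=0$. Then $\tilde N/I$ is a Lie algebra acting on $L$ by derivations, $l^b=[l,b]$ for $l\in L$, $b\in\tilde N$. The decomposable extension of $\tilde N$ and $L$ is the Malcev algebra on the external direct sum $\tilde N\oplus L$ with product $(a,l)\cdot(b,r)=([a,b],\ l^b-r^a+[l,r])$. *)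

(* Defs.v *)
From HB Require Import structures.
From mathcomp Require Import all_boot all_order all_algebra.
From mathcomp Require Import boolp classical_sets reals.
From mathcomp Require Import complex.

Set Implicit Arguments.
Unset Strict Implicit.
Unset Printing Implicit Defensive.

Import GRing.Theory.
Local Open Scope ring_scope.

Section Subspaces.
Variables (F : fieldType) (V : vectType F).
Implicit Types (P : V -> Prop) (Q : {vspace V} -> Prop) (U W : {vspace V}).

(* Meaningful when Q holds of the whole space and is stable under
   intersection; see leastvP. *)
Definition leastv Q : {vspace V} :=
  xget fullv [set U | Q U /\ forall W, Q W -> (U <= W)%VS]%classic.

Lemma leastvP Q : Q fullv -> (forall U W, Q U -> Q W -> Q (U :&: W)%VS) ->
  Q (leastv Q) /\ forall W, Q W -> (leastv Q <= W)%VS.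
Proof.
move=> Qf QI; rewrite /leastv; case: xgetP => [U _ //|none]; exfalso.
have exd : exists d, `[< exists2 U, Q U & \dim U = d >].
  by exists (\dim {:V}); apply/asboolP; exists fullv.
case: (ex_minnP exd) => d /asboolP[U QU dU] dmin.
apply: (none U); split=> // W QW; rewrite -dU in dmin.
have /eqP <- : (U :&: W == U)%VS.
  rewrite eqEdim capvSl dmin //; apply/asboolP.
  by exists (U :&: W)%VS => //; apply: QI.
exact: capvSr.
Qed.

Definition spanp P : {vspace V} := leastv (fun U => forall x, P x -> x \in U).

Lemma spanpP P :
  (forall x, P x -> x \in spanp P) /\
  forall W, (forall x, P x -> x \in W) -> (spanp P <= W)%VS.
Proof.
apply: (@leastvP (fun U => forall x, P x -> x \in U)) => [x _|U W PU PW x Px].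
  exact: memvf.
by rewrite memv_cap PU ?PW.
Qed.

Lemma mem_spanp P : P 0 -> (forall a x y, P x -> P y -> P (a *: x + y)) ->
  forall x, x \in spanp P <-> P x.
Proof.
move=> P0 PD x; split=> [|Px]; last exact: (proj1 (spanpP P)).
pose Q d := exists2 U : {vspace V}, (forall y, y \in U -> P y) & \dim U = d.
have exd : exists d, `[< Q d >].
  by exists 0%N; apply/asboolP; exists 0%VS => [y|]; rewrite ?memv0 ?dimv0 //
    => /eqP ->.
have bd d : `[< Q d >] -> (d <= \dim {:V})%N.
  by move=> /asboolP[U _ <-]; apply/dimvS/subvf.
case: (ex_maxnP exd bd) => d /asboolP[U PU dU] dmax.
have sPU y : P y -> y \in U.
  move=> Py; have: (\dim (<[y]> + U)%VS <= \dim U)%N.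
    rewrite dU dmax //; apply/asboolP; exists (<[y]> + U)%VS => // z.
    move=> /memv_addP[_ /vlineP[a ->] [u uU ->]].
    by apply: PD => //; apply: PU.
  move=> dyU; have /eqP -> : U == (<[y]> + U)%VS by rewrite eqEdim addvSr.
  by apply: (subvP (addvSl _ U)); apply: memv_line.
move=> /(subvP (proj2 (spanpP P) U sPU)).
exact: PU.
Qed.

End Subspaces.

Section Algebras.
Variables (F : fieldType) (V : vectType F) (br : V -> V -> V).
Implicit Types (x y z a : V) (U W I L S T N : {vspace V}).

Definition jac x y z : V :=
  br (br x y) z + br (br y z) x + br (br z x) y.

Definition bilinear_br : Prop :=
  (forall x, linear (br x)) /\ (forall y, linear (br^~ y)).

Definition malcev : Prop :=
  [/\ bilinear_br, forall x, br x x = 0 &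
      forall x y z, br (jac x y z) x = jac x y (br x z) ].

Definition lie : Prop :=
  [/\ bilinear_br, forall x, br x x = 0 & forall x y z, jac x y z = 0 ].

Definition lie_center x : Prop := forall y z, jac x y z = 0.

(* paren_product k w: w is the value of [x_1, ..., x_k], for some x_1, ..., x_k
   and some distribution of parentheses. *)
Inductive paren_product : nat -> V -> Prop :=
| ParenLeaf x : paren_product 1%N x
| ParenNode i j x y : paren_product i x -> paren_product j y ->
    paren_product (i + j)%N (br x y).

Definition NL (k : nat) : Prop :=
  malcev /\ forall w y z, paren_product k w -> jac w y z = 0.

Definition brv U W : {vspace V} :=
  spanp (fun x => exists u w, [/\ u \in U, w \in W & x = br u w ]).

Definition subalg U : Prop := forall x y, x \in U -> y \in U -> br x y \in U.

Definition ideal_in U I : Prop :=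
  (I <= U)%VS /\
  forall x y, x \in I -> y \in U -> br x y \in I /\ br y x \in I.

Definition ideal I : Prop := ideal_in fullv I.

Definition ideal_gen (P : V -> Prop) : {vspace V} :=
  leastv (fun I => ideal I /\ forall x, P x -> x \in I).

Lemma ideal_genP P :
  [/\ ideal (ideal_gen P), forall x, P x -> x \in ideal_gen P &
      forall I, ideal I -> (forall x, P x -> x \in I) -> (ideal_gen P <= I)%VS].
Proof.
have [|U W [[_ iU] PU] [[_ iW] PW]|[idP PP] least] :=
  @leastvP F V (fun I => ideal I /\ forall x, P x -> x \in I).
- by split=> [|x _]; [split=> // x y; rewrite !memvf | rewrite memvf].
- split=> [|x Px]; last by rewrite memv_cap PU ?PW.
  split=> [|x y]; first exact: subvf.
  rewrite !memv_cap => /andP[xU xW] yf.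
  have [xyU yxU] := iU x y xU yf; have [xyW yxW] := iW x y xW yf.
  by rewrite xyU xyW yxU yxW.
- by split=> // I idI PI; apply: least.
Qed.

Definition jac_ideal : {vspace V} :=
  ideal_gen (fun w => exists x y z, w = jac x y z).

(* The sequence U^1, ..., U^(n+1). *)
Fixpoint powers U (n : nat) : seq {vspace V} :=
  if n is m.+1 then
    let s := powers U m in
    rcons s (\sum_(i < m.+1) brv (nth 0%VS s i) (nth 0%VS s (m - i)))%VS
  else [:: U].

(* U^n for n > 0. *)
Definition power U (n : nat) : {vspace V} := nth 0%VS (powers U n.-1) n.-1.

Lemma size_powers U n : size (powers U n) = n.+1.
Proof. by elim: n => //= n IHn; rewrite size_rcons IHn. Qed.

Lemma nth_powers U n i : (i <= n)%N -> nth 0%VS (powers U n) i = power U i.+1.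
Proof.
elim: n => [|n IHn]; first by rewrite leqn0 => /eqP ->.
rewrite leq_eqVlt => /orP[/eqP -> //|lin]; rewrite -(IHn lin) /=.
by rewrite nth_rcons size_powers lin.
Qed.

Lemma power1 U : power U 1 = U. Proof. by []. Qed.

Lemma powerE U n : (1 < n)%N ->
  power U n = (\sum_(1 <= i < n) brv (power U i) (power U (n - i)))%VS.
Proof.
case: n => [|[|n]] // _; rewrite big_add1 /= big_mkord /power /=.
rewrite nth_rcons size_powers ltnn eqxx; apply: eq_bigr => i _.
have lin : (i <= n)%N by rewrite -ltnS.
by rewrite !nth_powers ?leq_subr // subSS /power subSn.
Qed.

Definition nilpotent U : Prop := exists2 n, (0 < n)%N & power U n = 0%VS.

Definition solvable U : Prop :=
  exists n, iter n (fun W => brv W W) U = 0%VS.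

Definition is_radical R : Prop :=
  [/\ ideal R, solvable R & forall I, ideal I -> solvable I -> (I <= R)%VS].

Definition is_nilradical N : Prop :=
  [/\ ideal N, nilpotent N & forall I, ideal I -> nilpotent I -> (I <= N)%VS].

Definition semisimple_subalg S : Prop :=
  subalg S /\ forall I, ideal_in S I -> solvable I -> I = 0%VS.

Definition levi_factor S : Prop :=
  semisimple_subalg S /\
  exists R, [/\ is_radical R, (S + R)%VS = fullv & (S :&: R)%VS = 0%VS].

Definition Rop a : V -> V := fun x => br x a.

Definition semisimple_elt t : Prop :=
  exists X : seq V, basis_of fullv X /\
    forall x, x \in X -> exists a : F, Rop t x = a *: x.

Definition nilpotent_elt n : Prop := exists m, forall x, iter m (Rop n) x = 0.

Definition splitting_elt g : Prop :=
  exists t n, [/\ g = t + n, semisimple_elt t, nilpotent_elt n &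
    forall x, Rop t (Rop n x) = Rop n (Rop t x)].

Definition splitting_alg : Prop := malcev /\ forall g, splitting_elt g.

Definition toroidal T : Prop :=
  [/\ subalg T, forall t u, t \in T -> u \in T -> br t u = 0 &
      forall t, t \in T -> semisimple_elt t].

(* T^* is 'Hom(subvs_of T, F^o); vsproj T only coerces t \in T to subvs_of T. *)
Definition weight_space T N (alpha : 'Hom(subvs_of T, F^o)) : {vspace V} :=
  spanp (fun x => x \in N /\
    forall t, t \in T -> br x t = (alpha (vsproj T t) : F) *: x).

(* Delta lists the weights of T on N (0 included when it is one). *)
Definition splitting_decomposition S T N (Delta : seq 'Hom(subvs_of T, F^o))
    : Prop :=
  [/\ [/\ (S + T + N)%VS = fullv, directv (S + T + N)
         & forall s t, s \in S -> t \in T -> br s t = 0],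
      levi_factor S, toroidal T, is_nilradical N &
      [/\ uniq Delta, forall alpha, alpha \in Delta -> weight_space N alpha != 0%VS,
          directv (\sum_(alpha <- Delta) weight_space N alpha) &
          N = (\sum_(alpha <- Delta) weight_space N alpha)%VS]].

(* The spanning sets in weight_space and N00 are already subspaces when br is
   bilinear; see mem_spanp. *)
Definition N00 S T N : {vspace V} :=
  spanp (fun x => x \in N /\ forall y, y \in (S + T)%VS -> br y x = 0).

Definition M1 S T N (Delta : seq 'Hom(subvs_of T, F^o)) : {vspace V} :=
  ideal_gen (fun x => x \in
    (S + T + \sum_(alpha <- Delta | alpha != 0%R) weight_space N alpha
       + brv S N)%VS).

(* Product of the algebra on the subspace U; meaningful when U is a subalgebra. *)
Definition sub_br U (x y : subvs_of U) : subvs_of U :=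
  vsproj U (br (vsval x) (vsval y)).

Definition dext_br U L (p q : (subvs_of U * subvs_of L)%type)
    : (subvs_of U * subvs_of L)%type :=
  (sub_br p.1 q.1,
   vsproj L (br (vsval p.2) (vsval q.1) - br (vsval q.2) (vsval p.1)
             + br (vsval p.2) (vsval q.2))).

End Algebras.

Arguments weight_space {F V} br T N alpha.
Arguments splitting_decomposition {F V} br S T N Delta.
Arguments M1 {F V} br S T N Delta.
Arguments sub_br {F V} br U x y.
Arguments dext_br {F V} br U L p q.

(* The conditions on subspaces U and L of an algebra A under which the
   decomposable extension dext_br U L is defined; here I is an ideal of U. *)
Definition dext_conditions (F : fieldType) (A : vectType F) (br : A -> A -> A)
    (U L : {vspace A}) : Prop :=
  [/\ subalg br U, ideal br L, (U + L)%VS = fullv,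
      forall l, l \in L -> lie_center br l &
      exists I : {vspace subvs_of U},
        [/\ ideal (sub_br br U) I,
            (jac_ideal (sub_br br U) <= I)%VS &
            forall b l, b \in I -> l \in L -> br (vsval b) l = 0]].

Definition br_morphism (F : fieldType) (A B : vectType F)
    (brA : A -> A -> A) (brB : B -> B -> B) (f : 'Hom(A, B)) : Prop :=
  forall x y, f (brA x y) = brB (f x) (f y).

Definition embedding (F : fieldType) (A B : vectType F)
    (brA : A -> A -> A) (brB : B -> B -> B) (f : 'Hom(A, B)) : Prop :=
  br_morphism brA brB f /\ lker f = 0%VS.

Definition epimorphism (F : fieldType) (A B : vectType F)
    (brA : A -> A -> A) (brB : B -> B -> B) (f : 'Hom(A, B)) : Prop :=
  br_morphism brA brB f /\ limg f = fullv.

(* (B, brB) is a splitting of (A, brA), with A embedded in B by f. *)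
Definition splitting_of (F : fieldType) (A B : vectType F)
    (brA : A -> A -> A) (brB : B -> B -> B) (f : 'Hom(A, B)) : Prop :=
  [/\ splitting_alg brB, embedding brA brB f &
      forall U : {vspace B}, subalg brB U -> (limg f <= U)%VS ->
        splitting_alg (sub_br brB U) -> U = fullv].

(* Main.v *)
Require Import Defs.
From HB Require Import structures.
From mathcomp Require Import all_boot all_order all_algebra.
From mathcomp Require Import boolp classical_sets reals.
From mathcomp Require Import complex.
From mathcomp Require Import ring zify.
Set Implicit Arguments.
Unset Strict Implicit.
Unset Printing Implicit Defensive.
Import Order.TTheory GRing.Theory Num.Theory.
Local Open Scope ring_scope.
Import VectorInternalTheory.

(** Let A be in NL_k. A vector of a generalized eigenspace of R_g for a nonzero
    eigenvalue is of the form R_g^(k-1) x, so it lies in A^k, hence in the Lie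
    center Lie(A). Therefore the semisimple part of R_g is a derivation with image
    in Lie(A), and the classical Lie arguments (Engel, Cartan, Weyl, Levi) apply to
    the action of A on Lie(A), which is a Lie representation although A is not a
    Lie algebra. In particular semisimple subalgebras and semisimple elements lie
    in Lie(A); so does the ideal M_1, and (2) follows from the complete
    reducibility of N under S and T. For (3), (a, l) |-> (a + l, a) embeds the
    decomposable extension in the square of the algebra.

    A minimal splitting is in NL_k because adjoining to a subalgebra U the
    semisimple part of one of its elements leaves U^n unchanged for n >= 2. To
    construct a splitting, extend M by a maximal torus of derivations that kill a
    Levi factor and map M to the intersection of the nilradical and of Lie(M);
    up to exponentials of nilpotent inner derivations, an element of the extension
    is tau + n, with tau inner semisimple commuting with the ad-nilpotent n. *)

(** * Linear maps and generalized eigenspaces *)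

(** Two obstacles shape the proof. First, [jac] is known to vanish only when one entry is Lie
    central, so Leibniz rules hold on subspaces only: [genE_bilin], [fcal_bilin] and [weyl_action]
    therefore assume them just on stable subspaces. The one product that the Lie center does not
    reach, that of two vectors of the null component of [ad g], is settled by the Malcev identity
    itself ([genE0_mul]). Second, spectral arguments use arbitrary functions [phi] of the
    eigenvalues instead of polynomials in the operator. An additive [phi] respects Leibniz rules.
    Taking complex conjugation for [phi] turns a trace into a sum of squared moduli; in Cartan's
    criterion this takes the place of linear forms over the rationals and explains the choice of
    [numClosedFieldType]. Nilpotent elements are not visibly closed under sums. The nilradical is
    thus defined by a linear condition, lowering a fixed composition flag of the Lie center; since
    [ad] raised to the power k-1 maps into the Lie center, such a flag controls nilpotency on the
    whole algebra. *)

Section Coordinates.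
Variables (F : fieldType) (V : vectType F).
Implicit Types x y : V.

(* Vector identities are checked coordinatewise, where [ring] applies. *)
Definition vcoord x i : F := v2r x 0 i.

Lemma vcoordP x y : vcoord x =1 vcoord y -> x = y.
Proof. by move=> xy; apply/v2r_inj/rowP. Qed.

Lemma vcoordD x y i : vcoord (x + y) i = vcoord x i + vcoord y i.
Proof. by rewrite /vcoord linearD mxE. Qed.

Lemma vcoordN x i : vcoord (- x) i = - vcoord x i.
Proof. by rewrite /vcoord linearN mxE. Qed.

Lemma vcoordZ a x i : vcoord (a *: x) i = a * vcoord x i.
Proof. by rewrite /vcoord linearZ mxE. Qed.

Lemma vcoord0 i : vcoord (0 : V) i = 0.
Proof. by rewrite /vcoord linear0 mxE. Qed.

Lemma vcoordMn x n i : vcoord (x *+ n) i = n%:R * vcoord x i.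
Proof. by rewrite -scaler_nat vcoordZ. Qed.

End Coordinates.

#[global] Opaque vcoord.

Ltac vring := apply: vcoordP => ?;
  rewrite ?(vcoordD, vcoordN, vcoordZ, vcoord0, vcoordMn); ring.

Notation "f *o g" := (comp_lfun f g) (at level 40, left associativity) : ring_scope.

Section Toolkit.
Variable F : fieldType.
Implicit Types V : vectType F.

(** [lfunE] expects a bundled linear map. The bundle is packed on the fly, so that a proof of
    linearity is enough. *)
Lemma linfun_linE V (W : vectType F) (f : V -> W) : linear f -> linfun f =1 f.
Proof.
move=> lf; pose M := GRing.isLinear.Build F V W _ f lf.
pose g : {linear V -> W} := HB.pack f M.
exact: (lfunE g).
Qed.

Lemma lfP V (W : vectType F) (f : 'Hom(V, W)) a x y : f (a *: x + y) = a *: f x + f y.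
Proof. exact: linearP. Qed.

Lemma lfD V (W : vectType F) (f : 'Hom(V, W)) x y : f (x + y) = f x + f y.
Proof. exact: linearD. Qed.

Lemma lfB V (W : vectType F) (f : 'Hom(V, W)) x y : f (x - y) = f x - f y.
Proof. exact: linearB. Qed.

Lemma lfN V (W : vectType F) (f : 'Hom(V, W)) x : f (- x) = - f x.
Proof. exact: linearN. Qed.

Lemma lfZ V (W : vectType F) (f : 'Hom(V, W)) a x : f (a *: x) = a *: f x.
Proof. exact: linearZ. Qed.

Lemma lf0 V (W : vectType F) (f : 'Hom(V, W)) : f 0 = 0.
Proof. exact: linear0. Qed.

Lemma lf_sum V (W : vectType F) (f : 'Hom(V, W)) I (r : seq I) (P : pred I) (E : I -> V) :
  f (\sum_(i <- r | P i) E i) = \sum_(i <- r | P i) f (E i).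
Proof. exact: linear_sum. Qed.

Definition lflin := (lfP, lfD, lfB, lfN, lfZ, lf0).

Definition lfE := (fun V (W : vectType F) => @add_lfunE F V W,
  fun V (W : vectType F) => @opp_lfunE F V W, fun V (W : vectType F) => @scale_lfunE F V W,
  fun V (W U : vectType F) => @comp_lfunE F V W U, fun V => @id_lfunE F V,
  fun V (W : vectType F) => @zero_lfunE F V W).

Lemma lin_D V (W : vectType F) (f : V -> W) x y : linear f -> f (x + y) = f x + f y.
Proof. by move=> lf; have := lf 1 x y; rewrite !scale1r. Qed.

Lemma lin_0 V (W : vectType F) (f : V -> W) : linear f -> f 0 = 0.
Proof. by move=> lf; apply: (addrI (f 0)); rewrite -lin_D // !addr0. Qed.

Lemma lin_Z V (W : vectType F) (f : V -> W) a x : linear f -> f (a *: x) = a *: f x.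
Proof. by move=> lf; have := lf a x 0; rewrite !addr0 (lin_0 lf) addr0. Qed.

Lemma lin_N V (W : vectType F) (f : V -> W) x : linear f -> f (- x) = - f x.
Proof. by move=> lf; rewrite -scaleN1r lin_Z // scaleN1r. Qed.

Lemma lin_B V (W : vectType F) (f : V -> W) x y : linear f -> f (x - y) = f x - f y.
Proof. by move=> lf; rewrite lin_D // lin_N. Qed.

Lemma iterD_lin V (f : 'End(V)) n x y : iter n f (x + y) = iter n f x + iter n f y.
Proof. by elim: n => //= n ->; rewrite lfD. Qed.

Lemma iterZ_lin V (f : 'End(V)) n a x : iter n f (a *: x) = a *: iter n f x.
Proof. by elim: n => //= n ->; rewrite lfZ. Qed.

Lemma iterN_lin V (f : 'End(V)) n x : iter n f (- x) = - iter n f x.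
Proof. by elim: n => //= n ->; rewrite lfN. Qed.

Definition lbr V (f g : 'End(V)) : 'End(V) := f *o g - g *o f.

Lemma lbrE V (f g : 'End(V)) x : lbr f g x = f (g x) - g (f x).
Proof. by rewrite /lbr !lfE. Qed.

Lemma span_ind V (G P : V -> Prop) : P 0 ->
  (forall a x y, P x -> P y -> P (a *: x + y)) ->
  (forall x, G x -> P x) -> forall x, x \in spanp G -> P x.
Proof.
move=> P0 PD GP x xG; apply/(mem_spanp P0 PD); apply: (subvP _ _ xG).
by apply: (proj2 (spanpP G)) => y /GP /(mem_spanp P0 PD).
Qed.

Lemma mem_span V (G : V -> Prop) x : G x -> x \in spanp G.
Proof. exact: (proj1 (spanpP G)). Qed.

Lemma span_le V (G : V -> Prop) (W : {vspace V}) :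
  (forall x, G x -> x \in W) -> (spanp G <= W)%VS.
Proof. exact: (proj2 (spanpP G)). Qed.

Lemma max_vspace V (P : {vspace V} -> Prop) U0 : P U0 ->
  exists2 U, P U & forall W, P W -> (\dim W <= \dim U)%N.
Proof.
move=> PU0; pose Q d := `[< exists2 U, P U & \dim U = d >].
have exd : exists d, Q d by exists (\dim U0); apply/asboolP; exists U0.
have bd d : Q d -> (d <= \dim {:V})%N.
  by move=> /asboolP[U _ <-]; apply/dimvS/subvf.
case: (ex_maxnP exd bd) => d /asboolP[U PU dU] dmax; exists U => // W PW.
by rewrite dU dmax //; apply/asboolP; exists W.
Qed.

Lemma min_vspace V (P : {vspace V} -> Prop) U0 : P U0 ->
  exists2 U, P U & forall W, P W -> (\dim U <= \dim W)%N.
Proof.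
move=> PU0; pose Q d := `[< exists2 U, P U & \dim U = d >].
have exd : exists d, Q d by exists (\dim U0); apply/asboolP; exists U0.
case: (ex_minnP exd) => d /asboolP[U PU dU] dmin; exists U => // W PW.
by rewrite dU dmin //; apply/asboolP; exists W.
Qed.

(** [U/W] is realized on a complement of [W] in [U]: [i] is the inclusion and [p] the projection
    along [W]. Having [p] defined on all of [V] lets it be composed with operators of [V]. *)
Lemma subquotient V (U W : {vspace V}) : (W <= U)%VS ->
  exists (X : vectType F) (i : 'Hom(X, V)) (p : 'Hom(V, X)),
    [/\ forall x, p (i x) = x, forall x, i x \in U,
        forall w, w \in W -> p w = 0 & forall u, u \in U -> u - i (p u) \in W].
Proof.
move=> WU; set C := (U :\: W)%VS.
have CW : (C :&: W = 0)%VS by apply: capv_diff.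
have CU : (C + W)%VS = U by rewrite addv_diff; apply/addv_idPl.
exists (subvs_of C), (linfun vsval), (linfun (vsproj C) \o daddv_pi C W)%VF.
split=> [x|x|w wW|u uU].
- by rewrite comp_lfunE !lfunE /= daddv_pi_id ?vsvalK ?subvsP.
- by rewrite lfunE /= (subvP (diffvSl U W)) ?subvsP.
- rewrite comp_lfunE; have := @daddv_pi_add _ _ C W w CW.
  rewrite (@daddv_pi_id _ _ W C) 1?capvC // CU (subvP WU) // => /(_ isT).
  by move/(canRL (addrK _)); rewrite subrr => ->; rewrite linear0.
- have := @daddv_pi_add _ _ C W u CW; rewrite CU uU => /(_ isT) {1}<-.
  by rewrite comp_lfunE !lfunE /= vsprojK ?memv_pi // addrC addKr memv_pi.
Qed.

Lemma quotient_space V (W : {vspace V}) :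
  exists (X : vectType F) (p : 'Hom(V, X)), limg p = fullv /\ lker p = W.
Proof.
have [X [i [p [pi _ pW ipW]]]] := subquotient (subvf W).
exists X, p; split.
  by apply/vspaceP=> x; rewrite memvf -(pi x) memv_img ?memvf.
apply/vspaceP=> v; rewrite memv_ker; apply/eqP/idP=> [pv|/pW //].
by have := ipW v (memvf v); rewrite pv linear0 subr0.
Qed.

Definition stab V (f : 'End(V)) (U : {vspace V}) :=
  forall u, u \in U -> f u \in U.

Lemma iter_stab V (f : 'End(V)) U n u : stab f U -> u \in U -> iter n f u \in U.
Proof. by move=> fU uU; elim: n => //= n /fU. Qed.

Lemma iter_lin V (f : 'End(V)) n : linear (iter n f).
Proof. by elim: n => [|n IH] a x y //=; rewrite IH linearP. Qed.

Lemma iter0 V (f : 'End(V)) n : iter n f 0 = 0.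
Proof. by elim: n => //= n ->; rewrite linear0. Qed.

Lemma iter_commute V (f g : 'End(V)) n x :
  (forall x, f (g x) = g (f x)) -> f (iter n g x) = iter n g (f x).
Proof. by move=> fg; elim: n => //= n <-; rewrite fg. Qed.

Lemma iter_eq0_leq V (f : 'End(V)) m n v :
  iter m f v = 0 -> (m <= n)%N -> iter n f v = 0.
Proof. by move=> fv /subnK <-; rewrite iterD fv iter0. Qed.

Lemma nilp_uniform V (f : 'End(V)) (U : {vspace V}) :
  (forall u, u \in U -> exists n, iter n f u = 0) ->
  exists n, forall u, u \in U -> iter n f u = 0.
Proof.
move=> nilf; have nE m : exists n, forall i, (i < m)%N -> iter n f (vbasis U)`_i = 0.
  elim: m => [|m [n nE]]; first by exists 0%N.
  have [k kE] : exists k, iter k f (vbasis U)`_m = 0.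
    case: (ltnP m (size (vbasis U))) => [ms|sm]; last first.
      by exists 0%N; rewrite /= nth_default.
    exact/nilf/vbasis_mem/mem_nth.
  exists (maxn n k) => i; rewrite ltnS leq_eqVlt => /orP[/eqP ->|/nE fi].
    exact: iter_eq0_leq kE (leq_maxr _ _).
  exact: iter_eq0_leq fi (leq_maxl _ _).
have [n {}nE] := nE (\dim U).
exists n => u uU; rewrite (coord_vbasis uU).
pose g := linfun (iter n f); have gE := linfun_linE (@iter_lin V f n).
by rewrite -gE linear_sum big1 // => i _; rewrite linearZ /= gE nE ?scaler0.
Qed.

(** No binomial expansion is made: one application of [g + h] yields a sum of two vectors, for each
    of which one of the two exponents has dropped by one. *)
Lemma nilp_add V (g h : 'End(V)) : (forall x, g (h x) = h (g x)) ->
  forall m v a b, (a + b <= m)%N -> iter a g v = 0 -> iter b h v = 0 ->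
  iter m (g + h) v = 0.
Proof.
move=> gh; elim=> [|m IH] v a b abm ga hb.
  by move: abm ga; rewrite leqn0 addn_eq0 => /andP[/eqP -> _] /= ->.
rewrite iterSr add_lfunE.
have -> : iter m (g + h) (g v + h v) = iter m (g + h) (g v) + iter m (g + h) (h v).
  by rewrite -{1}[g v]scale1r iter_lin scale1r.
case: a => [|a] in abm ga *; first by rewrite -[v]/(iter 0 g v) ga !linear0 !iter0 addr0.
case: b => [|b] in abm hb *; first by rewrite -[v]/(iter 0 h v) hb !linear0 !iter0 addr0.
rewrite (IH (g v) a b.+1) ?(IH (h v) a.+1 b) ?addr0 //; rewrite -?iterSr //;
  try lia.
- by rewrite -(iter_commute _ _ (fun x => esym (gh x))) ga linear0.
- by rewrite -(iter_commute _ _ gh) hb linear0.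
Qed.

(** The exponent may depend on the vector; the spanning set is already a subspace ([genEP]), and
    [nilp_uniform] supplies a common exponent when one is wanted. *)
Definition genE V (f : 'End(V)) (mu : F) : {vspace V} :=
  spanp (fun v => exists n, iter n (f - mu *: \1%VF) v = 0).

Lemma genEP V (f : 'End(V)) mu v :
  v \in genE f mu <-> exists n, iter n (f - mu *: \1%VF) v = 0.
Proof.
apply: mem_spanp => [|a x y [n nx] [m my]]; first by exists 0%N.
exists (n + m)%N; rewrite iter_lin.
rewrite (iter_eq0_leq nx (leq_addr _ _)) (iter_eq0_leq my (leq_addl _ _)).
by rewrite scaler0 addr0.
Qed.

Lemma shiftE V (f : 'End(V)) mu v : (f - mu *: \1%VF) v = f v - mu *: v.
Proof. by rewrite add_lfunE opp_lfunE scale_lfunE id_lfunE. Qed.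

Lemma eigen_genE V (f : 'End(V)) mu v : f v = mu *: v -> v \in genE f mu.
Proof. by move=> fv; apply/genEP; exists 1%N; rewrite /= shiftE fv subrr. Qed.

Lemma genE_commute V (f g : 'End(V)) mu :
  (forall x, f (g x) = g (f x)) -> stab g (genE f mu).
Proof.
move=> fg v /genEP[n nv]; apply/genEP; exists n.
by rewrite -iter_commute ?nv ?linear0 // => x; rewrite !shiftE linearB linearZ /= fg.
Qed.

Lemma genE_stab V (f : 'End(V)) mu : stab f (genE f mu).
Proof. exact: genE_commute. Qed.

Lemma shift_stab V (f : 'End(V)) mu U : stab f U -> stab (f - mu *: \1%VF) U.
Proof. by move=> fU u uU; rewrite shiftE memvB ?memvZ ?fU. Qed.

Lemma genE_shift_inj V (f : 'End(V)) mu nu v : mu != nu -> v \in genE f mu ->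
  f v = nu *: v -> v = 0.
Proof.
move=> mn /genEP[n nv] fv; apply/eqP; move: nv.
suff -> : iter n (f - mu *: \1%VF) v = (nu - mu) ^+ n *: v.
  by move/eqP; rewrite scaler_eq0 expf_eq0 subr_eq0 eq_sym (negbTE mn) andbF.
elim: n => [|n IH] /=; first by rewrite scale1r.
by rewrite IH linearZ /= shiftE fv -scalerBl scalerA -exprSr.
Qed.

Lemma genE_iter_inj V (f : 'End(V)) mu nu v n : mu != nu -> v \in genE f mu ->
  iter n (f - nu *: \1%VF) v = 0 -> v = 0.
Proof.
move=> mn; elim: n v => // n IH v vE; rewrite iterSr => /IH fv0.
apply: (genE_shift_inj mn vE); apply/eqP; rewrite -subr_eq0 -shiftE.
by apply/eqP/fv0/shift_stab => //; apply: genE_stab.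
Qed.

Lemma genE_sum_stab V (f : 'End(V)) s : stab f (\sum_(nu <- s) genE f nu)%VS.
Proof.
move=> u; elim: s u => [|nu s IH] u; first by rewrite big_nil !memv0 => /eqP ->; rewrite linear0.
rewrite big_cons => /memv_addP[a aE [b bE ->]]; rewrite linearD.
by rewrite memv_add ?IH // genE_stab.
Qed.

(** A power of [f - nu] that kills the component for the first eigenvalue [nu] of the list is
    injective on [genE f mu], which shortens the list. *)
Lemma genE_indep V (f : 'End(V)) s mu : mu \notin s ->
  (genE f mu :&: \sum_(nu <- s) genE f nu)%VS = 0%VS.
Proof.
move=> mus; apply/eqP; rewrite -subv0; apply/subvP=> v; rewrite memv_cap memv0.
case/andP=> vE vs; apply/eqP; elim: s v mus vE vs => [|nu s IH] v.
  by rewrite big_nil memv0 => _ _ /eqP.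
rewrite inE negb_or big_cons => /andP[mn mus] vE /memv_addP[a aE [b bE vab]].
have [n na] := proj1 (genEP _ _ _) aE.
apply: (genE_iter_inj mn vE (n := n)).
apply: IH => //; first by apply: iter_stab => //; apply/shift_stab/genE_stab.
rewrite vab -[a]scale1r iter_lin na scaler0 add0r.
by apply: iter_stab => //; apply/shift_stab/genE_sum_stab.
Qed.

(** Diagonalizability without a basis: over an algebraically closed field the spaces [genE f mu]
    span, so it suffices that each consists of eigenvectors. [diagble_basis] compares this with
    bases of eigenvectors. *)
Definition diagble V (f : 'End(V)) :=
  forall mu v, v \in genE f mu -> f v = mu *: v.

End Toolkit.

(** * Functions of an operator and the Jordan decomposition *)

Section Spectral.
Variable F : numClosedFieldType.
Implicit Types V : vectType F.

Lemma eigenvector_ex V (f : 'End(V)) (U : {vspace V}) : stab f U -> U != 0%VS ->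
  exists u a, [/\ u \in U, u != 0 & f u = a *: u].
Proof.
move=> fU U0; pose g := linfun (fun x => vsproj U (f (vsval x))) : 'End(subvs_of U).
have gE x : vsval (g x) = f (vsval x).
  rewrite linfun_linE ?vsprojK ?fU ?subvsP //= => a y z.
  by rewrite !linearP.
pose A := f2mx g.
have [a Aa] : exists a, root (char_poly A) a.
  apply/closed_rootP; rewrite size_char_poly eqSS.
  by rewrite -dimvf dimv_eq0; apply: contra U0 => /eqP U0;
    rewrite -dimv_eq0 -[\dim U]/(dim (subvs_of U)) -dimvf U0 dimv0.
move: Aa; rewrite -eigenvalue_root_char => /eigenvalueP[v vA v0].
pose x := r2v v; exists (vsval x), a; split.
- exact: subvsP.
- apply: contra v0 => /eqP x0; have {}x0 : x = 0 by apply/val_inj.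
  by apply/eqP/r2v_inj; rewrite linear0.
- rewrite -gE -linearZ; congr vsval; apply: v2r_inj.
  by rewrite unlock /= r2vK linearZ /= r2vK.
Qed.

(** Fitting decomposition: for an eigenvalue [a] of [f] on [U] and a uniform exponent [m], the
    kernel and the image of [(f - a)^m] on [U] are complementary and stable, and the image has
    smaller dimension. *)
Lemma genE_decomp V (f : 'End(V)) (U : {vspace V}) : stab f U ->
  exists s, (U <= \sum_(mu <- s) (U :&: genE f mu))%VS.
Proof.
have [n] := ubnP (\dim U); elim: n U => // n IH U; rewrite ltnS => dU fU.
have [->|U0] := eqVneq U 0%VS; first by exists [::]; rewrite sub0v.
have [u [a [uU u0 fu]]] := eigenvector_ex fU U0.
have [m mE] : exists m, forall u, u \in (U :&: genE f a)%VS ->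
    iter m (f - a *: \1%VF) u = 0.
  by apply: nilp_uniform => w; rewrite memv_cap => /andP[_ /genEP].
pose g := linfun (iter m (f - a *: \1%VF)).
have gE x : g x = iter m (f - a *: \1%VF) x := linfun_linE (@iter_lin _ _ _ m) x.
have gU : (g @: U <= U)%VS.
  apply/subvP=> _ /memv_imgP[w wU ->]; rewrite gE.
  exact/iter_stab/wU/shift_stab.
have kerg : (U :&: lker g)%VS = (U :&: genE f a)%VS.
  apply/vspaceP=> w; rewrite !memv_cap memv_ker; apply: andb_id2l => wU.
  rewrite gE; apply/eqP/idP=> [gw|wE]; first by apply/genEP; exists m.
  by apply: mE; rewrite memv_cap wU.
have dsum := limg_ker_dim g U; rewrite kerg in dsum.
have cap0 : (U :&: genE f a :&: (g @: U) = 0)%VS.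
  apply/eqP; rewrite -subv0; apply/subvP=> z /memv_capP[].
  rewrite memv_cap => /andP[_ wE] /memv_imgP[w wU wg]; rewrite {}wg in wE *.
  have wk : w \in genE f a.
    have [k wk] := proj1 (genEP _ _ _) wE; apply/genEP; exists (k + m)%N.
    by rewrite iterD -gE.
  by rewrite memv0 gE mE ?memv_cap ?wU.
have sumU : (U :&: genE f a + g @: U)%VS = U.
  apply/eqP; rewrite eqEdim subv_add capvSl gU /=.
  by rewrite dimv_disjoint_sum // dsum.
have fg : stab f (g @: U).
  move=> _ /memv_imgP[w wU ->]; rewrite gE iter_commute -?gE.
    by rewrite memv_img ?fU.
  by move=> x; rewrite !shiftE linearB linearZ.
have [|s sE] := IH (g @: U)%VS _ fg.
  apply: leq_trans dU; rewrite -dsum -[X in (X < _)%N]add0n ltn_add2r lt0n dimv_eq0.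
  apply: contra u0 => /eqP E0; rewrite -memv0 -E0 memv_cap uU /=.
  by apply: eigen_genE.
exists (a :: s); rewrite big_cons -{1}sumU addvS //.
apply: subv_trans sE _; elim/big_ind2: _ => // [*|i _]; first exact: addvS.
exact: capvS.
Qed.

Lemma genE_ind V (f : 'End(V)) (U : {vspace V}) (P : V -> Prop) : stab f U ->
  P 0 -> (forall a x y, P x -> P y -> P (a *: x + y)) ->
  (forall mu v, v \in U -> v \in genE f mu -> P v) -> forall v, v \in U -> P v.
Proof.
move=> fU P0 PD PE v vU; have [s /subvP/(_ v vU)] := genE_decomp fU.
elim: s v {vU} => [|mu s IH] v; first by rewrite big_nil memv0 => /eqP ->.
rewrite big_cons => /memv_addP[a + [b /IH bE ->]]; rewrite memv_cap => /andP[aU aE].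
by rewrite -[a]scale1r; apply: PD => //; apply: PE aE.
Qed.

Lemma lfun_genE_eq V (W : vectType F) (f : 'End(V)) (g h : 'Hom(V, W)) :
  (forall mu v, v \in genE f mu -> g v = h v) -> g = h.
Proof.
move=> gh; apply/lfunP=> v; move: v (memvf v); apply: (@genE_ind _ f).
- by move=> *; apply: memvf.
- by rewrite !linear0.
- by move=> a x y gx gy; rewrite !lfP gx gy.
- by move=> mu v _ /gh.
Qed.

Lemma genE_full V (f : 'End(V)) :
  exists2 s, uniq s & fullv = (\sum_(mu <- s) genE f mu)%VS.
Proof.
have [|s sE] := @genE_decomp V f fullv; first by move=> *; apply: memvf.
exists (undup s); first exact: undup_uniq.
apply/esym/eqP; rewrite eqEsubv subvf (subv_trans sE) //=.
rewrite big_undup; last exact: addvv.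
by elim/big_ind2: _ => // [*|i _]; [exact: addvS | exact: capvSr].
Qed.

Lemma genE_notin V (f : 'End(V)) s mu : fullv = (\sum_(mu <- s) genE f mu)%VS ->
  mu \notin s -> genE f mu = 0%VS.
Proof. by move=> sE /(genE_indep f); rewrite -sE capvf. Qed.

(** [phi] is arbitrary on purpose. The identity gives the semisimple part, indicator functions give
    spectral projections, conjugation serves Cartan's criterion, and inversion gives a partial
    inverse. *)
Lemma fcal_ex V (f : 'End(V)) (phi : F -> F) :
  exists h : 'End(V), forall mu v, v \in genE f mu -> h v = phi mu *: v.
Proof.
have [s us sE] := genE_full f.
suff [h hE] : exists h : 'End(V),
    forall mu v, mu \in s -> v \in genE f mu -> h v = phi mu *: v.
  exists h => mu v vE; have [|mus] := boolP (mu \in s); first by move/hE; apply.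
  move: vE; rewrite (genE_notin sE mus) memv0 => /eqP ->.
  by rewrite linear0 scaler0.
elim: s us {sE} => [_|mu s IH /= /andP[mus us]]; first by exists 0.
have [h hE] := IH us; have X0 := genE_indep f mus.
set X := genE f mu in X0; set Y := (\sum_(_ <- _) _)%VS in X0.
have XY := @daddv_pi_add _ _ X Y ^~ X0.
exists (phi mu *: daddv_pi X Y + (h \o daddv_pi Y X))%VF => nu v.
rewrite inE add_lfunE scale_lfunE comp_lfunE => /orP[/eqP ->|nus] vE.
  have := XY v (subvP (addvSl X Y) _ vE); rewrite daddv_pi_id // => /(canRL (addKr _)).
  by rewrite addNr => ->; rewrite linear0 addr0.
have vY : v \in Y.
  rewrite /Y (big_rem nu) //=; apply: subvP vE; exact: addvSl.
have := XY v (subvP (addvSr X Y) _ vY); rewrite (@daddv_pi_id _ _ Y X) 1?capvC //.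
by move/(canRL (addrK _)); rewrite subrr => ->; rewrite scaler0 add0r (hE nu).
Qed.

(* [fcal phi f] is phi applied to the semisimple part of f, which is [fcal id f]. *)
Definition fcal V (phi : F -> F) (f : 'End(V)) : 'End(V) := projT1 (cid (fcal_ex f phi)).

Lemma fcalE V (f : 'End(V)) phi mu v : v \in genE f mu -> fcal phi f v = phi mu *: v.
Proof. exact: (projT2 (cid (fcal_ex f phi))). Qed.

Lemma fcal_uniq V (f h : 'End(V)) phi :
  (forall mu v, v \in genE f mu -> h v = phi mu *: v) -> h = fcal phi f.
Proof. by move=> hE; apply: (@lfun_genE_eq _ _ f) => mu v vE; rewrite (hE mu) // (fcalE _ vE). Qed.

Lemma fcal_stab V (f : 'End(V)) phi U : stab f U -> stab (fcal phi f) U.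
Proof.
move=> fU; apply: (genE_ind fU) => [|a x y xU yU|mu v vU vE].
- by rewrite linear0 mem0v.
- by rewrite linearP memvD ?memvZ.
- by rewrite (fcalE _ vE) memvZ.
Qed.

(** This replaces the fact that such an operator is a polynomial in [f] without constant term. For
    [mu] nonzero, [mu *: v] is [f v] minus [(f - mu) v]; the first lies in [W] by assumption, the
    second by induction on the exponent killing [v]. *)
Lemma fcal_img V (f : 'End(V)) phi (U W : {vspace V}) : phi 0 = 0 -> stab f U ->
  (forall u, u \in U -> f u \in W) -> forall u, u \in U -> fcal phi f u \in W.
Proof.
move=> phi0 fU fW; apply: (genE_ind fU) => [|a x y xU yU|mu v vU vE].
- by rewrite linear0 mem0v.
- by rewrite linearP memvD ?memvZ.
rewrite (fcalE _ vE); have [->|mu0] := eqVneq mu 0; first by rewrite phi0 scale0r mem0v.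
apply: memvZ; have [n nv] := proj1 (genEP _ _ _) vE.
elim: n v vU {vE} nv => [|n IH] v vU; first by move=> /= ->; rewrite mem0v.
rewrite iterSr => /IH-/(_ (shift_stab _ fU vU)); rewrite shiftE => fvW.
rewrite -(scalerK mu0 v); apply: memvZ.
by rewrite -[mu *: v](subKr (f v)) memvB ?fW.
Qed.

Lemma fcal_commute V (f g : 'End(V)) phi : (forall x, f (g x) = g (f x)) ->
  forall x, fcal phi f (g x) = g (fcal phi f x).
Proof.
move=> fg x; rewrite -!comp_lfunE; move: x; apply/lfunP.
apply: (@lfun_genE_eq _ _ f) => mu v vE; rewrite !comp_lfunE.
by rewrite (fcalE _ vE) (fcalE _ (genE_commute fg vE)) linearZ.
Qed.

Lemma fcal_self V (f : 'End(V)) phi x : f (fcal phi f x) = fcal phi f (f x).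
Proof. by rewrite fcal_commute. Qed.

Lemma genE_nilp_add V (f n : 'End(V)) mu v : (forall x, f (n x) = n (f x)) ->
  (forall x, exists m, iter m n x = 0) -> v \in genE f mu -> v \in genE (f + n) mu.
Proof.
move=> fn nn /genEP[a av]; have [b bv] := nn v; apply/genEP; exists (a + b)%N.
rewrite -addrAC; apply: (nilp_add _ (leqnn _)) => // x.
by rewrite !shiftE lfB lfZ fn.
Qed.

Lemma fcal_diagble V (f : 'End(V)) phi : diagble (fcal phi f).
Proof.
move=> mu v vE.
suff: forall x, x \in genE (fcal phi f) mu -> fcal phi f x = mu *: x by apply.
apply: (@genE_ind _ f).
- by apply: genE_commute => x; rewrite fcal_self.
- by rewrite linear0 scaler0.
- by move=> a x y xE yE; rewrite lfP xE yE scalerDr !scalerA mulrC.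
move=> nu x xE xnu; rewrite (fcalE _ xnu).
have [->//|pm] := eqVneq (phi nu) mu.
rewrite (@genE_shift_inj _ _ _ _ (phi nu) _ _ xE) ?scaler0 1?eq_sym //.
by rewrite (fcalE _ xnu).
Qed.

Lemma fcal_id_nilp V (f : 'End(V)) x : exists m, iter m (f - fcal id f) x = 0.
Proof.
move: x (memvf x); apply: (@genE_ind _ f); first by move=> *; apply: memvf.
- by exists 0%N.
- move=> a x y [n nx] [m my]; exists (n + m)%N; rewrite iter_lin.
  rewrite (iter_eq0_leq nx (leq_addr _ _)) (iter_eq0_leq my (leq_addl _ _)).
  by rewrite scaler0 addr0.
move=> mu v _ vE; have [n nv] := proj1 (genEP _ _ _) vE; exists n.
elim: n v vE nv => // n IH v vE; rewrite !iterSr shiftE add_lfunE opp_lfunE.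
rewrite (fcalE _ vE) => /IH; apply.
by rewrite -shiftE; apply/shift_stab/vE; apply: genE_stab.
Qed.

(** Uniqueness of the Jordan decomposition: [d] differs from [f] by a commuting nilpotent operator,
    so each [genE f mu] lies in [genE d mu], where [d] is scalar. *)
Lemma fcal_id_uniq V (f d : 'End(V)) : diagble d -> (forall x, f (d x) = d (f x)) ->
  (forall x, exists m, iter m (f - d) x = 0) -> d = fcal id f.
Proof.
move=> dd fd nn; apply: fcal_uniq => mu v vE; apply: dd.
have -> : d = f - (f - d) by rewrite subKr.
apply: genE_nilp_add => // [x|x].
  by rewrite !lfE lfN lfB fd.
have [m mx] := nn x; exists m.
by elim: m x mx => // m IH x; rewrite !iterSr => /IH; rewrite opp_lfunE iterN_lin => ->; rewrite oppr0.
Qed.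

Lemma fcal_id_diagble V (f : 'End(V)) : diagble f -> fcal id f = f.
Proof. by move=> df; apply/esym/fcal_uniq. Qed.

(** Simultaneous diagonalization: a generalized eigenspace of [f - g] splits under [f], then under
    [g]. On a common eigenvector [f - g] acts by [a - b], which must be [mu] unless the vector is
    zero. *)
Lemma diagble_sub_nilp V (f g : 'End(V)) : diagble f -> diagble g ->
  (forall x, f (g x) = g (f x)) -> diagble (f - g).
Proof.
move=> df dg fg mu v vE.
suff: forall x, x \in genE (f - g) mu -> (f - g) x = mu *: x by apply.
have cfg x : (f - g) (f x) = f ((f - g) x).
  by rewrite !lfE lfB fg.
have cgg x : (f - g) (g x) = g ((f - g) x).
  by rewrite !lfE lfB fg.
apply: (@genE_ind _ f) => [||a x y xE yE|a x xE xa].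
- exact: genE_commute.
- by rewrite linear0 scaler0.
- by rewrite lfP xE yE scalerDr !scalerA mulrC.
have: x \in (genE (f - g) mu :&: genE f a)%VS by rewrite memv_cap xE.
move: x {xE xa}; apply: (@genE_ind _ g) => [||c x y xE yE|b x].
- move=> x; rewrite !memv_cap => /andP[xE xa]; rewrite (genE_commute cgg) //=.
  exact: genE_commute.
- by rewrite linear0 scaler0.
- by rewrite lfP xE yE scalerDr !scalerA mulrC.
rewrite memv_cap => /andP[xE /df fx] /dg gx.
have fgx : (f - g) x = (a - b) *: x by rewrite add_lfunE opp_lfunE fx gx scalerBl.
have [<-//|ab] := eqVneq (a - b) mu.
by rewrite (genE_shift_inj _ xE fgx) 1?eq_sym // linear0 scaler0.
Qed.

(** The Leibniz hypothesis is confined to stable subspaces [X] and [Y], because left multiplications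
    of a Malcev algebra satisfy it only against suitable arguments, such as Lie central ones. *)
Lemma genE_bilin V1 V2 V3 (b : V1 -> V2 -> V3) (f : 'End(V1)) (g : 'End(V2))
    (h : 'End(V3)) (X : {vspace V1}) (Y : {vspace V2}) mu nu x y :
  (forall u, linear (b u)) -> (forall v, linear (b^~ v)) ->
  stab f X -> stab g Y ->
  (forall x y, x \in X -> y \in Y -> h (b x y) = b (f x) y + b x (g y)) ->
  x \in X -> y \in Y -> x \in genE f mu -> y \in genE g nu ->
  b x y \in genE h (mu + nu).
Proof.
move=> bl br fX gY hb xX yY /genEP[m mx] /genEP[n ny]; apply/genEP.
exists (m + n)%N.
have [b0 b0'] := (fun z => lin_0 (br z), fun z => lin_0 (bl z)).
have: (m + n <= m + n)%N by []; move: {2 3}(m + n)%N => k.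
elim: k m n x y xX yY mx ny => [|k IH] m n x y xX yY mx ny mn.
  by move: mn mx; rewrite leqn0 addn_eq0 => /andP[/eqP -> _] /= ->; rewrite b0.
rewrite iterSr shiftE hb //.
have -> : b (f x) y + b x (g y) - (mu + nu) *: b x y =
    1 *: b ((f - mu *: \1%VF) x) y + b x ((g - nu *: \1%VF) y).
  have E1 : b ((f - mu *: \1%VF) x) y = b (f x) y - mu *: b x y.
    by rewrite shiftE (lin_B _ _ (br y)) (lin_Z _ _ (br y)).
  have E2 : b x ((g - nu *: \1%VF) y) = b x (g y) - nu *: b x y.
    by rewrite shiftE (lin_B _ _ (bl x)) (lin_Z _ _ (bl x)).
  by rewrite E1 E2; vring.
rewrite iter_lin scale1r.
case: m => [|m] in mn mx *.
  by rewrite -[x]/(iter 0 (f - mu *: \1%VF) x) mx lf0 !b0 iter0 addr0.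
case: n => [|n] in mn ny *.
  by rewrite -[y]/(iter 0 (g - nu *: \1%VF) y) ny lf0 !b0' iter0 addr0.
rewrite (IH m n.+1) ?(IH m.+1 n) ?addr0 //; try (by rewrite -iterSr);
  by [lia | apply: shift_stab].
Qed.

Lemma fcal_bilin V1 V2 V3 (b : V1 -> V2 -> V3) (f : 'End(V1)) (g : 'End(V2))
    (h : 'End(V3)) (X : {vspace V1}) (Y : {vspace V2}) phi x y :
  (forall u, linear (b u)) -> (forall v, linear (b^~ v)) ->
  stab f X -> stab g Y -> (forall mu nu, phi (mu + nu) = phi mu + phi nu) ->
  (forall x y, x \in X -> y \in Y -> h (b x y) = b (f x) y + b x (g y)) ->
  x \in X -> y \in Y ->
  fcal phi h (b x y) = b (fcal phi f x) y + b x (fcal phi g y).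
Proof.
move=> bl br fX gY phiD hb.
have b0y z : b 0 z = 0 := lin_0 (br z).
have bx0 z : b z 0 = 0 := lin_0 (bl z).
have bP a u v z : b (a *: u + v) z = a *: b u z + b v z := br z a u v.
have bP' a u v z : b z (a *: u + v) = a *: b z u + b z v := bl z a u v.
move=> xX yY; move: x xX; apply: (genE_ind fX) => [|a x1 x2 E1 E2|mu x xX xE].
- by rewrite !linear0 !b0y linear0 addr0.
- by rewrite lfP !bP lfP E1 E2; vring.
move: y yY; apply: (genE_ind gY) => [|a y1 y2 E1 E2|nu y yY yE].
- by rewrite !linear0 !bx0 linear0 addr0.
- by rewrite lfP !bP' lfP E1 E2; vring.
rewrite (fcalE _ xE) (fcalE _ yE) (fcalE _ (genE_bilin bl br fX gY hb xX yY xE yE)).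
have -> : b (phi mu *: x) y = phi mu *: b x y.
  exact: (lin_Z _ _ (br y)).
have -> : b x (phi nu *: y) = phi nu *: b x y.
  exact: (lin_Z _ _ (bl x)).
by rewrite phiD scalerDl.
Qed.

End Spectral.

(** * Traces *)

Section MatrixTrace.
Variable F : fieldType.

(** With a rank factorization [M = C *m B], the product [B *m C] has the same trace and a nilpotency
    index smaller by one, since [C] and [B] can be cancelled in [M^(m+1) = C (BC)^m B]. *)
Lemma mxtrace_nilp m : forall n (M : 'M[F]_n), iter m (mulmx M) 1%:M = 0 -> \tr M = 0.
Proof.
elim: m => [|m IH] n M; first by move=> /= M1; rewrite -[M]mulmx1 M1 mulmx0 mxtrace0.
set C := col_base M; set B := row_base M; have MCB : C *m B = M := mulmx_base M.
have powE k : iter k.+1 (mulmx M) 1%:M = C *m iter k (mulmx (B *m C)) 1%:M *m B.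
  elim: k => [|k IHk]; first by rewrite /= !mulmx1 MCB.
  by rewrite iterS IHk -{1}MCB /= !mulmxA.
rewrite powE => CNB; rewrite -MCB mxtrace_mulC; apply: IH.
apply: (row_full_inj (col_base_full M)); apply: (row_free_inj (row_base_free M)).
by rewrite CNB mulmx0 mul0mx.
Qed.

Lemma mxtrace_idem n (M : 'M[F]_n) : M *m M = M -> \tr M = (\rank M)%:R.
Proof.
move=> MM; set C := col_base M; set B := row_base M.
have MCB : C *m B = M := mulmx_base M.
have BC : B *m C = 1%:M.
  apply: (row_full_inj (col_base_full M)); apply: (row_free_inj (row_base_free M)).
  by rewrite -/C -/B mulmx1 mulmxA MCB -mulmxA MCB MM.
by rewrite -{1}MCB mxtrace_mulC BC mxtrace1.
Qed.

End MatrixTrace.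

Section LfunTrace.
Variables (F : fieldType) (V : vectType F).
Implicit Types f g h : 'End(V).

Definition trl (f : 'End(V)) : F := \tr (f2mx f).

Lemma f2mxE f u : u *m f2mx f = v2r (f (r2v u)).
Proof. by rewrite unlock /= !r2vK. Qed.

Lemma f2mx_ext (A B : 'M[F]_(dim V)) : (forall u : 'rV_(dim V), u *m A = u *m B) -> A = B.
Proof. by move=> AB; apply/row_matrixP=> i; rewrite !rowE. Qed.

Lemma f2mx_comp f g : f2mx (f *o g) = f2mx g *m f2mx f.
Proof. by apply: f2mx_ext => u; rewrite mulmxA !f2mxE comp_lfunE v2rK. Qed.

Lemma f2mxP a f g : f2mx (a *: f + g) = a *: f2mx f + f2mx g.
Proof.
by apply: f2mx_ext => u; rewrite mulmxDr -scalemxAr !f2mxE !lfE linearD linearZ.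
Qed.

Lemma trl_comp f g : trl (f *o g) = trl (g \o f)%VF.
Proof. by rewrite /trl !f2mx_comp mxtrace_mulC. Qed.

Lemma trlP a f g : trl (a *: f + g) = a * trl f + trl g.
Proof. by rewrite /trl f2mxP mxtraceD mxtraceZ. Qed.

Lemma trl0 : trl 0 = 0.
Proof. by have := trlP (-1) 0 0; rewrite scaler0 addr0 mulN1r addNr. Qed.

Lemma trlD f g : trl (f + g) = trl f + trl g.
Proof. by have := trlP 1 f g; rewrite scale1r mul1r. Qed.

Lemma trlZ a f : trl (a *: f) = a * trl f.
Proof. by have := trlP a f 0; rewrite !addr0 trl0 addr0. Qed.

Lemma trlN f : trl (- f) = - trl f.
Proof. by rewrite -scaleN1r trlZ mulN1r. Qed.

Lemma trlB f g : trl (f - g) = trl f - trl g.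
Proof. by rewrite trlD trlN. Qed.

Lemma trl_sum I (r : seq I) (f_ : I -> 'End(V)) :
  trl (\sum_(i <- r) f_ i) = \sum_(i <- r) trl (f_ i).
Proof. by elim/big_rec2: _ => [|i y1 y2 _ E]; rewrite ?trl0 ?trlD ?E. Qed.

Lemma trl_nilp f : (forall x, exists m, iter m f x = 0) -> trl f = 0.
Proof.
move=> nf; have [m mE] : exists m, forall u, u \in fullv -> iter m f u = 0.
  by apply: nilp_uniform => u _.
have powE k x : v2r (iter k f x) = v2r x *m iter k (mulmx (f2mx f)) 1%:M.
  elim: k x => [|k IH] x; first by rewrite mulmx1.
  by rewrite iterSr IH /= mulmxA f2mxE v2rK.
apply: (@mxtrace_nilp _ m); apply: f2mx_ext => u.
by rewrite -[u]r2vK -powE mE ?memvf // linear0 mulmx0.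
Qed.

Lemma trl_idem f : (f \o f)%VF = f -> exists2 r : nat, trl f = r%:R & (r = 0%N -> f = 0).
Proof.
move=> ff; exists (\rank (f2mx f)); first by apply: mxtrace_idem; rewrite -f2mx_comp ff.
move/eqP; rewrite mxrank_eq0 => /eqP f0; apply/lfunP=> x; rewrite lfE.
by apply: v2r_inj; rewrite -[x]v2rK -f2mxE f0 mulmx0 linear0.
Qed.

Lemma trl_comm f g h : trl (f *o lbr g h) = trl (lbr f g *o h).
Proof.
have -> : f *o lbr g h = f *o g *o h - f *o h *o g.
  by apply/lfunP=> x; rewrite !(lfE, lbrE) lfB.
have -> : lbr f g *o h = f *o g *o h - g *o (f *o h).
  by apply/lfunP=> x; rewrite !(lfE, lbrE).
by rewrite !trlB [X in _ - X]trl_comp.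
Qed.

End LfunTrace.

Section SpectralTrace.
Variables (F : numClosedFieldType) (V : vectType F).
Implicit Types f g h : 'End(V).

(** The trace is the sum of [phi mu] weighted by the ranks of the spectral projections [e mu]. If a
    sum of nonnegative terms vanishes, then so does each term, and a projection of rank zero is
    zero. *)
Lemma fcal_ge0_tr0 f phi : (forall mu, 0 <= phi mu) -> trl (fcal phi f) = 0 ->
  forall mu v, v \in genE f mu -> phi mu != 0 -> v = 0.
Proof.
move=> phi_ge0; have [s us sE] := genE_full f.
pose e mu : 'End(V) := fcal (fun nu => (nu == mu)%:R) f.
have -> : fcal phi f = \sum_(mu <- s) phi mu *: e mu.
  apply/esym/fcal_uniq => nu v vE; rewrite sum_lfunE.
  have [nus|nus] := boolP (nu \in s); last first.
    move: vE; rewrite (genE_notin sE nus) memv0 => /eqP ->; rewrite scaler0.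
    by rewrite big1 // => i _; rewrite lf0.
  rewrite (bigD1_seq nu) //= big1 ?addr0 => [|i in'].
    by rewrite lfE (fcalE _ vE) eqxx scale1r.
  by rewrite lfE (fcalE _ vE) eq_sym (negbTE in') scale0r scaler0.
have eI mu : exists2 r : nat, trl (e mu) = r%:R & (r = 0%N -> e mu = 0).
  apply: trl_idem; apply: (@lfun_genE_eq _ _ _ f) => nu v vE.
  rewrite comp_lfunE (fcalE _ vE) lfZ (fcalE _ vE) scalerA -natrM mulnb andbb //.
rewrite trl_sum => /eqP; rewrite psumr_eq0 => [/allP sum0 mu v vE phi0|mu _].
  have [mus|mus] := boolP (mu \in s); last first.
    by move: vE; rewrite (genE_notin sE mus) memv0 => /eqP.
  have := sum0 mu mus; rewrite trlZ /= mulf_eq0 (negbTE phi0) /=.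
  have [r -> r0] := eI mu; rewrite pnatr_eq0 => /eqP/r0 e0.
  by have := fcalE (fun nu => (nu == mu)%:R) vE; rewrite eqxx scale1r -/(e mu) e0 lfE.
by rewrite trlZ; have [r -> _] := eI mu; rewrite mulr_ge0 ?ler0n.
Qed.

Lemma fcal_comp f phi psi : (fcal phi f \o fcal psi f)%VF = fcal (fun mu => phi mu * psi mu) f.
Proof.
apply: fcal_uniq => mu v vE; rewrite comp_lfunE (fcalE _ vE) lfZ (fcalE _ vE).
by rewrite scalerA mulrC.
Qed.

Lemma nilp_comp f g : (forall x, f (g x) = g (f x)) ->
  (forall x, exists m, iter m f x = 0) -> forall x, exists m, iter m (f *o g) x = 0.
Proof.
move=> fg nf x; have [m mx] := nf x; exists m.
have -> : iter m (f *o g) x = iter m g (iter m f x); last by rewrite mx iter0.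
elim: m {mx} => //= m ->; rewrite comp_lfunE.
by rewrite fg iter_commute.
Qed.

Lemma trl_semisimple f g : (forall x, f (g x) = g (f x)) ->
  trl (f *o g) = trl (fcal id f *o g).
Proof.
move=> fg; apply/eqP; rewrite -subr_eq0 -trlB; apply/eqP.
have -> : f *o g - fcal id f *o g = (f - fcal id f) *o g.
  by apply/lfunP=> x; rewrite !lfE.
apply: trl_nilp; apply: nilp_comp => [x|x]; last exact: fcal_id_nilp.
by rewrite !lfE lfB fg (fcal_commute _ fg).
Qed.

(* The trace is the sum of the squared moduli of the eigenvalues. *)
Lemma conj_trace_nilp f : trl (f \o fcal (fun z => z^*) f)%VF = 0 ->
  forall x, exists m, iter m f x = 0.
Proof.
rewrite trl_semisimple => [|x]; last exact: fcal_self.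
rewrite fcal_comp => tr0 x.
suff xE : x \in genE f 0 by have [m] := proj1 (genEP _ _ _) xE; rewrite scale0r subr0; exists m.
move: x (memvf x); apply: (@genE_ind _ _ f) => [|||mu v _ vE].
- by move=> *; apply: memvf.
- exact: mem0v.
- by move=> a x y xE yE; rewrite memvD ?memvZ.
have [<-//|mu0] := eqVneq mu 0.
rewrite (fcal_ge0_tr0 _ tr0 vE) ?mem0v //= => [nu|]; first exact: mul_conjC_ge0.
by rewrite mulf_neq0 // conjC_eq0.
Qed.

End SpectralTrace.

Section EigenBasis.
Variables (F : numClosedFieldType) (V : vectType F).

(** From a basis of eigenvectors: in coordinates, [(a i - mu)^n * c i = 0] already forces
    [(a i - mu) * c i = 0]. Conversely, a longest free family of eigenvectors spans, since a
    generalized eigenvector outside its span would extend it. *)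
Lemma diagble_basis (f : 'End(V)) : diagble f <->
  exists X : seq V, basis_of fullv X /\ forall x, x \in X -> exists a, f x = a *: x.
Proof.
split=> [df|[X [Xb XE]] mu v vE]; last first.
  have vX : v \in <<X>>%VS by rewrite (span_basis Xb) memvf.
  have [n nv] := proj1 (genEP _ _ _) vE.
  pose Y := in_tuple X; have Yf : free Y := basis_free Xb.
  have {}vX := coord_span (X := Y) vX.
  have aE i : exists a, f Y`_i = a *: Y`_i.
    have [lti|lei] := ltnP i (size X); first exact/XE/mem_nth.
    by exists 0; rewrite nth_default // lf0 scale0r.
  have [a {}aE] := choice aE.
  pose c (i : 'I_(size X)) : F := coord Y i v.
  have itE k : iter k (f - mu *: \1%VF) v = \sum_(i < size X) ((a i - mu) ^+ k * c i) *: Y`_i.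
    elim: k => [|k IH]; first by rewrite /= {1}vX; apply: eq_bigr => i _; rewrite mul1r.
    rewrite iterS IH lf_sum; apply: eq_bigr => i _.
    by rewrite lfZ shiftE aE -scalerBl scalerA exprS mulrC mulrA.
  have c0 (i : 'I_(size X)) : (a i - mu) * c i = 0.
    apply/eqP; have := itE n; rewrite nv => /esym E.
    have /freeP/(_ _ E i)/eqP := Yf; rewrite !mulf_eq0 expf_eq0.
    by case/orP => [/andP[_ ->]|->]; rewrite ?orbT.
  apply/eqP; rewrite -subr_eq0 -shiftE -[_ v]/(iter 1 _ v) itE.
  by apply/eqP/big1 => i _; rewrite expr1 c0 scale0r.
pose Q n := `[< exists X : seq V, [/\ free X, size X = n
   & forall x, x \in X -> exists a, f x = a *: x] >].
have exQ : exists n, Q n by exists 0%N; apply/asboolP; exists [::]; split=> //; apply: nil_free.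
have bdQ n : Q n -> (n <= \dim {:V})%N.
  move=> /asboolP[X [Xf <- _]]; rewrite -(eqP Xf); exact/dimvS/subvf.
case: (ex_maxnP exQ bdQ) => n /asboolP[X [Xf Xn XE]] nmax; exists X; split=> //.
rewrite /basis_of Xf andbT eqEsubv subvf /=; apply/subvP=> v _; move: v (memvf v).
apply: (@genE_ind _ _ f) => [|||mu v _ /df fv]; first by move=> *; apply: memvf.
- exact: mem0v.
- by move=> a x y xE yE; rewrite memvD ?memvZ.
apply: contraT => vX; suff: (n.+1 <= n)%N by rewrite ltnn.
apply: nmax; apply/asboolP; exists (v :: X); split; first by rewrite free_cons vX.
  by rewrite /= Xn.
by move=> x; rewrite inE => /orP[/eqP ->|/XE //]; exists mu.
Qed.

End EigenBasis.

(** * Lie algebras of endomorphisms *)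

Section LinearLie.
Variables (F : numClosedFieldType) (V : vectType F).
Implicit Types (f g h x y : 'End(V)) (K M G I D : {vspace 'End(V)}) (U W : {vspace V}).

Lemma lbrP f a g h : lbr f (a *: g + h) = a *: lbr f g + lbr f h.
Proof. by apply/lfunP=> v; rewrite !(lfE, lbrE) lfP; vring. Qed.

Lemma lbrPl h a f g : lbr (a *: f + g) h = a *: lbr f h + lbr g h.
Proof. by apply/lfunP=> v; rewrite !(lfE, lbrE) lfP; vring. Qed.

Lemma lbrC f g : lbr f g = - lbr g f.
Proof. by rewrite /lbr opprB. Qed.

Lemma lbrxx f : lbr f f = 0. Proof. by rewrite /lbr subrr. Qed.

Lemma lbr0 f : lbr f 0 = 0.
Proof. by apply/lfunP=> v; rewrite !(lfE, lbrE) lf0 subrr. Qed.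

Lemma lbr_jacobi f g h : lbr f (lbr g h) = lbr (lbr f g) h + lbr g (lbr f h).
Proof. by apply/lfunP=> v; rewrite !(lfE, lbrE, lflin); vring. Qed.

Lemma lbr_eq0 f g : (forall v, f (g v) = g (f v)) -> lbr f g = 0.
Proof. by move=> fg; apply/lfunP=> v; rewrite lbrE lfE fg subrr. Qed.

Lemma lbr0_comm f g v : lbr f g = 0 -> f (g v) = g (f v).
Proof. by move=> /lfunP/(_ v)/eqP; rewrite lbrE lfE subr_eq0 => /eqP. Qed.

Definition actv K W : {vspace V} :=
  spanp (fun v : V => exists (k : 'End(V)) (w : V), [/\ k \in K, w \in W & v = k w]).

Lemma mem_actv K W (k : 'End(V)) (w : V) : k \in K -> w \in W -> k w \in actv K W.
Proof. by move=> kK wW; apply: mem_span; exists k, w. Qed.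

Lemma actv_le K W (X : {vspace V}) : (forall (k : 'End(V)) (w : V), k \in K -> w \in W -> k w \in X) -> (actv K W <= X)%VS.
Proof. by move=> kX; apply: span_le => _ [k [w [kK wW ->]]]; apply: kX. Qed.

Lemma actvS K K' W W' : (K <= K')%VS -> (W <= W')%VS -> (actv K W <= actv K' W')%VS.
Proof.
move=> /subvP sK /subvP sW; apply: actv_le => k w /sK kK /sW wW; exact: mem_actv.
Qed.

(** Joint nilpotency in the sense of Engel: products of sufficiently many elements of [K] vanish. *)
Definition nilset K := exists n, iter n (actv K) fullv = 0%VS.
Definition lclosed K := forall f g, f \in K -> g \in K -> lbr f g \in K.

Lemma actv_flag_dec K i : (iter i.+1 (actv K) fullv <= iter i (actv K) fullv)%VS.
Proof. by elim: i => [|i IH] /=; [exact: subvf | exact: actvS]. Qed.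

Lemma actv_flag_leq K i j : (i <= j)%N ->
  (iter j (actv K) fullv <= iter i (actv K) fullv)%VS.
Proof.
move=> /subnK <-; elim: (j - i)%N => // k IH; apply: subv_trans IH.
by rewrite addSn; apply: actv_flag_dec.
Qed.

Lemma nilset_ker0 K : nilset K -> (forall v : V, (forall c : 'End(V), c \in K -> c v = 0) -> v = 0) ->
  forall v : V, v = 0.
Proof.
move=> [n]; elim: n => [|n IH] Kn Kker; first by move=> v; apply/eqP; rewrite -memv0 -Kn memvf.
apply: IH => //; apply/eqP; rewrite -subv0; apply/subvP=> v vW.
rewrite memv0; apply/eqP/Kker => c cK; apply/eqP.
by rewrite -memv0 -Kn /= mem_actv.
Qed.

(** As [x] normalizes [K], it preserves the flag of [K]. On a quotient of consecutive terms [K] acts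
    by zero and only powers of [x] remain, so [p] applications of the larger set descend one step of
    the flag. *)
Lemma nilset_add K x : nilset K -> (forall v, exists m, iter m x v = 0) ->
  (forall k, k \in K -> lbr x k \in K) -> nilset (K + <[x]>)%VS.
Proof.
move=> [n Wn] nx xK; pose W i := iter i (actv K) fullv.
have [p pE] : exists p, forall v, v \in fullv -> iter p x v = 0.
  by apply: nilp_uniform => v _.
have xW i : stab x (W i).
  elim: i => [|i IH] v vW; first exact: memvf.
  move: v vW; apply: span_ind => [|a u v xu xv|_ [k [w [kK wW ->]]]].
  - by rewrite lf0 mem0v.
  - by rewrite lfP memvD ?memvZ.
  have -> : x (k w) = lbr x k w + k (x w) by rewrite lbrE subrK.
  by rewrite memvD ?mem_actv ?xK ?IH.
pose g j := linfun (iter j x).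
have gE j v : g j v = iter j x v := linfun_linE (@iter_lin _ _ x j) v.
have step i j : (iter j (actv (K + <[x]>)) (W i) <= g j @: W i + W i.+1)%VS.
  elim: j => [|j IH] /=.
    by apply: subv_trans (addvSl _ _); apply/subvP=> w wW; rewrite -[w]/(iter 0 x w) -gE memv_img.
  apply: subv_trans (actvS (subvv _) IH) _; apply: actv_le => ? ?.
  move=> /memv_addP[k kK [_ /vlineP[a ->] ->]] /memv_addP[_ /memv_imgP[w wW ->] [w' w'W ->]].
  rewrite gE add_lfunE scale_lfunE !lfD.
  have wj : iter j x w \in W i by apply: iter_stab.
  have -> : a *: (x (iter j x w) + x w') = g j.+1 (a *: w) + a *: x w'.
    by rewrite gE /= iterZ_lin lfZ scalerDr.
  rewrite addrCA memv_add ?memv_img ?memvZ //; apply: memvD; last by rewrite memvZ ?(xW i.+1).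
  apply: memvD; first exact: mem_actv.
  by apply: mem_actv => //; apply: (subvP (actv_flag_dec K i)).
have big i : (iter (i * p) (actv (K + <[x]>)) fullv <= W i)%VS.
  elim: i => // i IH; rewrite mulSn iterD.
  apply: subv_trans (_ : iter p (actv (K + <[x]>)) (W i) <= _)%VS.
    elim: {1 3}p => //= q IHq; exact: actvS.
  apply: subv_trans (step i p) _; rewrite subv_add subvv andbT.
  by apply/subvP=> _ /memv_imgP[w _ ->]; rewrite gE pE ?mem0v ?memvf.
by exists (n * p)%N; apply/eqP; rewrite -subv0 -Wn; apply: big.
Qed.

(** Let [M] be a maximal subalgebra of [K] with a finite flag. If [M] is not [K], an element of [K]
    outside [M] that normalizes [M] would enlarge it by [nilset_add]; the point is to find one. *)
Lemma engel K : lclosed K -> (forall f, f \in K -> forall v, exists m, iter m f v = 0) ->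
  nilset K.
Proof.
move=> cK nK; pose P M := [/\ (M <= K)%VS, lclosed M & nilset M].
have P0 : P 0%VS.
  split; first exact: sub0v.
    by move=> f g; rewrite !memv0 => /eqP -> /eqP ->; rewrite lbrxx.
  exists 1%N; apply/eqP; rewrite -subv0; apply: actv_le => k w.
  by rewrite memv0 => /eqP -> _; rewrite lfE mem0v.
have [M [sM cM nM] Mmax] := max_vspace P0.
have [KM|/subvPn[x0 x0K x0M]] := boolP (K <= M)%VS.
  by have -> : K = M by apply/eqP; rewrite eqEsubv KM sM.
suff [x [xK xM xMM]] : exists x, [/\ x \in K, x \notin M & forall m, m \in M -> lbr m x \in M].
  exfalso; suff: P (M + <[x]>)%VS.
    move/Mmax; rewrite dimv_disjoint_sum ?dim_vline; last first.
      apply/eqP; rewrite -subv0; apply/subvP=> v /memv_capP[vM /vlineP[a va]].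
      move: vM; rewrite {v}va memv0; have [->|a0] := eqVneq a 0; first by rewrite scale0r.
      by move=> /(memvZ a^-1); rewrite scalerA mulVf // scale1r (negbTE xM).
    have -> : x != 0 by apply: contra xM => /eqP ->; rewrite mem0v.
    by rewrite addn1 ltnn.
  split.
  - by rewrite subv_add sM; apply/subvP=> _ /vlineP[a ->]; rewrite memvZ.
  - move=> _ _ /memv_addP[m mM [_ /vlineP[a ->] ->]] /memv_addP[m' m'M [_ /vlineP[b ->] ->]].
    apply: subvP (addvSl _ _) _ _.
    rewrite [m + _]addrC [m' + _]addrC lbrPl !lbrP lbrxx scaler0 add0r memvD //.
      by rewrite lbrC scalerN -scaleNr memvZ ?xMM.
    by rewrite memvD ?memvZ ?xMM ?cM.
  - apply: nilset_add => //; first exact: nK.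
    by move=> m mM; rewrite lbrC memvN xMM.
have [n Wn] := nM; pose W i := iter i (actv M) fullv.
have Wle i j : (i <= j)%N -> (W j <= W i)%VS by apply: actv_flag_leq.
apply: contrapT => none.
(* Bracketing with M any number of times would lead to operators outside M
   that lower the flag W arbitrarily far. *)
have ex j : exists x, [/\ x \in K, x \notin M & forall i v, v \in W i -> x v \in W (i + j - n)%N].
  elim: j => [|j [x [xK xM xW]]].
    (* The subtraction is truncated: [i - n] is 0 for [i <= n], where nothing is claimed, and for
       larger [i] the term [W i] is zero. *)
    exists x0; split=> // i v vW; rewrite addn0.
    have [lin|/ltnW nli] := leqP i n.
      by move: lin; rewrite -subn_eq0 => /eqP ->; apply: memvf.
    have : (W i <= W n)%VS by apply: Wle.
    rewrite {2}/W Wn => /subvP/(_ _ vW); rewrite memv0 => /eqP ->.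
    by rewrite lf0 mem0v.
  have [m [mM mx]] : exists m, m \in M /\ lbr m x \notin M.
    apply: contrapT => no; apply: none; exists x; split=> // m mM.
    by apply: contraT => mx; case: no; exists m.
  exists (lbr m x); split=> //.
    by apply: cK => //; apply: (subvP sM).
  move=> i v vW; rewrite lbrE; apply: memvB.
    apply: (subvP (Wle (i + j.+1 - n) (i + j - n).+1 _)%N); first lia.
    by apply: mem_actv => //; apply: xW.
  have -> : (i + j.+1 - n = i.+1 + j - n)%N by lia.
  by apply: xW; apply: mem_actv.
(* With [j = n + n] and [i = 0] the image lies in [W n], which is zero; but then [x = 0] belongs to
   [M]. *)
have [x [_ /negP xM xW]] := ex (n + n)%N; apply: xM.
suff -> : x = 0 by rewrite mem0v.
apply/lfunP=> v; rewrite lfE; apply/eqP; rewrite -memv0 -Wn.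
by have := xW 0%N v (memvf v); rewrite add0n addnK.
Qed.

Definition lder K := spanp (fun x => exists f g, [/\ f \in K, g \in K & x = lbr f g]).

Lemma mem_lder K f g : f \in K -> g \in K -> lbr f g \in lder K.
Proof. by move=> fK gK; apply: mem_span; exists f, g. Qed.

Lemma lder_le K (X : {vspace 'End(V)}) : (forall f g, f \in K -> g \in K -> lbr f g \in X) -> (lder K <= X)%VS.
Proof. by move=> kX; apply: span_le => _ [k [w [kK wW ->]]]; apply: kX. Qed.

Lemma nilset_solvable K : nilset K -> exists n, iter n lder K = 0%VS.
Proof.
move=> [n Wn]; exists n; pose W i := iter i (actv K) fullv.
have H j : forall x, x \in iter j lder K -> forall i v, v \in W i -> x v \in W (i + j).+1.
  elim: j => [|j IH] x; first by move=> xK i v vW; rewrite addn0; apply: mem_actv.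
  move: x; apply: span_ind => [i v _|a f g If Ig i v vW|_ [f [g [fK gK ->]]] i v vW].
  - by rewrite lfE mem0v.
  - by rewrite !lfE memvD ?memvZ ?If ?Ig.
  have le : (W ((i + j).+1 + j).+1 <= W (i + j.+1).+1)%VS by apply: actv_flag_leq; lia.
  by rewrite lbrE memvB // (subvP le) // IH // IH.
apply/eqP; rewrite -subv0; apply/subvP=> x /H xW; rewrite memv0; apply/eqP/lfunP=> v.
rewrite lfE; apply/eqP; rewrite -memv0 -Wn.
by apply: (subvP (actv_flag_leq K (leqnSn n))); have := xW 0%N v (memvf v); rewrite add0n.
Qed.

Definition lad f : 'End('End(V)) := linfun (lbr f).

Lemma ladE f g : lad f g = lbr f g.
Proof. by apply: linfun_linE => a x y; rewrite lbrP. Qed.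

(** The eigenvalues of [lad f] are differences of eigenvalues of [f], so an additive [phi] commutes
    with passing to [lad]. Hence bracketing with [fcal phi f] preserves every subspace stable under
    [lad f]. *)
Lemma lad_fcal f phi (phiD : forall a b, phi (a + b) = phi a + phi b) g :
  fcal phi (lad f) g = lbr (fcal phi f) g.
Proof.
rewrite -ladE; move: g; apply/lfunP/esym; apply: fcal_uniq => nu y yE; rewrite ladE.
apply: (@lfun_genE_eq _ _ _ f) => mu v vE; rewrite lbrE lfE (fcalE _ vE) lfZ.
have yvE : y v \in genE f (nu + mu).
  apply: (@genE_bilin _ _ _ _ (fun (y : 'End(V)) (v : V) => y v) (lad f) f f fullv fullv)
    => //; try (by move=> *; apply: memvf).
  - by move=> u a w w'; rewrite lfP.
  - by move=> u a w w'; rewrite !lfE.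
  - by move=> z w _ _; rewrite ladE lbrE subrK.
by rewrite (fcalE _ yvE) phiD scalerDl addrK.
Qed.

Lemma conjCD (a b : F) : (a + b)^* = a^* + b^*.
Proof. exact: rmorphD. Qed.

(** Let [cb] be the conjugate part of [c] in [lder K]. For [c = lbr f g], the trace of [c *o cb] is
    that of [f *o lbr g cb], where [lbr g cb] is still in [K] by [lad_fcal], so it vanishes. Thus
    [c] is nilpotent, and Engel's theorem applies to [lder K]. *)
Lemma cartan_solvable K : lclosed K ->
  (forall f g, f \in K -> g \in K -> trl (f *o g) = 0) -> exists n, iter n lder K = 0%VS.
Proof.
move=> cK trK; have DK : (lder K <= K)%VS by apply: lder_le.
suff /nilset_solvable[n] : nilset (lder K) by rewrite -iterSr; exists n.+1.
apply: engel => [f g fD gD|c cD].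
  by apply: mem_lder; apply: (subvP DK).
have cKK : c \in K := subvP DK _ cD.
apply: conj_trace_nilp; set cb := fcal _ c.
suff: forall x, x \in lder K -> trl (x *o cb) = 0 by apply.
apply: span_ind => [|a x y Ex Ey|_ [f [g [fK gK ->]]]].
- by have -> : 0 *o cb = 0 :> 'End(V) by [apply/lfunP=> v; rewrite !lfE]; rewrite trl0.
- have -> : (a *: x + y) *o cb = a *: (x *o cb) + y *o cb by apply/lfunP=> v; rewrite !lfE.
  by rewrite trlP Ex Ey mulr0 addr0.
rewrite -trl_comm trK // lbrC memvN -lad_fcal; last exact: conjCD.
by apply: fcal_stab => // x xK; rewrite ladE cK.
Qed.

Definition irreducible_set G :=
  forall U, (forall g, g \in G -> stab g U) -> U = 0%VS \/ U = fullv.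

Lemma trl_commutator_span (P : 'End(V) -> 'End(V) -> Prop) cb :
  (forall f g, P f g -> lbr g cb = 0) ->
  forall x, x \in spanp (fun x => exists f g, P f g /\ x = lbr f g) -> trl (x *o cb) = 0.
Proof.
move=> Pcb; apply: span_ind => [|a x y Ex Ey|_ [f [g [fK ->]]]].
- by have -> : 0 *o cb = 0 :> 'End(V) by [apply/lfunP=> v; rewrite !lfE]; rewrite trl0.
- have -> : (a *: x + y) *o cb = a *: (x *o cb) + y *o cb by apply/lfunP=> v; rewrite !lfE.
  by rewrite trlP Ex Ey mulr0 addr0.
rewrite -trl_comm (Pcb f) //.
by have -> : f *o 0 = 0 :> 'End(V) by [apply/lfunP=> v; rewrite !lfE lf0]; rewrite trl0.
Qed.

(** Elements [c] of [N = [G, I]] are nilpotent by the conjugate trace, since the conjugate part of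
    [c] commutes with [I]. The common kernel of [N] is stable under [G], and nonzero by Engel's
    theorem unless the space is zero; hence it is everything. *)
Lemma irreducible_abelian G I : lclosed G -> irreducible_set G -> (I <= G)%VS ->
  (forall g i, g \in G -> i \in I -> lbr g i \in I) ->
  (forall i j, i \in I -> j \in I -> lbr i j = 0) ->
  forall g i, g \in G -> i \in I -> lbr g i = 0.
Proof.
move=> cG irG IG idI abI.
pose N := spanp (fun x => exists g i, (g \in G /\ i \in I) /\ x = lbr g i).
have NI : (N <= I)%VS by apply: span_le => _ [g [i [[gG iI] ->]]]; apply: idI.
have nilN c : c \in N -> forall v, exists m, iter m c v = 0.
  move=> cN; apply: conj_trace_nilp; set cb := fcal _ c.
  apply: (@trl_commutator_span (fun f g => f \in G /\ g \in I) cb _ _ cN) => f g [_ gI].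
  rewrite lbrC lbr_eq0 ?oppr0 // => v; apply: fcal_commute => {}v.
  by apply: lbr0_comm; apply: abI => //; apply: (subvP NI).
have nN : nilset N.
  apply: engel nilN => f g fN gN.
  by rewrite abI ?mem0v //; apply: (subvP NI).
pose Z := spanp (fun v => forall c, c \in N -> c v = 0).
have ZP v : v \in Z <-> forall c, c \in N -> c v = 0.
  apply: mem_spanp => [c _|a x y xZ yZ c cN]; first by rewrite lf0.
  by rewrite lfP xZ ?yZ // scaler0 addr0.
have [|Z0|Zf] := irG Z.
- move=> g gG v /ZP vZ; apply/ZP => c cN.
  have -> : c (g v) = g (c v) - lbr g c v by rewrite lbrE opprB addrC subrK.
  rewrite vZ // lf0 sub0r vZ ?oppr0 //; apply: mem_span; exists g, c; split=> //.
  by split=> //; apply: (subvP NI).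
- have V0 : forall v : V, v = 0.
    apply: nilset_ker0 nN _ => v /ZP; rewrite Z0 memv0 => /eqP //.
  by move=> g i _ _; apply/lfunP=> v; rewrite [LHS]V0 [RHS]V0.
move=> g i gG iI; apply/lfunP=> v; rewrite zero_lfunE.
have /ZP vZ : v \in Z by rewrite Zf memvf.
by rewrite (vZ (lbr g i)) //; apply: mem_span; exists g, i.
Qed.

(** By induction on the derived length [lder I] is central in [G]. A central commutator has zero
    conjugate trace, so it is nilpotent, and its kernel is stable under [G]; by irreducibility it is
    zero. Then [I] is abelian. *)
Lemma irreducible_solvable G I : lclosed G -> irreducible_set G -> (I <= G)%VS ->
  (forall g i, g \in G -> i \in I -> lbr g i \in I) ->
  (exists n, iter n lder I = 0%VS) ->
  forall g i, g \in G -> i \in I -> lbr g i = 0.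
Proof.
move=> cG irG + + [n]; elim: n I => [|n IH] I IG idI.
  by move=> I0 g i gG; rewrite [I]I0 memv0 => /eqP ->; apply: lbr0.
rewrite iterSr => In; have JI : (lder I <= I)%VS.
  by apply: lder_le => f g fI gI; apply: idI => //; apply: (subvP IG).
have cJ := IH (lder I) (subv_trans JI IG) _ In.
have {}cJ : forall g c, g \in G -> c \in lder I -> lbr g c = 0.
  apply: cJ => g c gG; move: c; apply: span_ind => [|a x y Ex Ey|_ [f [h [fK hK ->]]]].
  - by rewrite lbr0 mem0v.
  - by rewrite lbrP memvD ?memvZ.
  by rewrite lbr_jacobi memvD // mem_lder ?idI.
suff J0 : lder I = 0%VS.
  apply: irreducible_abelian => // i j iI jI; apply/eqP.
  by rewrite -memv0 -J0 mem_lder.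
apply/eqP; rewrite -subv0; apply/subvP=> c cJI; rewrite memv0; apply/eqP.
have cc g v : g \in G -> c (g v) = g (c v).
  by move=> gG; apply/esym/lbr0_comm/cJ.
have nc : forall v, exists m, iter m c v = 0.
  apply: conj_trace_nilp; set cb := fcal _ c.
  apply: (@trl_commutator_span (fun f g => f \in I /\ g \in I) cb) => [f g [_ gI]|].
    rewrite lbrC lbr_eq0 ?oppr0 // => v; apply: fcal_commute => {}v.
    by apply: cc; apply: (subvP IG).
  by apply: subvP cJI; apply: span_le => _ [f [g [fI gI ->]]]; apply: mem_span; exists f, g.
have [|Z0|Zf] := irG (lker c).
- by move=> g gG v; rewrite !memv_ker cc // => /eqP ->; rewrite lf0.
- have V0 (v : V) : v = 0.
    have [m] := nc v; elim: m => //= m IHm /eqP; rewrite -memv_ker Z0 memv0 => /eqP //.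
  by apply/lfunP=> v; rewrite [LHS]V0 [RHS]V0.
by apply/lfunP=> v; rewrite lfE; apply/eqP; rewrite -memv_ker Zf memvf.
Qed.

End LinearLie.

(** * Killing forms and Weyl's theorem *)

Section BilinearAlgebra.
Variables (F : numClosedFieldType) (V : vectType F) (br : V -> V -> V).
Hypothesis bil : bilinear_br br.
Implicit Types (x y z a b : V) (U W I K : {vspace V}).

Lemma br_linr x : linear (br x). Proof. by case: bil. Qed.
Lemma br_linl y : linear (br^~ y). Proof. by case: bil. Qed.
Lemma brP x c y z : br x (c *: y + z) = c *: br x y + br x z.
Proof. exact: br_linr. Qed.
Lemma brPl z c x y : br (c *: x + y) z = c *: br x z + br y z.
Proof. exact: (br_linl z). Qed.
Lemma brD x y z : br x (y + z) = br x y + br x z.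
Proof. exact: lin_D (br_linr x). Qed.
Lemma brDl x y z : br (x + y) z = br x z + br y z.
Proof. exact: lin_D (br_linl z). Qed.
Lemma brN x y : br x (- y) = - br x y. Proof. exact: lin_N (br_linr x). Qed.
Lemma brNl x y : br (- x) y = - br x y. Proof. exact: lin_N (br_linl y). Qed.
Lemma brB x y z : br x (y - z) = br x y - br x z.
Proof. exact: lin_B (br_linr x). Qed.
Lemma brBl x y z : br (x - y) z = br x z - br y z.
Proof. exact: lin_B (br_linl z). Qed.
Lemma brZ x c y : br x (c *: y) = c *: br x y. Proof. exact: lin_Z (br_linr x). Qed.
Lemma brZl x c y : br (c *: x) y = c *: br x y. Proof. exact: lin_Z (br_linl y). Qed.
Lemma br0 x : br x 0 = 0. Proof. exact: lin_0 (br_linr x). Qed.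
Lemma br0l x : br 0 x = 0. Proof. exact: lin_0 (br_linl x). Qed.

Definition brE := (brP, brPl, brD, brDl, brN, brNl, brB, brBl, brZ, brZl, br0, br0l).

(* Left multiplications: the paper's R_a is [- ad a]. *)
Definition ad : 'Hom(V, 'End(V)) := linfun (fun a => linfun (br a) : 'End(V)).

Lemma adE a x : ad a x = br a x.
Proof.
rewrite /ad linfun_linE; first exact: (linfun_linE (br_linr a)).
move=> c u v; apply/lfunP=> w; rewrite !lfE !(linfun_linE (br_linr _)).
exact: brPl.
Qed.

Lemma mem_brv U W u w : u \in U -> w \in W -> br u w \in brv br U W.
Proof. by move=> uU wW; apply: mem_span; exists u, w. Qed.

Lemma brv_le U W (X : {vspace V}) :
  (forall u w, u \in U -> w \in W -> br u w \in X) -> (brv br U W <= X)%VS.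
Proof. by move=> kX; apply: span_le => _ [k [w [kK wW ->]]]; apply: kX. Qed.

Lemma brvS U U' W W' : (U <= U')%VS -> (W <= W')%VS -> (brv br U W <= brv br U' W')%VS.
Proof.
by move=> /subvP sU /subvP sW; apply: brv_le => u w /sU uU /sW wW; apply: mem_brv.
Qed.

Hypothesis alt : forall x, br x x = 0.

Lemma brC x y : br x y = - br y x.
Proof.
apply/eqP; rewrite -addr_eq0; apply/eqP.
by have := alt (x + y); rewrite brD !brDl !alt add0r addr0 addrC.
Qed.

Lemma ideal_mem I x y : ideal br I -> x \in I -> br x y \in I.
Proof. by case=> _ H xI; case: (H x y xI (memvf y)). Qed.

Lemma ideal_memr I x y : ideal br I -> x \in I -> br y x \in I.
Proof. by case=> _ H xI; case: (H x y xI (memvf y)). Qed.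

Lemma idealI I : (forall x y, x \in I -> br x y \in I) -> ideal br I.
Proof.
by move=> H; split=> [|x y xI _]; [exact: subvf | rewrite [br y x]brC memvN H].
Qed.

Lemma brv_sub_ideal I : ideal br I -> (brv br I I <= I)%VS.
Proof. by move=> iI; apply: brv_le => u w uI _; apply: ideal_mem. Qed.

End BilinearAlgebra.

Section PerpDim.
Variables (F : fieldType) (V : vectType F) (B : V -> V -> F).
Hypothesis BP : forall x a y z, B x (a *: y + z) = a * B x y + B x z.
Hypothesis BPl : forall z a x y, B (a *: x + y) z = a * B x z + B y z.

Definition perp (X : {vspace V}) : {vspace V} := spanp (fun y => forall x, x \in X -> B x y = 0).

Lemma form0r x : B x 0 = 0.
Proof. by have := BP x (-1) 0 0; rewrite scaler0 addr0 mulN1r addNr. Qed.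

Lemma perpP X y : y \in perp X <-> forall x, x \in X -> B x y = 0.
Proof.
apply: mem_spanp => [x _|a u v Eu Ev x xX]; first exact: form0r.
by rewrite BP Eu ?Ev // mulr0 addr0.
Qed.

Lemma dim_perp X : (\dim {:V} <= \dim X + \dim (perp X))%N.
Proof.
pose phi := linfun (fun y => \row_(i < \dim X) B (vbasis X)`_i y : 'rV[F]_(\dim X)).
have phiE y : phi y = \row_(i < \dim X) B (vbasis X)`_i y.
  by rewrite /phi linfun_linE // => a u v; apply/rowP=> i; rewrite !mxE BP.
rewrite -(limg_ker_dim phi fullv) addnC capfv leq_add //.
  apply: leq_trans (dimvS (subvf _)) _.
  by rewrite dimvf dim_matrix; lia.
apply/dimvS/subvP=> y; rewrite memv_ker phiE => /eqP/rowP y0; apply/perpP=> x xX.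
have {}y0 i : (i < \dim X)%N -> B (vbasis X)`_i y = 0.
  by move=> ltid; have := y0 (Ordinal ltid); rewrite !mxE.
rewrite (coord_vbasis xX).
have B0 : B 0 y = 0 by have := BPl y (-1) 0 0; rewrite scaler0 addr0 mulN1r addNr.
elim/big_rec: _ => // i u _ Eu; rewrite BPl Eu addr0 y0 ?mulr0 //.
Qed.

End PerpDim.

Section Killing.
Variables (F : numClosedFieldType) (V : vectType F) (br : V -> V -> V).
Hypothesis lieV : lie br.
Implicit Types (x y z a b : V) (U W I K : {vspace V}).

Let bil : bilinear_br br. Proof. by case: lieV. Qed.
Let alt : forall x, br x x = 0. Proof. by case: lieV. Qed.
Let jac0 : forall x y z, jac br x y z = 0. Proof. by case: lieV. Qed.

Lemma lie_ad x y : ad br (br x y) = lbr (ad br x) (ad br y).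
Proof.
apply/lfunP=> z; rewrite lbrE !(adE bil); have := jac0 x y z; rewrite /jac.
rewrite [br (br y z) x](brC bil alt) [br z x](brC bil alt) (brNl bil).
rewrite [br (br x z) y](brC bil alt) opprK => /eqP; rewrite addr_eq0.
by move/eqP=> E; rewrite -[LHS](addrK (- br x (br y z))) E opprK addrC.
Qed.

Definition killing_form x y : F := trl (ad br x *o ad br y).
Definition killing_nondegenerate := forall x, (forall y, killing_form x y = 0) -> x = 0.
(** The form in which semisimplicity enters Weyl's and Levi's theorems; it is applied directly to
    the kernel of a trace form, to the center and to the whole algebra. *)
Definition ideals_perfect := forall K, ideal br K -> brv br K K = K.

Lemma killingP x (c : F) y z : killing_form x (c *: y + z) = c * killing_form x y + killing_form x z.
Proof.
rewrite /killing_form lfP -trlP; congr trl.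
by apply/lfunP=> v; rewrite !lfE lfP.
Qed.

Lemma killingC x y : killing_form x y = killing_form y x.
Proof. exact: trl_comp. Qed.

Lemma killing_inv x y z : killing_form (br x y) z = killing_form x (br y z).
Proof. by rewrite /killing_form !lie_ad trl_comm. Qed.

(** For [a] in [K] and in its orthogonal, [(ad a ad y)^2 = 0], so [a = 0] and the space is the sum
    of [K] and its orthogonal. An element of [K] orthogonal to [D = [K, K]] kills both summands, so
    it is zero, and counting dimensions gives [D = K]. *)
Lemma killing_perfect : killing_nondegenerate -> ideals_perfect.
Proof.
move=> nd K iK; set D := brv br K K.
have kPl z (c : F) x y : killing_form (c *: x + y) z = c * killing_form x z + killing_form y z.
  by rewrite ![killing_form _ z]killingC killingP.
pose B := killing_form; have pP := perpP killingP.
have abel a b : a \in K -> a \in perp B K -> b \in K -> br a b = 0.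
  move=> aK aP bK; apply: nd => y; rewrite killing_inv killingC.
  by apply: (proj1 (pP _ _) aP); apply: ideal_mem.
have capK : (K :&: perp B K = 0)%VS.
  apply/eqP; rewrite -subv0; apply/subvP=> a /memv_capP[aK aP]; rewrite memv0.
  apply/eqP/nd => y; apply: trl_nilp => v; exists 2%N; rewrite /= !(lfE, adE bil).
  have bV w : br a w \in K by apply: ideal_mem.
  set w := br a _; have wK : w \in K by apply: bV.
  by apply: abel => //; apply: ideal_memr.
have sumK : (K + perp B K)%VS = fullv.
  apply/eqP; rewrite eqEdim subvf dimv_disjoint_sum //.
  exact: (dim_perp killingP kPl).
have KD : (K :&: perp B D = 0)%VS.
  apply/eqP; rewrite -subv0; apply/subvP=> a /memv_capP[aK aD]; rewrite memv0.
  have aKb b : b \in K -> br a b = 0.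
    move=> bK; apply: nd => y; have := memvf y; rewrite -sumK => /memv_addP[u uK [w wP ->]].
    have E1 : killing_form (br a b) u = 0.
      by rewrite killing_inv killingC; apply: (proj1 (pP _ _) aD); apply: mem_brv.
    have E2 : killing_form (br a b) w = 0.
      by apply: (proj1 (pP _ _) wP); apply: ideal_mem.
    by rewrite -[u]scale1r killingP mul1r E1 E2 addr0.
  have aw w : w \in perp B K -> br a w = 0.
    move=> wP; suff E : br w a = 0 by rewrite (brC bil alt) E oppr0.
    apply: nd => y; rewrite killing_inv killingC.
    by apply: (proj1 (pP _ _) wP); apply: ideal_mem.
  apply/eqP/nd => y; rewrite /killing_form; have -> : ad br a = 0.
    apply/lfunP=> v; rewrite lfE (adE bil); have := memvf v.
    rewrite -sumK => /memv_addP[u uK [w wP ->]].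
    by rewrite (brD bil) aKb ?aw ?addr0.
  by have -> : 0 *o ad br y = 0 :> 'End(V) by [apply/lfunP=> v; rewrite !lfE]; rewrite trl0.
apply/eqP; rewrite eqEdim brv_sub_ideal //= -(leq_add2r (\dim (perp B D))).
apply: leq_trans (dim_perp killingP kPl D); rewrite -dimv_disjoint_sum //.
exact/dimvS/subvf.
Qed.

End Killing.

(** * The Casimir operator of a nondegenerate trace form *)

Section Casimir.
Variables (F : numClosedFieldType) (V : vectType F) (G : {vspace 'End(V)}).
Hypothesis cG : lclosed G.
Hypothesis ndG : forall g, g \in G -> (forall h, h \in G -> trl (g *o h) = 0) -> g = 0.

(** [c] is the sum of [P i j *: (X i *o X j)], with [P] the inverse of the Gram matrix [Q] of the
    trace form, so its trace is that of [P *m Q]. If [a] is the matrix of [lbr g] in the basis,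
    invariance of the form reads [a Q + Q a^T = 0]; multiplying by [P] on both sides gives
    [P a + a^T P = 0], that is, [lbr g c = 0]. *)
Lemma casimir_ex : exists c : 'End(V), [/\ trl c = (\dim G)%:R,
  forall g, g \in G -> lbr g c = 0, forall v, c v \in actv G fullv &
  forall v, (forall g, g \in G -> g v = 0) -> c v = 0].
Proof.
set d := \dim G; pose X (i : 'I_d) : 'End(V) := (vbasis G)`_i.
have XG i : X i \in G by apply/vbasis_mem/mem_nth; rewrite size_tuple.
pose Q : 'M[F]_d := \matrix_(i, j) trl (X i *o X j).
have QT : Q^T = Q by apply/matrixP=> i j; rewrite !mxE trl_comp.
have compSl (I : finType) (E : I -> 'End(V)) (h : 'End(V)) : (\sum_i E i) *o h = \sum_i (E i *o h).
  by apply/lfunP=> v; rewrite lfE !sum_lfunE; apply: eq_bigr => i _; rewrite lfE.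
have compZl a (f h : 'End(V)) : (a *: f) *o h = a *: (f *o h) :> 'End(V).
  by apply/lfunP=> v; rewrite !lfE.
have compZr a (f h : 'End(V)) : f *o (a *: h) = a *: (f *o h) :> 'End(V).
  by apply/lfunP=> v; rewrite !lfE lfZ.
have compSr (I : finType) (E : I -> 'End(V)) (h : 'End(V)) : h *o (\sum_i E i) = \sum_i (h *o E i).
  by apply/lfunP=> v; rewrite lfE !sum_lfunE lf_sum; apply: eq_bigr => i _; rewrite lfE.
have Qu : Q \in unitmx.
  rewrite -row_free_unit -kermx_eq0; apply/rowV0P=> u /sub_kermxP uQ.
  pose g := \sum_i u 0 i *: X i.
  have g0 : g = 0.
    apply: ndG => [|h hG]; first by apply: memv_suml => i _; rewrite memvZ.
    rewrite (coord_vbasis hG) compSr trl_sum big1 // => j _.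
    rewrite compZr trlZ -/(X j).
    have /rowP/(_ j) := uQ; rewrite !mxE => E; rewrite -[X in _ * X]/(trl (g *o X j)).
    rewrite compSl trl_sum -[RHS](mulr0 (coord (vbasis G) j h)); congr (_ * _).
    by rewrite -[RHS]E; apply: eq_bigr => i _; rewrite compZl trlZ mxE.
  have /freeP/(_ (fun i => u 0 i) g0) u0 := basis_free (vbasisP G).
  by apply/rowP=> i; rewrite mxE u0.
set P := invmx Q; pose S (C : 'M[F]_d) : 'End(V) := \sum_i \sum_j C i j *: (X i *o X j).
exists (S P); split.
- rewrite /S trl_sum; transitivity (\tr (P *m Q)); last by rewrite mulVmx // mxtrace1.
  apply: eq_bigr => i _; rewrite trl_sum mxE; apply: eq_bigr => j _.
  by rewrite trlZ -[in RHS]QT !mxE.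
- move=> g gG; pose a : 'M[F]_d := \matrix_(i, j) coord (vbasis G) j (lbr g (X i)).
  have aE i : lbr g (X i) = \sum_j a i j *: X j.
    by rewrite {1}(coord_vbasis (cG gG (XG i))); apply: eq_bigr => j _; rewrite mxE.
  have aQ : a *m Q + Q *m a^T = 0.
    apply/matrixP=> i j; rewrite !mxE.
    have -> : \sum_k a i k * Q k j = trl (lbr g (X i) *o X j).
      by rewrite aE compSl trl_sum; apply: eq_bigr => k _; rewrite compZl trlZ [Q _ _]mxE.
    have -> : \sum_k Q i k * a^T k j = trl (X i *o lbr g (X j)).
      by rewrite aE compSr trl_sum; apply: eq_bigr => k _; rewrite compZr trlZ [Q _ _]mxE [a^T _ _]mxE mulrC.
    rewrite trl_comm [lbr (X i) g]lbrC.
    have -> : (- lbr g (X i)) *o X j = - (lbr g (X i) *o X j).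
      by apply/lfunP=> v; rewrite !lfE.
    by rewrite trlN subrr.
  have Pa : P *m a + a^T *m P = 0.
    have := congr1 (fun A => P *m A *m P) aQ.
    by rewrite mulmxDr mulmxDl mulmx0 mul0mx !mulmxA mulVmx // mul1mx -[P *m a *m Q *m P]mulmxA mulmxV // mulmx1.
  have lbrS (C : 'M[F]_d) : lbr g (S C) = S (C *m a + a^T *m C).
    have lsum (I : finType) (E : I -> 'End(V)) : lbr g (\sum_i E i) = \sum_i lbr g (E i).
      by apply/lfunP=> v; rewrite lbrE !sum_lfunE lf_sum -sumrB; apply: eq_bigr => i _; rewrite lbrE.
    rewrite {1}/S lsum.
    transitivity (\sum_i \sum_j (C i j *: (X i *o lbr g (X j)) + C i j *: (lbr g (X i) *o X j))).
      apply: eq_bigr => i _; rewrite lsum; apply: eq_bigr => j _.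
      by apply/lfunP=> v; rewrite !(lfE, lbrE, lflin); vring.
    have -> : S (C *m a + a^T *m C) = S (C *m a) + S (a^T *m C).
      rewrite /S -big_split; apply: eq_bigr => i _; rewrite -big_split.
      by apply: eq_bigr => j _; rewrite mxE scalerDl.
    rewrite /S.
    transitivity (\sum_i \sum_j C i j *: (X i *o lbr g (X j)) +
        \sum_i \sum_j C i j *: (lbr g (X i) *o X j)).
      by rewrite -big_split; apply: eq_bigr => i _; rewrite -big_split.
    congr (_ + _).
      apply: eq_bigr => i _.
      transitivity (\sum_j \sum_k (C i j * a j k) *: (X i *o X k)).
        apply: eq_bigr => j _; rewrite aE compSr scaler_sumr; apply: eq_bigr => k _.
        by rewrite compZr scalerA.
      by rewrite exchange_big; apply: eq_bigr => k _; rewrite mxE scaler_suml.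
    transitivity (\sum_i \sum_j \sum_k (C i j * a i k) *: (X k *o X j)).
      apply: eq_bigr => i _; apply: eq_bigr => j _; rewrite aE compSl scaler_sumr.
      by apply: eq_bigr => k _; rewrite compZl scalerA.
    rewrite exchange_big [RHS]exchange_big; apply: eq_bigr => j _.
    rewrite exchange_big; apply: eq_bigr => k _; rewrite mxE scaler_suml.
    by apply: eq_bigr => i _; rewrite [a^T _ _]mxE mulrC.
  by rewrite lbrS Pa /S big1 // => i _; rewrite big1 // => j _; rewrite mxE scale0r.
- move=> v; rewrite /S sum_lfunE; apply: memv_suml => i _; rewrite sum_lfunE.
  apply: memv_suml => j _; rewrite !lfE memvZ // mem_actv ?memvf //.
- move=> v vI; rewrite /S sum_lfunE big1 // => i _; rewrite sum_lfunE big1 // => j _.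
  by rewrite !lfE (vI (X j)) // lf0 scaler0.
Qed.

End Casimir.

Section Twist.
Variables (F : fieldType) (X V : vectType F) (i : 'Hom(X, V)) (p : 'Hom(V, X)).

(** With [i] a section of [p], this is the operator induced on a subspace, a quotient or a
    subquotient, as long as the relevant subspaces are stable. *)
Definition twist : 'Hom('End(V), 'End(X)) := linfun (fun f : 'End(V) => p *o f *o i).

Lemma twistE f x : twist f x = p (f (i x)).
Proof.
rewrite /twist linfun_linE ?lfE // => a g h.
by apply/lfunP=> v; rewrite !lfE lfP.
Qed.

End Twist.

Section Weyl.
Variables (F : numClosedFieldType) (Q : vectType F) (brq : Q -> Q -> Q).
Hypotheses (lieQ : lie brq) (perfQ : ideals_perfect brq).

Definition lie_rep (V : vectType F) (rho : 'Hom(Q, 'End(V))) :=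
  forall x y, rho (brq x y) = lbr (rho x) (rho y).

Definition invs (V : vectType F) (G : {vspace 'End(V)}) : {vspace V} :=
  spanp (fun v : V => forall g : 'End(V), g \in G -> g v = 0).

Lemma invsP (V : vectType F) (G : {vspace 'End(V)}) v :
  v \in invs G <-> forall g : 'End(V), g \in G -> g v = 0.
Proof.
apply: mem_spanp => [g _|a x y Ex Ey g gG]; first by rewrite lf0.
by rewrite lfP Ex ?Ey // scaler0 addr0.
Qed.

Lemma lie_rep_closed (V : vectType F) (rho : 'Hom(Q, 'End(V))) : lie_rep rho -> lclosed (limg rho).
Proof.
by move=> rr _ _ /memv_imgP[x _ ->] /memv_imgP[y _ ->]; rewrite -rr memv_img ?memvf.
Qed.

(** The kernel [K'] of the trace form on the image is solvable by Cartan's criterion, while its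
    preimage is an ideal, hence perfect. So [K'] equals all its derived terms, one of which is
    zero. *)
Lemma rep_trace_nondegenerate (V : vectType F) (rho : 'Hom(Q, 'End(V))) : lie_rep rho ->
  forall g, g \in limg rho -> (forall h, h \in limg rho -> trl (g *o h) = 0) -> g = 0.
Proof.
move=> rr; set G := limg rho; have cG : lclosed G by apply: lie_rep_closed.
pose K' := spanp (fun g : 'End(V) => g \in G /\ forall h, h \in G -> trl (g *o h) = 0).
have K'P g : g \in K' <-> g \in G /\ forall h, h \in G -> trl (g *o h) = 0.
  apply: mem_spanp => [|a x y [xG Ex] [yG Ey]].
    split=> [|h hG]; first exact: mem0v.
    by have -> : 0 *o h = 0 :> 'End(V) by [apply/lfunP=> v; rewrite !lfE]; rewrite trl0.
  split=> [|h hG]; first by rewrite memvD ?memvZ.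
  have -> : (a *: x + y) *o h = a *: (x *o h) + y *o h by apply/lfunP=> v; rewrite !lfE.
  by rewrite trlP Ex ?Ey ?mulr0 ?addr0.
have idK' g f : g \in K' -> f \in G -> lbr g f \in K'.
  move=> /K'P[gG g0] fG; apply/K'P; split=> [|h hG]; first exact: cG.
  by rewrite -trl_comm g0 ?cG.
have [n K'n] : exists n, iter n (@lder _ V) K' = 0%VS.
  apply: cartan_solvable => [f g fK /K'P[gG _]|f g /K'P[_ f0] /K'P[gG _]].
    exact: idK'.
  exact: f0.
pose K := (rho @^-1: K')%VS.
have [bil alt _] := lieQ.
have iK : ideal brq K.
  apply: (idealI bil alt) => x y; rewrite /K -!memv_preim rr => xK.
  by apply: idK'; rewrite ?memv_img ?memvf.
have K'der : (K' <= lder K')%VS.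
  apply/subvP=> g gK'; have /K'P[/memv_imgP[x _ gx] _] := gK'.
  have : x \in K by rewrite -memv_preim -gx.
  rewrite gx -(perfQ iK); move: x {gx}; apply: span_ind => [|a x y Ex Ey|_ [x [y [xK yK ->]]]].
  - by rewrite lf0 mem0v.
  - by rewrite lfP memvD ?memvZ.
  by rewrite rr mem_lder // memv_preim.
have K'le m : (K' <= iter m (@lder _ V) K')%VS.
  elim: m => [|m IH] //=; apply: subv_trans K'der _.
  by apply: lder_le => f g fK gK; apply: mem_lder; apply: (subvP IH).
move=> g gG g0; apply/eqP; rewrite -memv0 -K'n; apply: (subvP (K'le n)).
exact/K'P.
Qed.

(** Complete reducibility in the form used later: invariants are complementary to the image of the
    action. The Casimir operator has nonzero trace, so its null component [V0] is a proper
    submodule, to which induction applies; the other components lie in the image of the action. *)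
Theorem weyl (V : vectType F) (rho : 'Hom(Q, 'End(V))) : lie_rep rho ->
  (invs (limg rho) + actv (limg rho) fullv = fullv)%VS /\
  (invs (limg rho) :&: actv (limg rho) fullv = 0)%VS.
Proof.
have [n] := ubnP (dim V); elim: n V rho => // n IH V rho; rewrite ltnS => dV rr.
set G := limg rho; have cG : lclosed G by apply: lie_rep_closed.
have [G0|G0] := eqVneq G 0%VS.
  have -> : invs G = fullv.
    apply/eqP; rewrite eqEsubv subvf /=; apply/subvP=> v _; apply/invsP => g.
    by rewrite G0 memv0 => /eqP ->; rewrite lfE.
  have -> : actv G fullv = 0%VS.
    apply/eqP; rewrite -subv0; apply: actv_le => g v; rewrite G0 memv0 => /eqP -> _.
    by rewrite lfE mem0v.
  by rewrite addv0 capv0.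
have [c [trc cc cQ cI]] := casimir_ex cG (rep_trace_nondegenerate rr).
have cgc g v : g \in G -> c (g v) = g (c v) by move=> gG; rewrite (lbr0_comm _ (cc g gG)).
pose V0 := genE c 0.
have V0full : V0 != fullv.
  apply: contra G0 => /eqP V0f; rewrite -dimv_eq0 -(eqr_nat F) -trc; apply/eqP.
  apply: trl_nilp => v; have : v \in V0 by rewrite V0f memvf.
  by move=> /genEP[m]; rewrite scale0r subr0; exists m.
have V0G g : g \in G -> stab g V0 by move=> gG; apply: genE_commute => v; apply: cgc.
pose i := linfun (vsval : subvs_of V0 -> V); pose p := linfun (vsproj V0).
have iE x : i x = vsval x by rewrite lfunE.
have pE v : p v = vsproj V0 v by rewrite lfunE.
pose rho0 : 'Hom(Q, 'End(subvs_of V0)) := twist i p *o rho.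
have rho0E x v : vsval (rho0 x v) = rho x (vsval v).
  rewrite comp_lfunE twistE iE pE vsprojK //.
  by apply: (V0G (rho x)); rewrite ?memv_img ?memvf ?subvsP.
have rr0 : lie_rep rho0.
  move=> x y; apply/lfunP=> v; apply: val_inj; rewrite /= lbrE linearB /= !rho0E rr lbrE //.
have dV0 : (dim (subvs_of V0) < n)%N.
  apply: leq_trans dV; rewrite -[dim (subvs_of V0)]/(\dim V0) -dimvf ltn_neqAle dimvS ?subvf // andbT.
  by apply: contra V0full => /eqP E; rewrite eqEdim subvf [\dim V0]E /=.
have [sum0 cap0] := IH _ _ dV0 rr0.
split.
  apply/eqP; rewrite eqEsubv subvf; apply/subvP=> v _; move: v (memvf v).
  apply: (@genE_ind _ _ c) => [|||mu v _ vE]; first by move=> *; apply: memvf.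
  - exact: mem0v.
  - by move=> a x y Ex Ey; rewrite memvD ?memvZ.
  have [mu0|mu0] := eqVneq mu 0.
    have vV0 : v \in V0 by rewrite /V0 -mu0.
    have := memvf (vsproj V0 v); rewrite -sum0 => /memv_addP[a /invsP aI [b bA ab]].
    have -> : v = vsval a + vsval b by rewrite -(vsprojK vV0) ab linearD.
    apply: memv_add.
      apply/invsP=> _ /memv_imgP[x _ ->]; rewrite -rho0E aI ?linear0 //.
      by rewrite memv_img ?memvf.
    move: b bA {ab}; apply: span_ind => [|t x y Ex Ey|_ [g [w [/memv_imgP[x _ ->] _ ->]]]].
    - by rewrite linear0 mem0v.
    - by rewrite linearP memvD ?memvZ.
    by rewrite rho0E mem_actv ?memv_img ?memvf.
  apply: subvP (addvSr _ _) _ _.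
  (* [c] maps into [actv G fullv], hence so does its spectral projection off the eigenvalue 0, which
     fixes [v]. *)
  have := @fcal_img _ _ c (fun z => (z != 0)%:R) fullv (actv G fullv).
  move=> /(_ _ _ _ v (memvf v)); rewrite (fcalE _ vE) mu0 scale1r; apply=> //.
  - by rewrite eqxx.
  - by move=> *; apply: memvf.
apply/eqP; rewrite -subv0; apply/subvP=> v /memv_capP[/invsP vI vA]; rewrite memv0.
have cv : c v = 0 by apply: cI => g; apply: vI.
have vV0 : v \in V0 by apply: eigen_genE; rewrite cv scale0r.
(* The projection onto [V0] commutes with [G]. It fixes the invariant [v] and carries [actv] of the
   whole module into that of [V0]. *)
pose e := fcal (fun z => (z == 0)%:R) c.
have ev : e v = v by rewrite (fcalE _ vV0) eqxx scale1r.
have eV0 w : e w \in V0.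
  move: w (memvf w); apply: (@genE_ind _ _ c) => [|||mu w _ wE]; first by move=> *; apply: memvf.
  - by rewrite lf0 mem0v.
  - by move=> a x y Ex Ey; rewrite lfP memvD ?memvZ.
  rewrite (fcalE _ wE); case: eqVneq wE => [->|_] wE; first by rewrite scale1r.
  by rewrite scale0r mem0v.
have : vsproj V0 v \in (invs (limg rho0) :&: actv (limg rho0) fullv)%VS.
  rewrite memv_cap; apply/andP; split.
    apply/invsP=> _ /memv_imgP[x _ ->]; apply: val_inj.
    by rewrite /= rho0E vsprojK // vI ?linear0 // memv_img ?memvf.
  rewrite -ev; move: v vA {vI cv vV0 ev}.
  apply: span_ind => [|t x y Ex Ey|_ [g [w [/memv_imgP[x _ ->] _ ->]]]].
  - by rewrite lf0 linear0 mem0v.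
  - by rewrite lfP linearP memvD ?memvZ.
  rewrite fcal_commute => [|z]; last by apply: cgc; rewrite memv_img ?memvf.
  have -> : vsproj V0 (rho x (e w)) = rho0 x (vsproj V0 (e w)).
    by apply: val_inj; rewrite /= rho0E !vsprojK // V0G ?memv_img ?memvf.
  by rewrite mem_actv ?memv_img ?memvf.
rewrite cap0 memv0 => /eqP E; apply/eqP.
by rewrite -(vsprojK vV0) E linear0.
Qed.

(** The algebra [L] acts on [Y] through its quotient [Q]; [rho] has to be a representation on [Y]
    only. The action of [Q] is read off along a linear section of [p], whose choice is immaterial
    because the kernel kills [Y]. *)
Lemma weyl_action (L V : vectType F) (brl : L -> L -> L) (p : 'Hom(L, Q))
    (rho : 'Hom(L, 'End(V))) (Y : {vspace V}) :
  br_morphism brl brq p -> limg p = fullv ->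
  (forall l, stab (rho l) Y) -> (forall l y, p l = 0 -> y \in Y -> rho l y = 0) ->
  (forall l m y, y \in Y -> rho (brl l m) y = lbr (rho l) (rho m) y) ->
  (forall y, y \in Y -> exists y0 y1, [/\ y = y0 + y1, y0 \in Y, forall l, rho l y0 = 0 &
     y1 \in spanp (fun y1 : V => exists (l : L) (z : V), z \in Y /\ y1 = rho l z)]) /\
  (forall y, y \in Y -> (forall l, rho l y = 0) ->
     y \in spanp (fun y1 : V => exists (l : L) (z : V), z \in Y /\ y1 = rho l z) -> y = 0).
Proof.
move=> pm pf rhoY rho0 rhoM.
pose s : 'Hom(Q, L) := (p^-1)%VF.
have ps q : p (s q) = q by rewrite limg_lfunVK // pf memvf.
pose iy := linfun (vsval : subvs_of Y -> V); pose py := linfun (vsproj Y).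
have iE x : iy x = vsval x by rewrite lfunE.
have pE v : py v = vsproj Y v by rewrite lfunE.
pose tau : 'Hom(Q, 'End(subvs_of Y)) := twist iy py *o rho *o s.
have rhoS l y : y \in Y -> rho l y = rho (s (p l)) y.
  move=> yY; apply/eqP; rewrite -subr_eq0; apply/eqP.
  have -> : rho l y - rho (s (p l)) y = rho (l - s (p l)) y by rewrite lfB !lfE.
  by apply: rho0 => //; rewrite lfB ps subrr.
have tauE q v : vsval (tau q v) = rho (s q) (vsval v).
  by rewrite !comp_lfunE twistE iE pE vsprojK //; apply/rhoY/subvsP.
have tauP l v : vsval (tau (p l) v) = rho l (vsval v).
  by rewrite tauE -rhoS ?subvsP.
have rr : lie_rep tau.
  move=> x y; rewrite -{1}(ps x) -{1}(ps y) -pm; apply/lfunP=> v; apply: val_inj.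
  by rewrite /= tauP rhoM ?subvsP // !lbrE linearB /= !tauE.
have [sumT capT] := weyl rr; split=> [y yY|y yY yI yA].
  have := memvf (vsproj Y y); rewrite -sumT => /memv_addP[a /invsP aI [b bA ab]].
  exists (vsval a), (vsval b); split.
  - by rewrite -(vsprojK yY) ab linearD.
  - exact: subvsP.
  - by move=> l; rewrite -tauP aI ?linear0 // memv_img ?memvf.
  move: b bA {ab}; apply: span_ind => [|t u w Eu Ew|_ [g [w [/memv_imgP[x _ ->] _ ->]]]].
  - by rewrite linear0 mem0v.
  - by rewrite linearP memvD ?memvZ.
  by apply: mem_span; exists (s x), (vsval w); rewrite tauE subvsP.
have : vsproj Y y \in (invs (limg tau) :&: actv (limg tau) fullv)%VS.
  rewrite memv_cap; apply/andP; split.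
    apply/invsP=> _ /memv_imgP[x _ ->]; apply: val_inj.
    by rewrite /= tauE vsprojK // yI linear0.
  move: y yA {yY yI}; apply: span_ind => [|t u w Eu Ew|_ [l [z [zY ->]]]].
  - by rewrite linear0 mem0v.
  - by rewrite linearP memvD ?memvZ.
  have -> : vsproj Y (rho l z) = tau (p l) (vsproj Y z).
    by apply: val_inj; rewrite /= tauP !vsprojK //; apply: rhoY.
  by rewrite mem_actv ?memv_img ?memvf.
rewrite capT memv0 => /eqP E.
by rewrite -(vsprojK yY) E linear0.
Qed.

End Weyl.

(** * The Lie center and Jordan decompositions *)

Section Powers.
Variables (F : numClosedFieldType) (V : vectType F) (br : V -> V -> V).
Implicit Types (x y : V) (U W : {vspace V}).

Lemma power_le U W n : (1 < n)%N ->
  (forall i j x y, (0 < i)%N -> (0 < j)%N -> (i + j = n)%N ->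
    x \in power br U i -> y \in power br U j -> br x y \in W) -> (power br U n <= W)%VS.
Proof.
move=> n1 H; rewrite powerE // big_seq; elim/big_ind: _ => [|X Y XW YW|i].
- exact: sub0v.
- by rewrite subv_add XW.
rewrite mem_index_iota => /andP[i0 ilt]; apply: brv_le => x y xU yU.
by apply: (H i (n - i)%N); rewrite ?subn_gt0 ?subnKC // ltnW.
Qed.

Lemma mem_power U i j x y : (0 < i)%N -> (0 < j)%N ->
  x \in power br U i -> y \in power br U j -> br x y \in power br U (i + j).
Proof.
move=> i0 j0 xU yU; have ij : (1 < i + j)%N by lia.
rewrite powerE //; have iin : i \in index_iota 1 (i + j) by rewrite mem_index_iota; lia.
rewrite (big_rem i iin) /=; apply: subvP (addvSl _ _) _ _.
by rewrite addKn; apply: mem_brv.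
Qed.

Lemma powerS U U' n : (0 < n)%N -> (U <= U')%VS -> (power br U n <= power br U' n)%VS.
Proof.
move=> + sU; elim/ltn_ind: n => -[|[|n]] IH // _.
apply: power_le => // i j x y i0 j0 ij xU yU; rewrite -ij mem_power //.
  by apply: (subvP (IH i _ i0)) => //; rewrite -ij; lia.
by apply: (subvP (IH j _ j0)) => //; rewrite -ij; lia.
Qed.

Lemma power_dec U n : subalg br U -> (0 < n)%N -> (power br U n.+1 <= power br U n)%VS.
Proof.
move=> sU; elim/ltn_ind: n => -[|[|n]] IH // _.
  apply: power_le => // i j x y i0 j0 ij.
  have [-> ->] : i = 1%N /\ j = 1%N by lia.
  exact: sU.
apply: power_le => // i j x y i0 j0 ij xU yU.
have [i1|i1] := leqP i 1.
  have [j2 ji] : (0 < j.-1)%N /\ (i + j.-1 = n.+2)%N by lia.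
  have yU' : y \in power br U j.-1.
    by apply: (subvP (IH j.-1 ltac:(lia) j2)); rewrite prednK.
  by rewrite -ji mem_power.
have [i2 ji] : (0 < i.-1)%N /\ (i.-1 + j = n.+2)%N by lia.
have xU' : x \in power br U i.-1.
  by apply: (subvP (IH i.-1 ltac:(lia) i2)); rewrite prednK.
by rewrite -ji mem_power.
Qed.

Lemma power_leq U m n : subalg br U -> (0 < m)%N -> (m <= n)%N ->
  (power br U n <= power br U m)%VS.
Proof.
move=> sU m0 /subnK <-; elim: (n - m)%N => // k IH; apply: subv_trans IH.
by rewrite addSn; apply: power_dec => //; lia.
Qed.

Lemma subalg_full : subalg br fullv. Proof. by move=> x y _ _; apply: memvf. Qed.

Lemma paren_product_gt0 n w : paren_product br n w -> (0 < n)%N.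
Proof. by elim=> // i j x y _ i0 _ _; lia. Qed.

Lemma paren_product_power n w : paren_product br n w -> w \in power br fullv n.
Proof.
elim=> [x|i j x y px xP py yP]; first exact: memvf.
by apply: mem_power => //; [apply: paren_product_gt0 px | apply: paren_product_gt0 py].
Qed.

Hypothesis bil : bilinear_br br.

Lemma power_paren n (W : {vspace V}) : (0 < n)%N ->
  (forall w, paren_product br n w -> w \in W) -> (power br fullv n <= W)%VS.
Proof.
move=> n0 H; apply: subv_trans (_ : spanp (paren_product br n) <= W)%VS; last exact: span_le.
move: n0 {H}; elim/ltn_ind: n => -[|[|n]] IH // _.
  by apply/subvP=> x _; apply: mem_span; constructor.
apply: power_le => // i j x y i0 j0 ij.
move=> /(subvP (IH i ltac:(lia) i0)) + /(subvP (IH j ltac:(lia) j0)); rewrite -ij => xP.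
move: x xP y; apply: span_ind => [y _|a u v Eu Ev y yP|x xP].
- by rewrite (br0l bil) mem0v.
- by rewrite (brPl bil) memvD ?memvZ ?Eu ?Ev.
apply: span_ind => [|a u v Eu Ev|y yP].
- by rewrite (br0 bil) mem0v.
- by rewrite (brP bil) memvD ?memvZ.
by apply: mem_span; constructor.
Qed.

End Powers.

Lemma power_morph (F : numClosedFieldType) (A B : vectType F) (brA : A -> A -> A)
    (brB : B -> B -> B) (f : 'Hom(A, B)) (U : {vspace A}) n : br_morphism brA brB f -> (0 < n)%N ->
  (f @: power brA U n)%VS = power brB (f @: U) n.
Proof.
move=> fm; elim/ltn_ind: n => -[|[|n]] IH // _.
apply/eqP; rewrite eqEsubv; apply/andP; split.
  apply/subvP=> _ /memv_imgP[x xU ->]; rewrite memv_preim.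
  suff /subvP : (power brA U n.+2 <= f @^-1: power brB (f @: U) n.+2)%VS by apply.
  apply: power_le => // i j {}x y i0 j0 ij {}xU yU; rewrite -memv_preim fm -ij mem_power //.
    by rewrite -IH ?memv_img //; lia.
  by rewrite -IH ?memv_img //; lia.
apply: power_le => // i j ? ? i0 j0 ij.
rewrite -IH // -?IH //; try lia.
move=> /memv_imgP[x xU ->] /memv_imgP[y yU ->]; rewrite -fm memv_img //.
by rewrite -ij mem_power.
Qed.

Section Malcev.
Variables (F : numClosedFieldType) (V : vectType F) (br : V -> V -> V).
Hypothesis malc : malcev br.
Implicit Types (x y z w a b : V) (U W I K : {vspace V}).

Lemma malc_bil : bilinear_br br. Proof. by case: malc. Qed.
Lemma malc_alt x : br x x = 0. Proof. by case: malc => _ ->. Qed.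
Local Notation bil := malc_bil.
Local Notation alt := malc_alt.
Local Notation J := (jac br).

Lemma malcC x y : br x y = - br y x. Proof. exact: (brC bil alt). Qed.

Lemma jac_rot x y z : J x y z = J y z x.
Proof. by rewrite /jac; vring. Qed.

Lemma jac_swap x y z : J x y z = - J y x z.
Proof.
by rewrite /jac (malcC y x) (malcC x z) (malcC z y) !(brNl bil); vring.
Qed.

Lemma jacP x y c u v : J x y (c *: u + v) = c *: J x y u + J x y v.
Proof. by rewrite /jac !(brE bil); vring. Qed.

Lemma jacPl x y c u v : J (c *: u + v) x y = c *: J u x y + J v x y.
Proof. by rewrite /jac !(brE bil); vring. Qed.

Lemma jac0r x y : J x y 0 = 0. Proof. by rewrite /jac !(brE bil) !addr0. Qed.

Lemma malc_id x y z : br (J x y z) x = J x y (br x z).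
Proof. by case: malc. Qed.

Lemma malc_lin x y z w :
  br (J x y z) w + br (J w y z) x = J x y (br w z) + J w y (br x z).
Proof.
have jD u v s t : J (u + v) s t = J u s t + J v s t by have := jacPl s t 1 u v; rewrite !scale1r.
have jDr u v s t : J s t (u + v) = J s t u + J s t v by have := jacP s t 1 u v; rewrite !scale1r.
have E : br (J x y z + J w y z) (x + w) = J x y (br (x + w) z) + J w y (br (x + w) z).
  by rewrite -!jD malc_id.
rewrite [br (x + w) z](brDl bil) !jDr (brD bil (J x y z + J w y z)) in E.
rewrite !(brDl bil (J x y z)) !malc_id in E.
apply: (addrI (J x y (br x z))); apply: (addIr (J w y (br w z))).
by transitivity (J x y (br x z) + J x y (br w z) + (J w y (br x z) + J w y (br w z)));
  [rewrite -E|]; vring.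
Qed.

Lemma jac_leib x y z : J x y z = 0 -> br x (br y z) = br (br x y) z + br y (br x z).
Proof.
rewrite /jac => /eqP; rewrite addrAC addr_eq0 => /eqP E.
rewrite [br x (br y z)]malcC -E; congr (_ + _).
by rewrite [br z x]malcC (brNl bil) -malcC.
Qed.

Definition Lc : {vspace V} := spanp (lie_center br).

Lemma LcP x : x \in Lc <-> forall y z, J x y z = 0.
Proof.
apply: mem_spanp => [y z|a u v Eu Ev y z]; first by rewrite jac_rot jac0r.
by rewrite jacPl Eu Ev scaler0 addr0.
Qed.

Lemma Lc_jac x y z : x \in Lc -> J x y z = 0. Proof. by move/LcP. Qed.
Lemma Lc_jac2 x y z : x \in Lc -> J y x z = 0.
Proof. by move=> xL; rewrite jac_swap Lc_jac ?oppr0. Qed.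
Lemma Lc_jac3 x y z : x \in Lc -> J y z x = 0.
Proof. by move=> xL; rewrite -jac_rot Lc_jac. Qed.

Definition derivation (D : 'End(V)) := forall x y, D (br x y) = br (D x) y + br x (D y).

Lemma derivation_jac D x y z : derivation D ->
  D (J x y z) = J (D x) y z + J x (D y) z + J x y (D z).
Proof. by move=> dD; rewrite /jac !(lfD, dD, brE bil); vring. Qed.

Lemma Lc_derivation x : x \in Lc -> derivation (ad br x).
Proof. by move=> xL y z; rewrite !(adE bil) jac_leib // Lc_jac. Qed.

(** For [w] in the Lie center, the linearized Malcev identity gives
    [J a b (br w c) = - br w (J a b c)]. As [ad w] is a derivation, [br w (J x y z)] is a sum of
    three such terms, so four times it is zero. *)
Lemma Lc_ideal : ideal br Lc.
Proof.
apply: (idealI bil alt) => w x wL; apply/LcP => y z.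
have st a b c : J a b (br w c) = - br w (J a b c).
  have := malc_lin a b c w; rewrite !(Lc_jac _ _ wL) (br0l bil) !addr0 => <-.
  exact: malcC.
have := derivation_jac x y z (Lc_derivation wL); rewrite !(adE bil) => E.
have E1 : J (br w x) y z = - br w (J x y z) by rewrite jac_rot st jac_rot -jac_rot -[J y z x]jac_rot.
have E2 : J x (br w y) z = - br w (J x y z) by rewrite -jac_rot st jac_rot.
have {E2} : br w (J x y z) = 0.
  have : br w (J x y z) *+ 4 = 0.
    by rewrite E1 E2 st in E; rewrite !mulrS mulr0n {1}E; vring.
  by move/eqP; rewrite -scaler_nat scaler_eq0 pnatr_eq0 => /eqP.
by rewrite E1 => ->; rewrite oppr0.
Qed.

Lemma ad_Lcl x a : x \in Lc -> ad br (br x a) = lbr (ad br x) (ad br a).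
Proof.
move=> xL; apply/lfunP=> z; rewrite lbrE !(adE bil) [br x (br a z)]jac_leib ?addrK //.
exact: Lc_jac.
Qed.

Lemma ad_Lcr x a b : x \in Lc -> br (br a b) x = br a (br b x) - br b (br a x).
Proof. by move=> xL; rewrite [br a (br b x)]jac_leib ?addrK // Lc_jac3. Qed.

Lemma Lc_leib x a b : x \in Lc -> br a (br x b) = br (br a x) b + br x (br a b).
Proof. by move=> xL; apply: jac_leib; apply: Lc_jac2. Qed.

Lemma derivation_ad D a : derivation D -> ad br (D a) = lbr D (ad br a).
Proof. by move=> dD; apply/lfunP=> x; rewrite lbrE !(adE bil) dD addrK. Qed.

End Malcev.

Section JordanParts.
Variables (F : numClosedFieldType) (V : vectType F) (br : V -> V -> V).
Hypothesis malc : malcev br.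
Implicit Types (x y z w a b g t : V) (U W I K : {vspace V}).
Local Notation bil := (malc_bil malc).
Local Notation alt := (malc_alt malc).
Local Notation J := (jac br).

Definition js a : 'End(V) := fcal id (ad br a).

Lemma leib_jac x y z : br x (br y z) = br (br x y) z + br y (br x z) -> J x y z = 0.
Proof.
move=> E; have := E; rewrite /jac (malcC malc (br y z) x) E.
by rewrite (malcC malc (br z x) y) (malcC malc z x) (brN bil) => _; vring.
Qed.

Lemma RopE a x : Rop br a x = - ad br a x.
Proof. by rewrite (adE bil) /Rop (malcC malc). Qed.

Lemma iter_Rop a m x : iter m (Rop br a) x = (-1) ^+ m *: iter m (ad br a) x.
Proof.
elim: m => [|m IH]; first by rewrite scale1r.
by rewrite !iterS RopE IH lfZ exprS mulN1r scaleNr.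
Qed.

Lemma nilpotent_eltP a : nilpotent_elt br a <-> forall x, exists m, iter m (ad br a) x = 0.
Proof.
have H m x : iter m (Rop br a) x = 0 <-> iter m (ad br a) x = 0.
  rewrite iter_Rop; split=> [/eqP|->]; last by rewrite scaler0.
  by rewrite scaler_eq0 signr_eq0 => /eqP.
split=> [[m mE] x|nE]; first by exists m; apply/H.
have [m mE] : exists m, forall u, u \in fullv -> iter m (ad br a) u = 0.
  by apply: nilp_uniform => u _.
by exists m => x; apply/H/mE/memvf.
Qed.

Lemma semisimple_eltP a : semisimple_elt br a <-> diagble (ad br a).
Proof.
rewrite diagble_basis; split=> -[X [Xb XE]]; exists X; split=> // x /XE[c cE]; exists (- c).
  by rewrite scaleNr -cE RopE opprK.
by rewrite RopE cE scaleNr.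
Qed.

(** By uniqueness of the Jordan decomposition the semisimple summand must act as [js g]. Being a
    splitting element thus means that a given operator is inner; [t] itself is determined only up to
    elements acting by zero. *)
Lemma splitting_eltP g : splitting_elt br g <-> exists t, ad br t = js g.
Proof.
split=> [[t [n [gE /semisimple_eltP st /nilpotent_eltP nn tn]]]|[t tE]].
  have gE' : ad br g = ad br t + ad br n by rewrite gE lfD.
  exists t; apply: fcal_id_uniq => // x; rewrite gE'; last first.
    by have [m mx] := nn x; exists m; rewrite addrC addKr.
  rewrite !lfE lfD; congr (_ + _).
  by have := tn x; rewrite !RopE !lfN => /oppr_inj/oppr_inj.
have nE : ad br (g - t) = ad br g - js g by rewrite lfB tE.
exists t, (g - t); split.
- by rewrite addrC subrK.
- by apply/semisimple_eltP; rewrite tE; apply: fcal_diagble.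
- by apply/nilpotent_eltP; rewrite nE; apply: fcal_id_nilp.
move=> x; rewrite !RopE !lfN; congr (- - _); rewrite tE nE !lfE lfB.
by rewrite /js fcal_self.
Qed.

Lemma genE_iter_img (f : 'End(V)) mu v m : mu != 0 -> v \in genE f mu ->
  exists v', v = iter m f v'.
Proof.
move=> mu0; elim: m v => [|m IH] v vE; first by exists v.
have: fcal (fun z : F => (z != 0)%:R) f v \in (f @: genE f mu)%VS.
  apply: (fcal_img (U := genE f mu)) => //; first by rewrite eqxx.
    exact: genE_stab.
  by move=> u uE; apply: memv_img.
rewrite (fcalE _ vE) mu0 scale1r => /memv_imgP[u /IH[v' ->] ->].
by exists v'.
Qed.

Lemma iter_ad_power a m x : iter m (ad br a) x \in power br fullv m.+1.
Proof.
elim: m => [|m IH]; first exact: memvf.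
by rewrite iterS (adE bil) -add1n mem_power // power1 memvf.
Qed.

Lemma NL_power k : (0 < k)%N -> NL br k <-> malcev br /\ (power br fullv k <= Lc br)%VS.
Proof.
move=> k0; split=> -[_ H]; split=> //.
  by apply: (power_paren bil k0) => w wP; apply/(LcP malc) => y z; apply: H.
by move=> w y z /paren_product_power/(subvP H)/(LcP malc).
Qed.

(** Let [f = ad g]. By the Malcev identity [J g y] anticommutes with [f], so it preserves the null
    component. Since [f (br y z)] is [br (f y) z + br y (f z) - J g y z], induction on the sum of
    the two exponents concludes. *)
Lemma genE0_mul g y z : y \in genE (ad br g) 0 -> z \in genE (ad br g) 0 ->
  br y z \in genE (ad br g) 0.
Proof.
set f := ad br g; have fE x : f x = br g x by apply: adE bil _ _.
have E0P v : v \in genE f 0 <-> exists n, iter n f v = 0.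
  by rewrite genEP scale0r subr0.
have jac0 z' y' : z' \in genE f 0 -> J g y' z' \in genE f 0.
  move=> /E0P[n nz]; apply/E0P; exists n.
  suff E m : iter m f (J g y' z') = (-1) ^+ m *: J g y' (iter m f z').
    by rewrite E nz jac0r // scaler0.
  elim: m => [|m IH]; first by rewrite scale1r.
  rewrite !iterS IH lfZ !fE exprS mulN1r scaleNr -scalerN; congr (_ *: _).
  by rewrite (malcC malc g) (malc_id malc).
move=> /E0P[p py] /E0P[q qz].
have : (p + q <= p + q)%N by []; move: {2}(p + q)%N => m.
elim: m p q y z py qz => [|m IH] p q y z py qz pqm.
  move: pqm py; rewrite leqn0 addn_eq0 => /andP[/eqP -> _] /= ->.
  by rewrite (br0l bil) mem0v.
suff : f (br y z) \in genE f 0 by move=> /E0P[n]; rewrite -iterSr => nE; apply/E0P; exists n.+1.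
have zE : z \in genE f 0 by apply/E0P; exists q.
have -> : f (br y z) = br (f y) z + br y (f z) - J g y z.
  rewrite !fE /jac (malcC malc (br y z) g) (malcC malc (br z g) y) (malcC malc z g) (brN bil).
  by vring.
apply: memvB; last exact: jac0.
apply: memvD.
  case: p => [|p] in py pqm *.
    by move: py => /= ->; rewrite lf0 (br0l bil) mem0v.
  by apply: (IH p q); rewrite -?iterSr.
case: q => [|q] in qz pqm *.
  by move: qz => /= ->; rewrite lf0 (br0 bil) mem0v.
by apply: (IH p q); rewrite -?iterSr //; lia.
Qed.

Section NLk.
Variable k : nat.
Hypotheses (k0 : (0 < k)%N) (HL : (power br fullv k <= Lc br)%VS).

Lemma genE_Lc g mu : mu != 0 -> (genE (ad br g) mu <= Lc br)%VS.
Proof.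
move=> mu0; apply/subvP=> v /(genE_iter_img k mu0)[v' ->].
apply: (subvP HL); apply: subvP (iter_ad_power g k v').
by apply: power_dec => //; apply: subalg_full.
Qed.

Lemma js_genE0 g x : x \in genE (ad br g) 0 -> js g x = 0.
Proof. by move=> xE; rewrite /js (fcalE _ xE) scale0r. Qed.

Lemma ad_stab_ideal g I : ideal br I -> stab (ad br g) I.
Proof. by move=> iI x xI; rewrite (adE bil) (ideal_memr _ iI). Qed.

Lemma js_derivation g : derivation br (js g).
Proof.
have stf : stab (ad br g) fullv by move=> *; apply: memvf.
have LE x y : x \in Lc br -> js g (br x y) = br (js g x) y + br x (js g y).
  move=> xL; apply: (@fcal_bilin _ _ _ _ br _ _ _ (Lc br) fullv) => //.
  - exact: (br_linr bil).
  - exact: (br_linl bil).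
  - exact/ad_stab_ideal/(Lc_ideal malc).
  - by move=> u v uL _; rewrite !(adE bil) (Lc_leib malc).
  - exact: memvf.
have LEr x y : x \in Lc br -> js g (br y x) = br (js g y) x + br y (js g x).
  move=> xL; rewrite (malcC malc) lfN LE // opprD addrC (malcC malc _ y) opprK.
  by rewrite (malcC malc x) opprK.
move=> x y; move: x (memvf x); apply: (genE_ind stf) => [|c u v Eu Ev|mu x _ xE].
- by rewrite !lf0 !(br0l bil) lf0 addr0.
- by rewrite !lfP !(brPl bil) lfP Eu Ev; vring.
have [mu0|/(genE_Lc g)/subvP/(_ x xE)/LE -> //] := eqVneq mu 0; rewrite mu0 in xE.
move: y (memvf y); apply: (genE_ind stf) => [|c u v Eu Ev|nu y _ yE].
- by rewrite !lf0 !(br0 bil) lf0 addr0.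
- by rewrite !lfP !(brP bil) lfP Eu Ev; vring.
have [nu0|/(genE_Lc g)/subvP/(_ y yE)/LEr -> //] := eqVneq nu 0; rewrite nu0 in yE.
by rewrite !js_genE0 ?genE0_mul // (br0l bil) (br0 bil) addr0.
Qed.

Lemma js_Lc g x : js g x \in Lc br.
Proof.
move: x (memvf x); apply: (@genE_ind _ _ (ad br g)) => [|||mu x _ xE].
- by move=> *; apply: memvf.
- by rewrite lf0 mem0v.
- by move=> c u v Eu Ev; rewrite lfP memvD ?memvZ.
have [mu0|/(genE_Lc g)/subvP/(_ x xE) xL] := eqVneq mu 0.
  by rewrite js_genE0 ?mem0v // -mu0.
by rewrite /js (fcalE _ xE) memvZ.
Qed.

Lemma ad_eq0_js g x : br g x = 0 -> js g x = 0.
Proof. by move=> gx; apply/js_genE0/eigen_genE; rewrite (adE bil) gx scale0r. Qed.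

Lemma js_self g : js g g = 0. Proof. by rewrite ad_eq0_js ?alt. Qed.

Lemma semisimple_Lc t : diagble (ad br t) -> t \in Lc br.
Proof.
move=> dt; apply/(LcP malc) => y z; apply: leib_jac.
by have := js_derivation t y z; rewrite /js fcal_id_diagble // !(adE bil).
Qed.

End NLk.

End JordanParts.

Section Subalgebra.
Variables (F : numClosedFieldType) (V : vectType F) (br : V -> V -> V).
Hypothesis malc : malcev br.
Implicit Types (x y z w a b g t : V) (U W I K : {vspace V}).
Local Notation bil := (malc_bil malc).
Local Notation alt := (malc_alt malc).
Local Notation J := (jac br).

Lemma sub_brE U (x y : subvs_of U) : subalg br U -> vsval (sub_br br U x y) = br (vsval x) (vsval y).
Proof. by move=> sU; rewrite /sub_br vsprojK // sU ?subvsP. Qed.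

Lemma sub_jacE U (x y z : subvs_of U) : subalg br U ->
  vsval (jac (sub_br br U) x y z) = J (vsval x) (vsval y) (vsval z).
Proof. by move=> sU; rewrite /jac !linearD /= !sub_brE. Qed.

Lemma sub_malcev U : subalg br U -> malcev (sub_br br U).
Proof.
move=> sU; split=> [|x|x y z].
- have vsP c (u v : subvs_of U) : vsval (c *: u + v) = c *: vsval u + vsval v by [].
  by split=> x c u v; apply: val_inj; rewrite /= ?vsP !sub_brE // vsP ?(brP bil) ?(brPl bil).
- by apply: val_inj; rewrite /= sub_brE // alt.
by apply: subvs_inj; rewrite (sub_brE _ _ sU) !(sub_jacE _ _ _ sU) (malc_id malc) (sub_brE _ _ sU).
Qed.

End Subalgebra.

Section MinimalSplitting.
Variables (F : numClosedFieldType) (V : vectType F) (br : V -> V -> V).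
Hypothesis splA : splitting_alg br.
Implicit Types (x y z w a b g t : V) (U W I K : {vspace V}).
Let malc : malcev br := proj1 splA.
Local Notation bil := (malc_bil malc).
Local Notation alt := (malc_alt malc).
Local Notation J := (jac br).
Variable k : nat.
Hypothesis k2 : (2 <= k)%N.

Definition NLsub U := forall w y z, w \in power br U k -> y \in U -> z \in U -> J w y z = 0.

Lemma power2 U x y : x \in U -> y \in U -> br x y \in power br U 2.
Proof. by move=> xU yU; apply: (@mem_power _ _ br U 1 1). Qed.

(** [ad g] maps [U^j] into [U^(j+1)], and a function of it that vanishes at 0 has image in the same
    subspace. *)
Lemma js_power U g j x : subalg br U -> g \in U -> (0 < j)%N -> x \in power br U j ->
  js br g x \in power br U j.+1.
Proof.
move=> sU gU j0 xj; have step u : u \in power br U j -> ad br g u \in power br U j.+1.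
  by move=> uj; rewrite (adE bil) -add1n mem_power.
apply: (fcal_img (U := power br U j)) => // u uj.
by apply: (subvP (power_dec sU j0)); apply: step.
Qed.

(** [t] acts as [js g], so a bracket with [t] raises the degree at least as much as one with an
    element of [U], and [br t t = 0]. Hence a multiple of [t] can occur as a summand in degree 1
    only. *)
Lemma power_adjoin U g t n : subalg br U -> g \in U -> ad br t = js br g -> (1 < n)%N ->
  (power br (U + <[t]>) n <= power br U n)%VS.
Proof.
move=> sU gU tE; have tj j x : (0 < j)%N -> x \in power br U j -> br t x \in power br U j.+1.
  by move=> j0 xj; rewrite -(adE bil) tE js_power.
have tj' j x : (0 < j)%N -> x \in power br U j -> br x t \in power br U j.+1.
  by move=> j0 xj; rewrite (malcC malc) memvN tj.
elim/ltn_ind: n => n IH n1; apply: power_le => // i j x y i0 j0 ij xi yj.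
have pwr m z : (0 < m)%N -> (m < n)%N -> z \in power br (U + <[t]>) m ->
   exists c u, [/\ u \in power br U m, z = u + c *: t & (1 < m)%N -> c = 0].
  move=> m0 mn; have [m1|m1] := ltnP 1 m.
    by move=> /(subvP (IH m mn m1)) zm; exists 0, z; rewrite scale0r addr0.
  have -> : m = 1%N by lia.
  by move=> /memv_addP[u uU [_ /vlineP[c ->] ->]]; exists c, u.
have [c [u [ui -> ci]]] := pwr i x i0 ltac:(lia) xi.
have [d [v [vj -> dj]]] := pwr j y j0 ltac:(lia) yj.
rewrite (brD bil) !(brDl bil) !(brZ bil) !(brZl bil) alt !scaler0 addr0.
rewrite -ij; apply: memvD; first apply: memvD.
- exact: mem_power.
- have [/ci ->|i1] := ltnP 1 i; first by rewrite scale0r mem0v.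
  have -> : i = 1%N by lia.
  by rewrite add1n memvZ ?tj.
have [/dj ->|j1] := ltnP 1 j; first by rewrite scale0r mem0v.
have -> : j = 1%N by lia.
by rewrite addn1 memvZ ?tj'.
Qed.

Lemma subalg_adjoin U g t : subalg br U -> g \in U -> ad br t = js br g -> subalg br (U + <[t]>)%VS.
Proof.
move=> sU gU tE x y xU yU; apply: (subvP (addvSl _ _)).
have: br x y \in power br (U + <[t]>) 2 by apply: power2.
move=> /(subvP (@power_adjoin U g t 2 sU gU tE isT)).
exact: (subvP (@power_dec _ _ br U 1 sU isT)).
Qed.

(** The only new Jacobians are those of [w], [u] and [t]. Since [J g w u = 0], the operator [ad g]
    satisfies the Leibniz rule on [U^k] times [U]; its semisimple part [ad t] inherits it. *)
Lemma NLsub_adjoin U g t : subalg br U -> NLsub U -> g \in U -> ad br t = js br g ->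
  NLsub (U + <[t]>)%VS.
Proof.
move=> sU nU gU tE w y z /(subvP (power_adjoin sU gU tE k2)) wk.
have k0 : (0 < k)%N by lia.
have wut u : u \in U -> J w u t = 0.
  move=> uU; rewrite -jac_rot; apply: (leib_jac malc).
  have adt v : br t v = js br g v by rewrite -(adE bil) tE.
  rewrite !adt.
  have gst j : (0 < j)%N -> stab (ad br g) (power br U j).
    move=> j0 v vj; rewrite (adE bil); apply: (subvP (power_dec sU j0)).
    by rewrite -add1n mem_power.
  apply: (@fcal_bilin _ _ _ _ br _ _ _ (power br U k) U) => //.
  - exact: (br_linr bil).
  - exact: (br_linl bil).
  - exact: gst.
  - exact: (gst 1%N).
  - move=> {}w {}u {}wk {}uU; rewrite !(adE bil); apply: (jac_leib malc).
    by rewrite jac_rot nU.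
move=> /memv_addP[u uU [_ /vlineP[c ->] ->]] /memv_addP[v vU [_ /vlineP[d ->] ->]].
rewrite [v + _]addrC (jacP malc) -[J _ _ v](jac_rot) -[J v w _]jac_rot.
have E1 : J w (u + c *: t) t = 0.
  have tt : J t t w = 0 by rewrite /jac alt (br0l bil) (malcC malc w t) (brNl bil); vring.
  rewrite (jac_rot br w) [u + _]addrC (jacPl malc) tt scaler0 add0r -(jac_rot br w u t).
  exact: wut.
have E2 : J (u + c *: t) v w = 0.
  rewrite [u + _]addrC (jacPl malc) -(jac_rot br w u v) (nU w u v) // addr0.
  by rewrite (jac_swap malc t) -(jac_rot br w v t) wut ?oppr0 ?scaler0.
by rewrite E1 scaler0 add0r E2.
Qed.

(** A subalgebra [U] maximal among those that contain [U0] and satisfy the relative identity already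
    contains all the semisimple parts of its elements, so it is splitting, and minimality makes it
    the whole algebra. *)
Lemma minimal_splitting_NL (U0 : {vspace V}) : subalg br U0 -> NLsub U0 ->
  (forall U, subalg br U -> (U0 <= U)%VS -> splitting_alg (sub_br br U) -> U = fullv) ->
  NL br k.
Proof.
move=> sU0 nU0 minU.
have [U [U0U sU nU] maxU] :=
  @max_vspace _ _ (fun U => [/\ (U0 <= U)%VS, subalg br U & NLsub U]) U0 (And3 (subvv _) sU0 nU0).
suff UE : U = fullv.
  apply/(NL_power malc (ltnW k2)); split=> //; apply/subvP=> w wk.
  by apply/(LcP malc) => y z; apply: nU; rewrite UE ?memvf.
apply: minU => //; split=> [|g]; first exact: (sub_malcev malc).
have [t tE] := proj1 (splitting_eltP malc _) (proj2 splA (vsval g)).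
have tU : t \in U.
  apply: contraT => tU; have := maxU (U + <[t]>)%VS.
  have -> : (\dim (U + <[t]>) <= \dim U)%N = false.
    rewrite dimv_disjoint_sum ?dim_vline.
      have -> : t != 0 by apply: contra tU => /eqP ->; rewrite mem0v.
      by rewrite addn1 ltnn.
    apply/eqP; rewrite -subv0; apply/subvP=> v /memv_capP[vM /vlineP[a va]].
    move: vM; rewrite {v}va memv0; have [->|a0] := eqVneq a 0; first by rewrite scale0r.
    by move=> /(memvZ a^-1); rewrite scalerA mulVf // scale1r (negbTE tU).
  move=> H; suff: false by []; apply: H; split.
  - exact: subv_trans U0U (addvSl _ _).
  - exact: (subalg_adjoin sU (subvsP g) tE).
  - exact: (NLsub_adjoin sU nU (subvsP g) tE).
have mU := sub_malcev malc sU.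
apply/(splitting_eltP mU); exists (vsproj U t).
have adS (x y : subvs_of U) : vsval (ad (sub_br br U) x y) = ad br (vsval x) (vsval y).
  by rewrite (adE (malc_bil mU)) sub_brE // (adE bil).
have itS (x y : subvs_of U) mu m : vsval (iter m (ad (sub_br br U) x - mu *: \1%VF) y) =
    iter m (ad br (vsval x) - mu *: \1%VF) (vsval y).
  by elim: m => //= m <-; rewrite !shiftE linearB linearZ /= adS.
(* Generalized eigenvectors of the restricted multiplication are generalized eigenvectors in the
   ambient algebra, so the semisimple part of the restriction is the restriction of [js]. *)
apply: fcal_uniq => mu v /genEP[n nv]; apply: val_inj.
rewrite /= adS vsprojK // tE /js (@fcalE _ _ _ _ mu) //.
by apply/genEP; exists n; rewrite -itS nv linear0.
Qed.

End MinimalSplitting.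

(** * Semisimple algebras and Levi factors *)

Section Quotient.
Variables (F : numClosedFieldType) (A B : vectType F) (brA : A -> A -> A) (brB : B -> B -> B).
Variable p : 'Hom(A, B).
Hypotheses (pm : br_morphism brA brB p) (pf : limg p = fullv).

Lemma surj_ex y : exists x, y = p x.
Proof. by have := memvf y; rewrite -pf => /memv_imgP[x _ ->]; exists x. Qed.

Lemma morph_jac x y z : p (jac brA x y z) = jac brB (p x) (p y) (p z).
Proof. by rewrite /jac !lfD !pm. Qed.

Lemma surj_bilinear : bilinear_br brA -> bilinear_br brB.
Proof.
move=> bil; split=> x c y z; have [[a ->] [b ->] [d ->]] := And3 (surj_ex x) (surj_ex y) (surj_ex z).
  by rewrite -lfP -!pm (brP bil) lfP.
by rewrite -lfP -!pm (brPl bil) lfP.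
Qed.

Lemma surj_malcev : malcev brA -> malcev brB.
Proof.
move=> [bil alt mi]; split=> [|x|x y z]; first exact: surj_bilinear.
  by have [a ->] := surj_ex x; rewrite -pm alt lf0.
have [[a ->] [b ->] [d ->]] := And3 (surj_ex x) (surj_ex y) (surj_ex z).
by rewrite -morph_jac -!pm -morph_jac mi.
Qed.

Lemma surj_Lc (mA : malcev brA) : (p @: Lc brA <= Lc brB)%VS.
Proof.
apply/subvP=> _ /memv_imgP[x /(LcP mA) xL ->]; apply/(LcP (surj_malcev mA)) => y z.
by have [[b ->] [d ->]] := conj (surj_ex y) (surj_ex z); rewrite -morph_jac xL lf0.
Qed.

Lemma surj_power k (mA : malcev brA) : (0 < k)%N -> (power brA fullv k <= Lc brA)%VS ->
  (power brB fullv k <= Lc brB)%VS.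
Proof.
by move=> k0 kL; rewrite -pf -(power_morph _ pm) //; apply: subv_trans (limgS _ kL) (surj_Lc mA).
Qed.

End Quotient.

Section Morphism.
Variables (F : numClosedFieldType) (A B : vectType F) (brA : A -> A -> A) (brB : B -> B -> B).
Variable p : 'Hom(A, B).
Hypotheses (pm : br_morphism brA brB p).

Lemma morph_brv U W : (p @: brv brA U W)%VS = brv brB (p @: U) (p @: W).
Proof.
apply/eqP; rewrite eqEsubv; apply/andP; split.
  apply/subvP=> _ /memv_imgP[x xU ->]; move: x xU; apply: span_ind => [|c u v Eu Ev|_ [u [w [uU wW ->]]]].
  - by rewrite lf0 mem0v.
  - by rewrite lfP memvD ?memvZ.
  by rewrite pm mem_brv ?memv_img.
by apply: brv_le => _ _ /memv_imgP[x xU ->] /memv_imgP[y yU ->]; rewrite -pm memv_img ?mem_brv.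
Qed.

Lemma morph_derived n U :
  (p @: iter n (fun W => brv brA W W) U)%VS = iter n (fun W => brv brB W W) (p @: U)%VS.
Proof. by elim: n => //= n IH; rewrite morph_brv IH. Qed.

Lemma preim_ideal I : ideal brB I -> ideal brA (p @^-1: I).
Proof.
move=> iI; split=> [|x y]; first exact: subvf.
rewrite -memv_preim => xI _; rewrite -!memv_preim !pm.
by split; [apply: ideal_mem | apply: ideal_memr].
Qed.

End Morphism.

Lemma quotient_alg (F : numClosedFieldType) (A : vectType F) (br : A -> A -> A) (I : {vspace A}) :
  bilinear_br br -> ideal br I ->
  exists (B : vectType F) (brB : B -> B -> B) (p : 'Hom(A, B)),
    [/\ br_morphism br brB p, limg p = fullv & lker p = I].
Proof.
move=> bil iI; have [B [p [pf pk]]] := quotient_space I.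
exists B, (fun x y => p (br (p^-1%VF x) (p^-1%VF y))), p; split=> // x y.
have lift z : p^-1%VF (p z) - z \in I.
  by rewrite -pk memv_ker lfB limg_lfunVK ?subrr // memv_img ?memvf.
apply/eqP; rewrite -subr_eq0 -lfB -memv_ker pk -opprB memvN.
set x' := p^-1%VF (p x); set y' := p^-1%VF (p y).
have -> : br x' y' - br x y = br (x' - x) y' + br x (y' - y).
  by rewrite !(brE bil); vring.
by apply: memvD; [exact: ideal_mem iI (lift x) | exact: ideal_memr iI (lift y)].
Qed.

Section Solvable.
Variables (F : numClosedFieldType) (V : vectType F) (br : V -> V -> V).
Hypotheses (bil : bilinear_br br) (alt : forall x, br x x = 0).
Implicit Types (x y : V) (I J U W R : {vspace V}).
Local Notation der n U := (iter n (fun W => brv br W W) U).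

Lemma derivedS n U U' : (U <= U')%VS -> (der n U <= der n U')%VS.
Proof. by elim: n => //= n IH /IH sU; apply: brvS. Qed.

Lemma solvableS U U' : (U <= U')%VS -> solvable br U' -> solvable br U.
Proof. by move=> sU [n Un]; exists n; apply/eqP; rewrite -subv0 -Un derivedS. Qed.

Lemma solvable_derived n U : solvable br (der n U) -> solvable br U.
Proof. by move=> [m]; rewrite -iterD; exists (m + n)%N. Qed.

Lemma solvable_abelian U : (forall x y, x \in U -> y \in U -> br x y = 0) -> solvable br U.
Proof.
move=> ab; exists 1%N; apply/eqP; rewrite -subv0; apply: brv_le => x y xU yU.
by rewrite ab ?mem0v.
Qed.

Lemma idealD I J : ideal br I -> ideal br J -> ideal br (I + J)%VS.
Proof.
move=> iI iJ; apply: (idealI bil alt) => _ y /memv_addP[u uI [v vJ ->]].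
by rewrite (brDl bil) memv_add ?ideal_mem.
Qed.

Lemma idealX I J : ideal br I -> ideal br J -> ideal br (I :&: J)%VS.
Proof.
move=> iI iJ; apply: (idealI bil alt) => x y /memv_capP[xI xJ].
by rewrite memv_cap !ideal_mem.
Qed.

Lemma ideal_subalg I : ideal br I -> subalg br I.
Proof. by move=> iI x y xI _; apply: ideal_mem. Qed.

Lemma solvableD I J : ideal br I -> ideal br J -> solvable br I -> solvable br J ->
  solvable br (I + J)%VS.
Proof.
move=> iI iJ sI [n Jn]; apply: (@solvable_derived n); apply: solvableS sI.
have le m : (der m (I + J) <= I + der m J)%VS.
  elim: m => //= m IH; apply: subv_trans (@brvS _ _ br _ _ _ _ IH IH) _; apply: brv_le => ? ?.
  move=> /memv_addP[u uI [v vJ ->]] /memv_addP[u' uI' [v' vJ' ->]].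
  have -> : br (u + v) (u' + v') = (br u u' + br v u' + br u v') + br v v'.
    by rewrite !(brE bil); vring.
  apply: memv_add; last exact: mem_brv.
  apply: memvD; last exact: ideal_mem.
  by apply: memvD; [apply: ideal_mem | apply: ideal_memr].
by apply: subv_trans (le n) _; rewrite Jn addv0 subvv.
Qed.

Lemma ideal0 : ideal br 0%VS.
Proof. by apply: (idealI bil alt) => x y; rewrite !memv0 => /eqP ->; rewrite (br0l bil). Qed.

Lemma radical_ex : exists R, is_radical br R.
Proof.
have P0 : ideal br 0%VS /\ solvable br 0%VS by split; [exact: ideal0 | exists 0%N].
have [R [iR sR] maxR] := @max_vspace _ _ (fun I => ideal br I /\ solvable br I) _ P0.
exists R; split=> // I iI sI; have := maxR (R + I)%VS (conj (idealD iR iI) (solvableD iR iI sR sI)).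
move=> le; have /eqP -> : R == (R + I)%VS by rewrite eqEdim addvSl.
exact: addvSr.
Qed.

Lemma nilpotent_solvable U : subalg br U -> nilpotent br U -> solvable br U.
Proof.
move=> sU [n n0 Un]; exists n; apply/eqP; rewrite -subv0.
have le m : (der m U <= power br U m.+1)%VS.
  elim: m => [|m IH] //=; apply: subv_trans (@brvS _ _ br _ _ _ _ IH IH) _; apply: brv_le => x y xU yU.
  apply: (subvP (@power_leq _ _ br U m.+2 (m.+1 + m.+1) sU isT ltac:(lia))).
  exact: mem_power.
by apply: subv_trans (le n) _; rewrite -Un power_dec.
Qed.

End Solvable.

Section Semisimple.
Variables (F : numClosedFieldType) (V : vectType F) (br : V -> V -> V) (k : nat).
Hypotheses (malc : malcev br) (k0 : (0 < k)%N) (HL : (power br fullv k <= Lc br)%VS).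
Hypothesis ss : forall I, ideal br I -> solvable br I -> I = 0%VS.
Local Notation bil := (malc_bil malc).
Local Notation alt := (malc_alt malc).
Implicit Types (x y : V).

Lemma compP (a : F) (W : vectType F) (f g h : 'End(W)) : h *o (a *: f + g) = a *: (h *o f) + h *o g.
Proof. by apply/lfunP=> v; rewrite !lfE lfP. Qed.

Lemma compPl (a : F) (W : vectType F) (f g h : 'End(W)) : (a *: f + g) *o h = a *: (f *o h) + g *o h.
Proof. by apply/lfunP=> v; rewrite !lfE. Qed.

Let B x y := trl (ad br x *o ad br y).
Let BP x a y z : B x (a *: y + z) = a * B x y + B x z.
Proof. by rewrite /B lfP compP trlP. Qed.
Let BPl z a x y : B (a *: x + y) z = a * B x z + B y z.
Proof. by rewrite /B lfP compPl trlP. Qed.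

(* By Cartan's criterion this intersection is a solvable ideal. *)
Lemma Lc_form_radical : (Lc br :&: perp B (Lc br) = 0)%VS.
Proof.
set K := (_ :&: _)%VS; have iLc := Lc_ideal malc.
have KP x : x \in K <-> x \in Lc br /\ forall y, y \in Lc br -> B y x = 0.
  by rewrite memv_cap; split=> [/andP[xL /(perpP BP)]|[-> /(perpP BP)]].
have BC x y : B x y = B y x by apply: trl_comp.
apply: ss.
  apply: (idealI bil alt) => x a /KP[xL x0]; apply/KP; split=> [|y yL]; first exact: ideal_mem.
  rewrite BC /B (ad_Lcl malc) // -trl_comm lbrC -(ad_Lcl malc) //.
  have -> : ad br x *o (- ad br (br y a)) = - (ad br x *o ad br (br y a)).
    by apply/lfunP=> v; rewrite !lfE lfN.
  by rewrite trlN -/(B x _) BC x0 ?oppr0 // ideal_mem.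
have cK : lclosed (ad br @: K)%VS.
  move=> _ _ /memv_imgP[x xK ->] /memv_imgP[y yK ->].
  have /KP[xL x0] := xK; have /KP[yL y0] := yK.
  rewrite -(ad_Lcl malc) // memv_img //; apply/KP; split=> [|z zL]; first exact: ideal_mem.
  rewrite BC /B (ad_Lcl malc) // -trl_comm -(ad_Lcl malc) //.
  by rewrite -/(B _ _) BC x0 // ideal_mem.
have [n nE] : exists n, iter n (@lder _ V) (ad br @: K)%VS = 0%VS.
  apply: cartan_solvable => // _ _ /memv_imgP[x /KP[xL x0] ->] /memv_imgP[y /KP[yL y0] ->].
  exact: y0.
have KL : (K <= Lc br)%VS by apply: capvSl.
have dL m : (iter m (fun W => brv br W W) K <= Lc br)%VS.
  elim: m => //= m IH; apply: brv_le => x y xI _; apply: ideal_mem => //.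
  exact: (subvP IH).
have dE m x : x \in iter m (fun W => brv br W W) K -> ad br x \in iter m (@lder _ V) (ad br @: K)%VS.
  elim: m x => [|m IH] x /=; first exact: memv_img.
  move: x; apply: span_ind => [|a u v Eu Ev|_ [u [v [uI vI ->]]]].
  - by rewrite lf0 mem0v.
  - by rewrite lfP memvD ?memvZ.
  rewrite (ad_Lcl malc) ?(subvP (dL m)) //; apply: mem_lder; exact: IH.
exists n.+1 => /=; apply/eqP; rewrite -subv0; apply: brv_le => x y xI _.
by have := dE n x xI; rewrite nE memv0 -(adE bil) => /eqP ->; rewrite lfE mem0v.
Qed.

(** The centralizer [C] of the Lie center meets it in an abelian ideal, hence trivially; as [C^k]
    lies in both, [C] is nilpotent, hence zero. If [y] is orthogonal to the Lie center, then
    [br x y] lies in the radical of the form for Lie central [x], so [y] is in [C]; dimensions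
    conclude. *)
Lemma semisimple_Lc_full : Lc br = fullv.
Proof.
have iLc := Lc_ideal malc; have BC x y : B x y = B y x by apply: trl_comp.
pose C := spanp (fun y => forall x, x \in Lc br -> br x y = 0).
have CP y : y \in C <-> forall x, x \in Lc br -> br x y = 0.
  apply: mem_spanp => [x _|a u v Eu Ev x xL]; first by rewrite (br0 bil).
  by rewrite (brP bil) Eu ?Ev // scaler0 addr0.
have iC : ideal br C.
  apply: (idealI bil alt) => c a /CP cC; apply/CP => l lL.
  rewrite (jac_leib malc) ?(Lc_jac malc) // cC // (br0l bil) add0r.
  by rewrite (malcC malc) cC ?oppr0 // ideal_mem.
have CL0 : (C :&: Lc br = 0)%VS.
  apply: ss; first exact: (idealX bil alt).
  by apply: solvable_abelian => x y /memv_capP[_ xL] /memv_capP[/CP yC _]; apply: yC.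
have C0 : C = 0%VS.
  apply: ss => //; apply: (nilpotent_solvable (ideal_subalg iC)); exists k => //.
  apply/eqP; rewrite -subv0 -CL0 subv_cap (subv_trans (powerS _ k0 (subvf C)) HL) andbT.
  exact: (@power_leq _ _ br C 1 k (ideal_subalg iC) isT k0).
have PC : (perp B (Lc br) <= C)%VS.
  apply/subvP=> y /(perpP BP) yP; apply/CP => x xL.
  have : br x y \in (Lc br :&: perp B (Lc br))%VS.
    rewrite memv_cap ideal_mem //=; apply/(perpP BP) => z zL.
    rewrite BC /B (malcC malc) lfN.
    have -> : - ad br (br y x) = lbr (ad br x) (ad br y).
      by rewrite (malcC malc y x) lfN opprK (ad_Lcl malc).
    rewrite trl_comp trl_comm -(ad_Lcl malc) // -/(B _ _) yP // ideal_mem //.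
  by rewrite Lc_form_radical memv0 => /eqP.
apply/eqP; rewrite eqEdim subvf /=; apply: leq_trans (dim_perp BP BPl (Lc br)) _.
have /eqP -> : perp B (Lc br) == 0%VS by rewrite -subv0 -C0.
by rewrite dimv0 addn0.
Qed.

Lemma semisimple_lie : lie br.
Proof.
split=> [||x y z]; [exact: bil | exact: alt |].
by apply: (Lc_jac malc); rewrite semisimple_Lc_full memvf.
Qed.

Lemma semisimple_killing : killing_nondegenerate br.
Proof.
move=> x x0; have := Lc_form_radical; rewrite semisimple_Lc_full capfv => P0.
apply/eqP; rewrite -memv0 -P0; apply/(perpP BP) => y _; rewrite /B trl_comp; exact: x0.
Qed.

Lemma semisimple_perfect : ideals_perfect br.
Proof. exact: (killing_perfect semisimple_lie semisimple_killing). Qed.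

End Semisimple.

Section RadicalQuotient.
Variables (F : numClosedFieldType) (V : vectType F) (br : V -> V -> V) (k : nat).
Hypotheses (malc : malcev br) (k0 : (0 < k)%N) (HL : (power br fullv k <= Lc br)%VS).
Variable R : {vspace V}.
Hypothesis radR : is_radical br R.
Local Notation bil := (malc_bil malc).
Local Notation alt := (malc_alt malc).

Lemma radical_quotient : exists (Q : vectType F) (brq : Q -> Q -> Q) (p : 'Hom(V, Q)),
  [/\ br_morphism br brq p, limg p = fullv, lker p = R, lie brq & ideals_perfect brq] /\
  (forall I, ideal brq I -> solvable brq I -> I = 0%VS).
Proof.
have [iR sR maxR] := radR.
have [Q [brq [p [pm pf pk]]]] := quotient_alg bil iR.
have mQ := surj_malcev pm pf malc; have HQ := surj_power pm pf malc k0 HL.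
have ssQ I : ideal brq I -> solvable brq I -> I = 0%VS.
  move=> iI [n In]; have /eqP : (p @: (p @^-1: I))%VS = 0%VS.
    apply/eqP; rewrite -lkerE pk; apply: maxR; first exact: (preim_ideal pm).
    apply: (@solvable_derived _ _ _ n); apply: solvableS sR.
    rewrite -pk lkerE (morph_derived pm) lpreimK ?pf ?subvf // In.
    by [].
  by rewrite lpreimK ?pf ?subvf // => /eqP.
exists Q, brq, p; split=> //; split=> //; first exact: (semisimple_lie mQ k0 HQ ssQ).
exact: (semisimple_perfect mQ k0 HQ ssQ).
Qed.

End RadicalQuotient.

(** * Levi's theorem for an abelian kernel *)

Section AbelianLevi.
Variables (F : numClosedFieldType) (X : vectType F) (br : X -> X -> X).
Variables (Q : vectType F) (brq : Q -> Q -> Q) (p : 'Hom(X, Q)).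
Hypotheses (lieX : lie br) (lieQ : lie brq) (perfQ : ideals_perfect brq).
Hypotheses (pm : br_morphism br brq p) (pf : limg p = fullv).
Local Notation I := (lker p).
Hypothesis abI : forall x y, x \in I -> y \in I -> br x y = 0.

Let bil : bilinear_br br. Proof. by case: lieX. Qed.
Let alt : forall x, br x x = 0. Proof. by case: lieX. Qed.
Let bilq : bilinear_br brq. Proof. by case: lieQ. Qed.
Let altq : forall x, brq x x = 0. Proof. by case: lieQ. Qed.

Let IP x : x \in I <-> p x = 0.
Proof. by rewrite memv_ker; split=> /eqP. Qed.

Let idI x y : x \in I -> br x y \in I.
Proof. by move=> /IP xI; apply/IP; rewrite pm xI (br0l bilq). Qed.
Let idIr x y : x \in I -> br y x \in I.
Proof. by move=> xI; rewrite (brC bil alt) memvN idI. Qed.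

Lemma perfect_centerless q : (forall y, brq q y = 0) -> q = 0.
Proof.
move=> q0; pose C := spanp (fun c => forall y, brq c y = 0).
have CP c : c \in C <-> forall y, brq c y = 0.
  apply: mem_spanp => [y|a u v Eu Ev y]; first by rewrite (br0l bilq).
  by rewrite (brPl bilq) Eu Ev scaler0 addr0.
have iC : ideal brq C.
  by apply: (idealI bilq altq) => c y /CP ->; apply: mem0v.
have : C = 0%VS.
  rewrite -(perfQ iC); apply/eqP; rewrite -subv0; apply: brv_le => u w /CP -> _.
  exact: mem0v.
by move=> C0; apply/eqP; rewrite -memv0 -C0; apply/CP.
Qed.

(* The operators with image in I and scalar on I, modulo ad I, form a module
   over X/I; an invariant lift of the projection onto I cuts out a subalgebra
   which is a complement to I up to the center. *)
Lemma invariant_projection : exists phi : 'End(X),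
  [/\ forall x, phi x \in I, forall i, i \in I -> phi i = i &
      forall x, exists2 r, r \in I & lbr (ad br x) phi = ad br r].
Proof.
pose P := (ad br @: I)%VS.
have [Y [pi [pif pik]]] := quotient_space P.
have pi0 f : pi f = 0 <-> f \in P by rewrite -pik memv_ker; split=> /eqP.
pose LAD : 'Hom('End(X), 'End('End(X))) := linfun (@lad _ X).
have LADE f : LAD f = lad f.
  rewrite /LAD linfun_linE // => a g h; apply/lfunP=> z.
  by rewrite ladE lbrPl !lfE !ladE.
pose rho : 'Hom(X, 'End(Y)) := twist (pi^-1)%VF pi *o LAD *o ad br.
have adI x r : r \in I -> lbr (ad br x) (ad br r) \in P.
  by move=> rI; rewrite -(lie_ad lieX) memv_img ?idIr.
have rhoE x f : rho x (pi f) = pi (lbr (ad br x) f).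
  rewrite !comp_lfunE twistE LADE ladE; apply/eqP; rewrite -subr_eq0 -lfB.
  set f' := (pi^-1)%VF (pi f).
  have /memv_imgP[r rI rE] : f' - f \in P.
    by apply/pi0; rewrite lfB limg_lfunVK ?subrr // memv_img ?memvf.
  have -> : lbr (ad br x) f' - lbr (ad br x) f = lbr (ad br x) (f' - f).
    by apply/lfunP=> v; rewrite !(add_lfunE, opp_lfunE, lbrE) lfB; vring.
  by apply/eqP/pi0; rewrite rE adI.
pose Wp (phi : 'End(X)) := (forall x, phi x \in I) /\ exists l : F, forall i, i \in I -> phi i = l *: i.
pose W := spanp Wp.
have WP phi : phi \in W <-> Wp phi.
  apply: mem_spanp => [|a f g [fI [l fl]] [gI [m gm]]].
    by split=> [x|]; [rewrite lfE mem0v | exists 0 => i _; rewrite lfE scale0r].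
  split=> [x|]; first by rewrite !lfE memvD ?memvZ.
  by exists (a * l + m) => i iI; rewrite !lfE fl // gm // scalerA -scalerDl.
pose W0p (phi : 'End(X)) := (forall x, phi x \in I) /\ forall i, i \in I -> phi i = 0.
pose W0 := spanp W0p.
have W0P phi : phi \in W0 <-> W0p phi.
  apply: mem_spanp => [|a f g [fI f0] [gI g0]].
    by split=> [x|i _]; rewrite lfE ?mem0v.
  by split=> [x|i iI]; rewrite !lfE ?memvD ?memvZ // f0 // g0 // scaler0 addr0.
have PW0 : (P <= W0)%VS.
  apply/subvP=> _ /memv_imgP[r rI ->]; apply/W0P; split=> [x|i iI].
    by rewrite (adE bil) idI.
  by rewrite (adE bil) abI.
have W0step x phi : phi \in W -> lbr (ad br x) phi \in W0.
  move=> /WP[fI [l fl]]; apply/W0P; split=> [v|i iI].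
    by rewrite lbrE !(adE bil) memvB // idIr.
  rewrite lbrE !(adE bil) fl // fl ?idIr //.
  by rewrite (brZ bil) subrr.
have W0W : (W0 <= W)%VS.
  apply/subvP=> f /W0P[fI f0]; apply/WP; split=> //; exists 0 => i iI.
  by rewrite f0 // scale0r.
have [|||sumY _] := @weyl_action _ Q brq lieQ perfQ X Y br p rho (pi @: W)%VS pm pf.
- move=> x _ /memv_imgP[f fW ->]; rewrite rhoE memv_img //.
  by apply: (subvP W0W); apply: W0step.
- move=> x _ /IP xI /memv_imgP[f /WP[fI [l fl]] ->]; rewrite rhoE; apply/pi0.
  have -> : lbr (ad br x) f = ad br (- l *: x).
    apply/lfunP=> v; rewrite lbrE !(adE bil) abI // fl ?idI // sub0r (brZl bil).
    by rewrite scaleNr.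
  by rewrite memv_img // memvZ.
- move=> x y _ /memv_imgP[f fW ->]; rewrite lbrE !rhoE (lie_ad lieX).
  rewrite -lfB; congr (pi _).
  by rewrite [lbr (ad br x) (lbr _ _)]lbr_jacobi addrK.
pose f0 := projv I.
have f0W : f0 \in W.
  apply/WP; split=> [x|]; first exact: memv_proj.
  by exists 1 => i iI; rewrite scale1r projv_id.
(* Weyl's theorem replaces the class of the projection [f0] by an invariant class, that of [f]. The
   difference comes from [W0], so [f] still restricts to the identity on [I]. *)
have [y0 [y1 [yE /memv_imgP[f fW y0E] fr y1s]]] := sumY _ (memv_img pi f0W).
rewrite {}y0E in yE fr.
have {y1s} : y1 \in (pi @: W0)%VS.
  move: y1 y1s {yE}; apply: span_ind => [|a u v Eu Ev|_ [x [_ [/memv_imgP[g gW ->] ->]]]].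
  - exact: mem0v.
  - by rewrite memvD ?memvZ.
  by rewrite rhoE memv_img // W0step.
move=> /memv_imgP[g gW0 y1E].
have : f0 - f \in W0.
  have -> : f0 - f = (f0 - f - g) + g by rewrite subrK.
  rewrite memvD //; apply: (subvP PW0); apply/pi0.
  by rewrite !lfB yE y1E; vring.
case/W0P=> d1 d2; exists f; split.
- by case/WP: fW.
- move=> i iI; have /eqP := d2 i iI; rewrite !lfE subr_eq0 projv_id // => /eqP <- //.
move=> x; have := fr x; rewrite rhoE => /pi0/memv_imgP[r rI ->].
by exists r.
Qed.

(** [S1] is the stabilizer of the projection [phi]. Since [lbr (ad x) phi = ad r] and
    [lbr (ad r) phi = - ad r], the element [x + r] is in [S1]. The intersection of [S1] and [I] is
    central, and passing to [[S1, S1]] removes it by Weyl's theorem on [S1]. *)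
Lemma abelian_levi : exists S, [/\ subalg br S, (S + I)%VS = fullv & (S :&: I)%VS = 0%VS].
Proof.
have [phi [phiI phid phiP]] := invariant_projection.
pose S1 := spanp (fun x => lbr (ad br x) phi = 0).
have S1P x : x \in S1 <-> lbr (ad br x) phi = 0.
  apply: mem_spanp => [|a u v Eu Ev]; first by rewrite lf0 lbrC lbr0 oppr0.
  by rewrite lfP lbrPl Eu Ev scaler0 addr0.
have sS1 : subalg br S1.
  move=> x y /S1P xS /S1P yS; apply/S1P; rewrite (lie_ad lieX).
  apply/eqP; rewrite -[X in X == _](addrK (lbr (ad br y) (lbr (ad br x) phi))).
  by rewrite -lbr_jacobi xS yS !lbr0 subrr.
have adphi r : r \in I -> lbr (ad br r) phi = - ad br r.
  move=> rI; apply/lfunP=> v; rewrite lbrE opp_lfunE !(adE bil) abI // phid ?idI //.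
  by rewrite sub0r.
have S1I : (S1 + I)%VS = fullv.
  apply/eqP; rewrite eqEsubv subvf; apply/subvP=> x _.
  have [r rI rE] := phiP x.
  have -> : x = (x + r) - r by rewrite addrK.
  apply: memv_add; last by rewrite memvN.
  apply/S1P; rewrite lfD -[ad br x]scale1r lbrPl scale1r rE adphi //.
  by rewrite subrr.
have S1c r x : r \in S1 -> r \in I -> br r x = 0.
  move=> /S1P + rI; rewrite adphi // => /eqP; rewrite oppr_eq0 => /eqP r0.
  by rewrite -(adE bil) r0 lfE.
have pS1 q : exists2 s, s \in S1 & q = p s.
  have [x ->] := surj_ex pf q; have := memvf x; rewrite -S1I => /memv_addP[s sS [i /IP iI ->]].
  by exists s; rewrite ?lfD ?iI ?addr0.
pose L := subvs_of S1; pose brL := sub_br br S1.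
have brLE (l m : L) : vsval (brL l m) = br (vsval l) (vsval m).
  by rewrite /brL /sub_br vsprojK // sS1 ?subvsP.
pose iL := linfun (vsval : L -> X); have iLE l : iL l = vsval l by rewrite lfunE.
pose pL : 'Hom(L, Q) := p *o iL; pose rho : 'Hom(L, 'End(X)) := ad br *o iL.
have pLE l : pL l = p (vsval l) by rewrite comp_lfunE iLE.
have rhoE l x : rho l x = br (vsval l) x by rewrite comp_lfunE iLE (adE bil).
have [|||||sumS capS] := @weyl_action _ Q brq lieQ perfQ L X brL pL rho S1.
- by move=> l m; rewrite !pLE brLE pm.
- apply/vspaceP=> q; rewrite memvf; have [s sS ->] := pS1 q.
  by rewrite -(vsprojK sS) -pLE memv_img ?memvf.
- by move=> l x xS; rewrite rhoE sS1 ?subvsP.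
- by move=> l x; rewrite pLE rhoE => /IP lI _; rewrite S1c ?subvsP.
- move=> l m y _; rewrite lbrE !rhoE brLE.
  by have /lfunP/(_ y) := lie_ad lieX (vsval l) (vsval m); rewrite lbrE !(adE bil).
have spS : spanp (fun y1 : X => exists (l : L) (z : X), z \in S1 /\ y1 = rho l z) = brv br S1 S1.
  apply/eqP; rewrite eqEsubv; apply/andP; split.
    by apply: span_le => _ [l [z [zS ->]]]; rewrite rhoE mem_brv ?subvsP.
  apply: brv_le => u w uS wS; apply: mem_span; exists (vsproj S1 u), w.
  by rewrite rhoE vsprojK.
have SS1 : (brv br S1 S1 <= S1)%VS by apply: brv_le => u w; apply: sS1.
exists (brv br S1 S1); split.
- by move=> x y xS yS; apply: mem_brv; apply: (subvP SS1).
- apply/eqP; rewrite eqEsubv subvf; apply/subvP=> x _.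
  have := memvf x; rewrite -S1I => /memv_addP[s sS [i iI ->]].
  have [y0 [y1 [-> y0S y00]]] := sumS s sS; rewrite spS => y1S.
  rewrite addrC addrA addrC memv_add // memvD //; apply/IP/perfect_centerless => q.
  have [z zS ->] := pS1 q; rewrite -pm (brC bil alt).
  by have := y00 (vsproj S1 z); rewrite rhoE vsprojK // => ->; rewrite oppr0 lf0.
apply/eqP; rewrite -subv0; apply/subvP=> x /memv_capP[xS xI]; rewrite memv0; apply/eqP.
have xS1 := subvP SS1 _ xS.
apply: capS => //; last by rewrite spS.
by move=> l; rewrite rhoE (brC bil alt) S1c ?oppr0.
Qed.

End AbelianLevi.

Section Levi.
Variables (F : numClosedFieldType) (V : vectType F) (br : V -> V -> V) (k : nat).
Hypotheses (malc : malcev br) (k0 : (0 < k)%N) (HL : (power br fullv k <= Lc br)%VS).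
Variable R : {vspace V}.
Hypothesis radR : is_radical br R.
Local Notation bil := (malc_bil malc).
Local Notation alt := (malc_alt malc).

Lemma Lc_sub_lie B : subalg br B -> (B <= Lc br)%VS -> lie (sub_br br B).
Proof.
move=> sB BL; have [bi al _] := sub_malcev malc sB.
split=> // x y z; apply: subvs_inj; rewrite (sub_jacE _ _ _ sB).
by rewrite (Lc_jac malc) ?linear0 // (subvP BL) ?subvsP.
Qed.

Lemma perfect_power (Q : vectType F) (brq : Q -> Q -> Q) n : ideals_perfect brq ->
  (0 < n)%N -> power brq fullv n = fullv.
Proof.
move=> perfQ; elim/ltn_ind: n => -[|[|n]] IH // _.
have full : brv brq fullv fullv = fullv.
  by apply: perfQ; split=> [|x y _ _]; rewrite ?subvf ?memvf.
apply/eqP; rewrite eqEsubv subvf /= -{1}full; apply: brv_le => x y _ _.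
rewrite -add1n; apply: mem_power => //; first exact: memvf.
by rewrite IH ?memvf.
Qed.

(** The quotient by [R] is perfect, so it is the image of the k-th power of the algebra, which is
    Lie central. A complement of [R] can therefore be sought inside the Lie center, which is a Lie
    algebra. *)
Theorem levi : exists S, [/\ subalg br S, (S <= Lc br)%VS, (S + R)%VS = fullv & (S :&: R)%VS = 0%VS].
Proof.
have [_ sR _] := radR.
have [Q [brq [p [[pm pf pk lieQ perfQ] _]]]] := radical_quotient malc k0 HL radR.
have iR : ideal br R by case: radR.
have LR : (Lc br + R)%VS = fullv.
  apply/eqP; rewrite eqEsubv subvf; apply/subvP=> x _.
  have : p x \in (p @: power br fullv k)%VS.
    by rewrite (power_morph _ pm) // pf perfect_power ?memvf.
  move=> /memv_imgP[y yk pxy].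
  rewrite -[x](subrK y) addrC memv_add ?(subvP HL) // -pk memv_ker lfB pxy subrr //.
(* A minimal such B meets R trivially, since otherwise the abelian case,
   applied to the quotient of B by [B :&: R, B :&: R], gives a smaller one. *)
pose P B := [/\ subalg br B, (B <= Lc br)%VS & (B + R)%VS = fullv].
have PL : P (Lc br) by split=> //; apply: ideal_subalg; apply: Lc_ideal.
have [B [sB BL BR] minB] := min_vspace PL.
exists B; split=> //; apply/eqP; apply: contraT => I0; exfalso.
pose I := (B :&: R)%VS.
have sI : solvable br I by apply: solvableS sR; apply: capvSr.
pose I1 := brv br I I.
have II1 : ~ (I <= I1)%VS.
  move=> le; case: sI => n In; move/negP: I0; apply; rewrite -subv0 -In.
  elim: n {In} => [|n IH] /=; first exact: subvv.
  by apply: subv_trans le _; apply: brvS.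
have iI1 : (I1 <= I)%VS.
  apply: brv_le => u w /memv_capP[uB uR] /memv_capP[wB wR].
  by rewrite memv_cap sB //=; apply: ideal_mem.
pose L := subvs_of B; pose brL := sub_br br B.
have lieL : lie brL by apply: Lc_sub_lie.
have bilL : bilinear_br brL by case: lieL.
have altL : forall x, brL x x = 0 by case: lieL.
have brLE (l m : L) : vsval (brL l m) = br (vsval l) (vsval m) by apply: sub_brE.
pose iL := linfun (vsval : L -> V); have iLE l : iL l = vsval l by rewrite lfunE.
pose K := (iL @^-1: I1)%VS.
have KP l : l \in K <-> vsval l \in I1 by rewrite -memv_preim iLE.
have iK : ideal brL K.
  apply: (idealI bilL altL) => l m /KP lI; apply/KP; rewrite brLE.
  move: (vsval l) lI; apply: span_ind => [|a u v Eu Ev|_ [u [w [uI wI ->]]]].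
  - by rewrite (br0l bil) mem0v.
  - by rewrite (brPl bil) memvD ?memvZ.
  have idI z : z \in I -> br (vsval m) z \in I.
    by move=> /memv_capP[zB zR]; rewrite memv_cap sB ?subvsP //= (ideal_memr _ iR).
  rewrite (malcC malc) memvN (jac_leib malc); last first.
    by apply: (Lc_jac malc); apply: (subvP BL); apply: subvsP.
  by rewrite memvD ?mem_brv ?idI.
have [X [brX [pi [pim pif pik]]]] := quotient_alg bilL iK.
have lieX : lie brX.
  split; [exact: surj_bilinear pim pif bilL| |].
    by move=> x; have [l ->] := surj_ex pif x; rewrite -pim altL lf0.
  move=> x y z; have [[l ->] [m ->] [n ->]] := And3 (surj_ex pif x) (surj_ex pif y) (surj_ex pif z).
  by rewrite -(morph_jac pim); case: lieL => _ _ ->; rewrite lf0.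
pose pX : 'Hom(X, Q) := p *o iL *o pi^-1%VF.
have pXE l : pX (pi l) = p (vsval l).
  rewrite !comp_lfunE iLE; apply/eqP; rewrite -subr_eq0 -lfB -memv_ker pk.
  have : pi^-1%VF (pi l) - l \in K.
    by rewrite -pik memv_ker lfB limg_lfunVK ?subrr // memv_img ?memvf.
  by move=> /KP/(subvP iI1)/memv_capP[_]; rewrite linearB.
have pXm : br_morphism brX brq pX.
  move=> x y; have [[l ->] [m ->]] := conj (surj_ex pif x) (surj_ex pif y).
  by rewrite -pim !pXE brLE pm.
have pXf : limg pX = fullv.
  apply/vspaceP=> q; rewrite memvf; have [x ->] := surj_ex pf q.
  have := memvf x; rewrite -BR => /memv_addP[b bB [r rR ->]].
  have -> : p (b + r) = pX (pi (vsproj B b)).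
    rewrite pXE vsprojK // lfD; have /eqP -> : p r == 0 by rewrite -memv_ker pk.
    by rewrite addr0.
  by rewrite memv_img ?memvf.
have kerX l : (pi l \in lker pX) = (vsval l \in I).
  by rewrite memv_ker pXE -memv_ker pk memv_cap subvsP.
have [|S [sS SI ScI]] := abelian_levi lieX lieQ perfQ pXm pXf.
  move=> x y; have [[l ->] [m ->]] := conj (surj_ex pif x) (surj_ex pif y).
  rewrite !kerX => lI mI; rewrite -pim; apply/eqP; rewrite -memv_ker pik.
  by apply/KP; rewrite brLE mem_brv.
pose B' := (iL @: (pi @^-1: S))%VS.
have B'B : (B' <= B)%VS by apply/subvP=> _ /memv_imgP[l _ ->]; rewrite iLE subvsP.
have BI : (B <= B' + I)%VS.
  apply/subvP=> b bB; have := memvf (pi (vsproj B b)); rewrite -SI => /memv_addP[s sS' [i iI bE]].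
  have [[m mE] [n nE]] := conj (surj_ex pif s) (surj_ex pif i).
  have nI : vsval n \in I by rewrite -kerX -nE.
  have mB : vsval m \in B' by rewrite -iLE memv_img // -memv_preim -mE.
  have : vsproj B b - m - n \in K by rewrite -pik memv_ker !lfB bE mE nE -addrA -opprD subrr.
  move=> /KP/(subvP iI1); rewrite !linearB /= vsprojK // => dI.
  have -> : b = vsval m + (b - vsval m - vsval n + vsval n) by rewrite subrK addrC subrK.
  by rewrite memv_add // memvD.
have PB' : P B'.
  split.
  - move=> _ _ /memv_imgP[l + ->] /memv_imgP[m + ->]; rewrite -!memv_preim => lS mS.
    by rewrite !iLE -brLE -iLE memv_img // -memv_preim pim sS.
  - exact: subv_trans B'B BL.
  apply/eqP; rewrite eqEsubv subvf -BR subv_add addvSr andbT.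
  apply: subv_trans BI _; apply: addvS; [exact: subvv | exact: capvSr].
(* If [B'] is all of [B], then each element of [I] has its class in both [S] and [lker pX], so it
   lies in [I1 = [I, I]]; this is impossible for a nonzero solvable [I]. *)
have BE : B' = B by apply/eqP; rewrite eqEdim B'B minB.
apply: II1; apply/subvP=> x xI; have xB : x \in B by case/memv_capP: xI.
have : x \in B' by rewrite BE.
move=> /memv_imgP[l + xE]; rewrite -memv_preim => lS; rewrite iLE in xE.
have : pi l \in (S :&: lker pX)%VS by rewrite memv_cap lS kerX -xE.
by rewrite ScI memv0 -memv_ker pik xE => /KP.
Qed.

End Levi.

(** * The nilradical *)

Section NilFlag.
Variables (F : numClosedFieldType) (A V : vectType F) (br : A -> A -> A).
Variables (rho : 'Hom(A, 'End(V))) (R : {vspace A}) (U : {vspace V}).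
Hypotheses (iR : ideal br R) (sR : solvable br R).
Hypothesis repU : forall a b u, u \in U -> rho (br a b) u = lbr (rho a) (rho b) u.

Definition invariant (Z : {vspace V}) := forall a, stab (rho a) Z.

Definition nil_on r := forall u, u \in U -> exists m, iter m (rho r) u = 0.

(** The last two clauses turn nilpotency of an element of [R] into the linear condition of lowering
    a fixed flag, and put [[A, R]] among the elements that satisfy it. *)
Definition good_step (Z Z' : {vspace V}) := [/\ invariant Z', (Z' <= Z)%VS,
  forall a r w, r \in R -> w \in Z -> rho (br a r) w \in Z' &
  forall r w, r \in R -> nil_on r -> w \in Z -> rho r w \in Z'].

Lemma good_step_refl Z : invariant Z -> good_step Z Z.
Proof. by move=> iZ; split=> // *; apply: iZ. Qed.

(** On an irreducible quotient the solvable ideal [R] acts centrally, so [[A, R]] acts by zero. A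
    central nilpotent operator has a stable nonzero kernel unless the quotient is zero, so it acts
    by zero too. *)
Lemma irreducible_step (U1 U2 : {vspace V}) : invariant U1 -> invariant U2 -> (U2 <= U1)%VS -> (U1 <= U)%VS ->
  (forall Z, invariant Z -> (U2 <= Z)%VS -> (Z <= U1)%VS -> Z = U2 \/ Z = U1) ->
  good_step U1 U2.
Proof.
move=> inv1 inv2 U21 U1U irr.
have [X [i [p [pi iU pU ipU]]]] := subquotient U21.
pose tw : 'Hom(A, 'End(X)) := twist i p *o rho.
have twE a x : tw a x = p (rho a (i x)) by rewrite comp_lfunE twistE.
have twp a u : u \in U1 -> p (rho a u) = tw a (p u).
  move=> uU; rewrite twE; apply/eqP; rewrite -subr_eq0 -!lfB; apply/eqP/pU/inv2.
  exact: ipU.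
have p0U u : u \in U1 -> p u = 0 -> u \in U2.
  by move=> uU pu; have := ipU u uU; rewrite pu lf0 subr0.
have twb a b : tw (br a b) = lbr (tw a) (tw b).
  apply/lfunP=> x; rewrite lbrE !twE repU ?(subvP U1U) // lbrE lfB.
  have iX : i x \in U1 by apply: iU.
  have E c u : u \in U1 -> p (rho c u) = p (rho c (i (p u))) by move=> uU; rewrite twp // twE.
  by rewrite (E a (rho b (i x))) ?inv1 // (E b (rho a (i x))) ?inv1.
set G := limg tw; have cG : lclosed G.
  by move=> _ _ /memv_imgP[a _ ->] /memv_imgP[b _ ->]; rewrite -twb memv_img ?memvf.
have irG : irreducible_set G.
  move=> Y GY; have [|||ZE|ZE] := irr (i @: Y + U2)%VS.
  - move=> a _ /memv_addP[_ /memv_imgP[y yY ->] [u uU ->]]; rewrite lfD.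
    have yE : rho a (i y) = i (tw a y) + (rho a (i y) - i (tw a y)) by rewrite addrC subrK.
    rewrite yE -addrA memv_add ?memv_img ?GY ?memv_img ?memvf //.
    by rewrite memvD ?inv2 // twE ipU ?inv1.
  - exact: addvSr.
  - by rewrite subv_add U21 andbT; apply/subvP=> _ /memv_imgP[y _ ->].
  - left; apply/eqP; rewrite -subv0; apply/subvP=> y yY; rewrite memv0 -(pi y) pU //.
    by rewrite -ZE (subvP (addvSl _ _)) // memv_img.
  right; apply/eqP; rewrite eqEsubv subvf; apply/subvP=> x _.
  have : i x \in (i @: Y + U2)%VS by rewrite ZE.
  move=> /memv_addP[_ /memv_imgP[y yY ->] [u uU xE]].
  by rewrite -(pi x) xE lfD pi pU // addr0.
have twR r : r \in R -> tw r \in (tw @: R)%VS by apply: memv_img.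
have [n Rn] := sR.
have irrS := irreducible_solvable cG irG (limgS tw (subvf R)).
have {irrS} tw0 : forall a r, r \in R -> lbr (tw a) (tw r) = 0.
  move=> a r rR; apply: irrS; rewrite ?memv_img ?memvf //.
    move=> _ _ /memv_imgP[b _ ->] /memv_imgP[s sR' ->]; rewrite -twb memv_img //.
    exact: ideal_memr.
  exists n; apply/eqP; rewrite -subv0.
  have : (iter n (@lder _ X) (tw @: R) <= tw @: iter n (fun W => brv br W W) R)%VS.
    elim: n {Rn} => [|m IH] /=; first exact: subvv.
    apply: lder_le => f g /(subvP IH)/memv_imgP[c cI ->] /(subvP IH)/memv_imgP[b bI ->].
    by rewrite -twb memv_img // mem_brv.
  by rewrite Rn limg0.
split=> // [a r w rR wU|r w rR nr wU].
  apply: p0U; first exact: inv1.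
  by rewrite twp // twb tw0 // lfE.
apply: p0U; first exact: inv1.
rewrite twp //; set c := tw r.
have nc x : exists m, iter m c x = 0.
  have [m mE] := nr (i x) (subvP U1U _ (iU x)); exists m.
  have <- : p (iter m (rho r) (i x)) = iter m c x; last by rewrite mE lf0.
  elim: m {mE} => [|m IH] /=; first exact: pi.
  by rewrite -IH twp // iter_stab.
have [|c0|cf] := irG (lker c).
- move=> _ /memv_imgP[a _ ->] x; rewrite !memv_ker => /eqP cx.
  by rewrite -(lbr0_comm _ (tw0 a r rR)) -/c cx lf0.
- suff -> : p w = 0 by rewrite lf0.
  have [m] := nc (p w); elim: m => //= m IH /eqP; rewrite -memv_ker c0 memv0 => /eqP //.
by apply/eqP; rewrite -memv_ker cf memvf.
Qed.

(** A composition series is obtained by refining the interval. Flags are functions on all naturals,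
    stationary at the end, so that every index satisfies [good_step] and series can be
    concatenated. *)
Lemma nil_flag_interval (U1 U2 : {vspace V}) : invariant U1 -> invariant U2 -> (U2 <= U1)%VS -> (U1 <= U)%VS ->
  exists n (W : nat -> {vspace V}), [/\ W 0%N = U1, W n = U2 & forall i, good_step (W i) (W i.+1)].
Proof.
have [d] := ubnP (\dim U1 - \dim U2)%N; elim: d U1 U2 => // d IH U1 U2 dU inv1 inv2 U21 U1U.
have [E|U12] := eqVneq U1 U2.
  by exists 0%N, (fun=> U1); split=> // i; apply: good_step_refl.
have [[Z [invZ U2Z ZU1 Z2 Z1]]|none] :=
    pselect (exists Z, [/\ invariant Z, (U2 <= Z)%VS, (Z <= U1)%VS, Z != U2 & Z != U1]).
  have lt2 : (\dim U2 < \dim Z)%N.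
    by rewrite ltn_neqAle dimvS // andbT; apply: contra Z2 => /eqP E; rewrite eq_sym eqEdim U2Z E /=.
  have lt1 : (\dim Z < \dim U1)%N.
    by rewrite ltn_neqAle dimvS // andbT; apply: contra Z1 => /eqP E; rewrite eqEdim ZU1 E /=.
  have [n1 [W1 [W10 W1n g1]]] := IH U1 Z ltac:(lia) inv1 invZ ZU1 U1U.
  have [n2 [W2 [W20 W2n g2]]] := IH Z U2 ltac:(lia) invZ inv2 U2Z (subv_trans ZU1 U1U).
  exists (n1 + n2)%N, (fun i => if (i < n1)%N then W1 i else W2 (i - n1)%N); split.
  - by case: ltnP => // ; rewrite leqn0 => /eqP n0; rewrite sub0n W20 -W1n n0.
  - by rewrite ltnNge leq_addr /= addKn.
  move=> i; case: (ltnP i n1) => in1.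
    case: (ltnP i.+1 n1) => in1'; first exact: g1.
    have -> : n1 = i.+1 by lia.
    by rewrite subnn W20 -W1n (_ : n1 = i.+1) //; lia.
  have -> : (i.+1 < n1)%N = false by apply/negbTE; rewrite -leqNgt ltnW.
  by rewrite subSn.
exists 1%N, (fun i => if i == 0%N then U1 else U2); split; [by [] | by [] |].
case=> [|i] /=; last exact: good_step_refl.
apply: irreducible_step => // Z invZ U2Z ZU1.
have [->|Z2] := eqVneq Z U2; first by left.
have [->|Z1] := eqVneq Z U1; first by right.
by case: none; exists Z.
Qed.

Lemma nil_flag : invariant U ->
  exists n (W : nat -> {vspace V}), [/\ W 0%N = U, W n = 0%VS & forall i, good_step (W i) (W i.+1)].
Proof.
move=> invU; apply: nil_flag_interval => //; last exact: sub0v.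
by move=> a v; rewrite !memv0 => /eqP ->; rewrite lf0.
Qed.

End NilFlag.

Section Nilradical.
Variables (F : numClosedFieldType) (V : vectType F) (br : V -> V -> V) (k : nat).
Hypotheses (malc : malcev br) (k0 : (0 < k)%N) (HL : (power br fullv k <= Lc br)%VS).
Local Notation bil := (malc_bil malc).
Local Notation alt := (malc_alt malc).
Variable R : {vspace V}.
Hypotheses (iR : ideal br R) (sR : solvable br R).

Definition ad_nilpotent r := forall x, exists m, iter m (ad br r) x = 0.

(** [N] consists of the elements of [R] that lower a flag of the Lie center, which is clearly a
    subspace. Such an element is ad-nilpotent on the whole algebra, as [k] applications reach the
    Lie center and the flag then runs down to zero. *)
Lemma nil_ideal : exists (N : {vspace V}),
  [/\ ideal br N, (N <= R)%VS, forall r, r \in R -> ad_nilpotent r -> r \in N,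
      forall r, r \in N -> ad_nilpotent r &
      (forall a r, r \in R -> br a r \in N) /\
      exists n (W : nat -> {vspace V}), [/\ W 0%N = Lc br, W n = 0%VS, forall i, ideal br (W i),
        forall i, (W i.+1 <= W i)%VS & forall i r w, r \in N -> w \in W i -> br r w \in W i.+1]].
Proof.
have iL := Lc_ideal malc.
have [||n [W [W0 Wn gW]]] := @nil_flag _ V V br (ad br) R (Lc br) iR sR.
- by move=> a b u uL; rewrite lbrE !(adE bil) (ad_Lcr malc).
- by move=> a u uL; rewrite (adE bil) ideal_memr.
have idW i : ideal br (W i).
  case: i => [|i]; first by rewrite W0.
  have [inv _ _ _] := gW i; apply: (idealI bil alt) => x y xW.
  by rewrite (malcC malc) memvN -(adE bil) inv.
pose N := spanp (fun r => r \in R /\ forall i w, w \in W i -> br r w \in W i.+1).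
have NP r : r \in N <-> r \in R /\ forall i w, w \in W i -> br r w \in W i.+1.
  apply: mem_spanp => [|a x y [xR xW] [yR yW]].
    by split=> [|i w _]; rewrite ?(br0l bil) mem0v.
  split=> [|i w wW]; first by rewrite memvD ?memvZ.
  by rewrite (brPl bil) memvD ?memvZ ?xW ?yW.
have RN a r : r \in R -> br a r \in N.
  move=> rR; apply/NP; split=> [|i w wW]; first exact: ideal_memr.
  by have [_ _ H _] := gW i; rewrite -(adE bil) H.
exists N; split.
- apply: (idealI bil alt) => x y /NP[xR _]; rewrite (malcC malc) memvN; exact: RN.
- by apply/subvP=> x /NP[].
- move=> r rR nr; apply/NP; split=> // i w wW; have [_ _ _ H] := gW i.
  by rewrite -(adE bil) H // => u _; apply: nr.
- move=> r /NP[rR rW] x; exists (n + k)%N; rewrite iterD.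
  have : iter k (ad br r) x \in W 0%N.
    rewrite W0; apply: (subvP HL); apply: subvP (iter_ad_power malc r k x).
    by apply: power_dec => //; apply: subalg_full.
  move: (iter k _ x) => y yW; apply/eqP; rewrite -memv0 -Wn.
  have H m : iter m (ad br r) y \in W m by elim: m => //= m IH; rewrite (adE bil) rW.
  exact: H.
split=> //; exists n, W; split=> // [i|i r w /NP[_ H] //]; last exact: H.
by have [_ ->] := gW i.
Qed.

(** Products are not associative, so the length is doubled at each step: of two factors of total
    length [2^(i+1) k], one has length at least [2^i k] and lies in [W i], and the other, being in
    [N], lowers it. *)
Lemma nilpotent_flag (N : {vspace V}) n (W : nat -> {vspace V}) : ideal br N ->
  W 0%N = Lc br -> W n = 0%VS -> (forall i, (W i.+1 <= W i)%VS) ->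
  (forall i r w, r \in N -> w \in W i -> br r w \in W i.+1) -> nilpotent br N.
Proof.
move=> iN W0 Wn decW NW; have sN := ideal_subalg iN.
suff H i : (power br N (2 ^ i * k) <= W i)%VS.
  exists (2 ^ n * k)%N; first by rewrite muln_gt0 expn_gt0 k0.
  by apply/eqP; rewrite -subv0 -Wn.
elim: i => [|i IH].
  by rewrite expn0 mul1n W0; apply: subv_trans (powerS _ k0 (subvf N)) HL.
have p0 : (0 < 2 ^ i * k)%N by rewrite muln_gt0 expn_gt0 k0.
apply: power_le; first by rewrite expnS; lia.
move=> a b x y a0 b0 ab xN yN.
have xN' : x \in N by apply: (subvP (@power_leq _ _ br N 1 a sN isT a0)).
have yN' : y \in N by apply: (subvP (@power_leq _ _ br N 1 b sN isT b0)).
have [ba|ba] := leqP (2 ^ i * k) b.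
  apply: NW => //; apply: (subvP IH).
  by apply: (subvP (power_leq sN p0 ba)).
rewrite (malcC malc) memvN; apply: NW => //; apply: (subvP IH).
have ab' : (a + b = 2 * (2 ^ i * k))%N by rewrite ab expnS mulnA.
by apply: (subvP (@power_leq _ _ br N (2 ^ i * k) a sN p0 ltac:(lia))).
Qed.

Lemma ideal_power_nil I x : ideal br I -> nilpotent br I -> x \in I -> ad_nilpotent x.
Proof.
move=> iI [n n0 In] xI y; exists n; apply/eqP; rewrite -memv0 -In.
elim: n n0 {In} => // -[|n] IH _.
  by rewrite /= (adE bil) ideal_mem.
rewrite iterS (adE bil) -[X in power _ _ X]add1n; apply: mem_power => //; exact: IH.
Qed.

End Nilradical.

Section NilradicalEx.
Variables (F : numClosedFieldType) (V : vectType F) (br : V -> V -> V) (k : nat).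
Hypotheses (malc : malcev br) (k0 : (0 < k)%N) (HL : (power br fullv k <= Lc br)%VS).
Local Notation bil := (malc_bil malc).
Variable R : {vspace V}.
Hypothesis radR : is_radical br R.

Lemma nilradical_ex : exists N, [/\ is_nilradical br N, (N <= R)%VS,
  forall r, r \in R -> (r \in N <-> ad_nilpotent br r) & forall a r, r \in R -> br a r \in N].
Proof.
have [iR sR maxR] := radR.
have [N [iN NR nilN Nnil [RN [n [W [W0 Wn iW decW NW]]]]]] := nil_ideal malc k0 HL iR sR.
exists N; split=> //; last by move=> r rR; split; [apply: Nnil | apply: nilN].
split=> // [|I iI nI].
  exact: (nilpotent_flag malc k0 HL iN W0 Wn decW NW).
apply/subvP=> x xI; apply: nilN; last exact: (ideal_power_nil malc iI nI).
by apply: (subvP (maxR I iI _)) => //; apply: (nilpotent_solvable (ideal_subalg iI) nI).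
Qed.

End NilradicalEx.

(** * Tori and splitting decompositions *)

Section DiagonalizableSums.
Variables (F : numClosedFieldType) (V : vectType F).
Implicit Types f g : 'End(V).

Lemma diagble_scale c f : diagble f -> diagble (c *: f).
Proof.
move=> /diagble_basis[X [Xb XE]]; apply/diagble_basis; exists X; split=> // x /XE[a aE].
by exists (c * a); rewrite lfE aE scalerA.
Qed.

Lemma diagble_add f g : diagble f -> diagble g -> (forall x, f (g x) = g (f x)) -> diagble (f + g).
Proof.
move=> df dg fg; have -> : f + g = f - (-1 *: g) by rewrite scaleN1r opprK.
apply: diagble_sub_nilp => // [|x]; first exact: diagble_scale.
by rewrite !lfE lfZ fg.
Qed.

End DiagonalizableSums.

Section Torus.
Variables (F : numClosedFieldType) (V : vectType F) (br : V -> V -> V).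
Hypothesis malc : malcev br.
Local Notation bil := (malc_bil malc).
Local Notation alt := (malc_alt malc).
Implicit Types (x y t : V) (Y : {vspace V}).
Variable T : {vspace V}.
Hypotheses (TL : (T <= Lc br)%VS) (abT : forall t u, t \in T -> u \in T -> br t u = 0).
Hypothesis ssT : forall t, t \in T -> diagble (ad br t).

Lemma torus_comm t u y : t \in T -> u \in T -> br t (br u y) = br u (br t y).
Proof.
move=> tT uT; rewrite (jac_leib malc (Lc_jac malc _ _ (subvP TL _ tT))).
by rewrite (abT tT uT) (br0l bil) add0r.
Qed.

Definition joint_eigen (s : seq V) y := forall t, t \in s -> exists a, br t y = a *: y.

Lemma joint_eigen_span Y s : (forall t, t \in s -> t \in T) ->
  (forall t y, t \in T -> y \in Y -> br t y \in Y) ->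
  forall y, y \in Y -> y \in spanp (fun y => y \in Y /\ joint_eigen s y).
Proof.
move=> + TY; elim: s => [|t s IH] sT y yY; first by apply: mem_span.
have {}IH := IH _ y yY; move: (IH (fun u us => sT u (mem_behead (s := t :: s) us))).
move: y {yY IH}; apply: span_ind => [|a u v Eu Ev|y [yY jy]].
- exact: mem0v.
- by rewrite memvD ?memvZ.
(* [a] collects the eigenvalues of [y] under the elements of [s]; off [s] its value 0 is a dummy. *)
have [a aE] := choice (fun u : V => match pselect (u \in s) with
  | left us => let: ex_intro a aE := jy u us in ex_intro (fun a : F => u \in s -> br u y = a *: y) a (fun _ => aE)
  | right nus => ex_intro (fun a : F => u \in s -> br u y = a *: y) 0 (fun us => False_ind _ (nus us)) end).
pose Z := spanp (fun z => z \in Y /\ forall u, u \in s -> br u z = a u *: z).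
have ZP z : z \in Z <-> z \in Y /\ forall u, u \in s -> br u z = a u *: z.
  apply: mem_spanp => [|c z1 z2 [z1Y E1] [z2Y E2]].
    by split=> [|u us]; rewrite ?mem0v // (br0 bil) scaler0.
  split=> [|u us]; first by rewrite memvD ?memvZ.
  by rewrite (brP bil) E1 // E2 // scalerDr !scalerA mulrC.
have tT : t \in T by apply: sT; rewrite mem_head.
have stZ : stab (ad br t) Z.
  move=> z /ZP[zY zE]; rewrite (adE bil); apply/ZP; split=> [|u us]; first exact: TY.
  have uT : u \in T by apply: sT; rewrite inE us orbT.
  by rewrite (torus_comm _ uT tT) zE // (brZ bil).
have : y \in Z by apply/ZP; split=> // u us; apply: aE.
move: y {yY jy aE}; apply: (genE_ind stZ) => [|c u v Eu Ev|mu z /ZP[zY zE] zmu].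
- exact: mem0v.
- by rewrite memvD ?memvZ.
apply: mem_span; split=> // u; rewrite inE => /orP[/eqP ->|us].
  by exists mu; rewrite -(adE bil) (ssT tT zmu).
by exists (a u); apply: zE.
Qed.

Definition weightP Y (alpha : 'Hom(subvs_of T, F^o)) x :=
  x \in Y /\ forall t, t \in T -> br x t = (alpha (vsproj T t) : F) *: x.

Lemma weight_spaceP Y (alpha : 'Hom(subvs_of T, F^o)) x :
  x \in weight_space br T Y alpha <-> weightP Y alpha x.
Proof.
apply: mem_spanp => [|c u v [uY uE] [vY vE]].
  by split=> [|t tT]; rewrite ?mem0v // (br0l bil) scaler0.
split=> [|t tT]; first by rewrite memvD ?memvZ.
by rewrite (brPl bil) uE // vE // scalerDr !scalerA mulrC.
Qed.

Lemma weight_span Y : (forall t y, t \in T -> y \in Y -> br t y \in Y) ->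
  forall y, y \in Y -> y \in spanp (fun y => exists alpha, weightP Y alpha y).
Proof.
move=> TY y yY; have := joint_eigen_span (@vbasis_mem _ _ ^~ T) TY yY.
move: y {yY}; apply: span_ind => [|c u v Eu Ev|y [yY jy]].
- exact: mem0v.
- by rewrite memvD ?memvZ.
have aE i : exists a, br (vbasis T)`_i y = a *: y.
  have [lti|lei] := ltnP i (size (vbasis T)); first exact/jy/mem_nth.
  by exists 0; rewrite nth_default // (br0l bil) scale0r.
have [a {}aE] := choice aE.
(* The eigenvalues on a basis of [T] are extended linearly; the sign passes from left
   multiplications to the right ones that define weights. *)
pose al (t : subvs_of T) : F^o := - \sum_(i < \dim T) coord (vbasis T) i (vsval t) * a i.
have alL : linear al.
  move=> c u v; rewrite /al linearP /= scalerN -opprD; congr (- _).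
  rewrite scaler_sumr -big_split; apply: eq_bigr => i _.
  by rewrite linearP /= mulrDl -mulrA.
apply: mem_span; exists (linfun al); split=> // t tT.
rewrite (linfun_linE alL) /al vsprojK // (malcC malc) scaleNr; congr (- _).
rewrite {1}(coord_vbasis tT).
have lsum (I : finType) (E : I -> V) : br (\sum_i E i) y = \sum_i br (E i) y.
  elim/big_rec2: _ => [|i u v _ E']; first exact: (br0l bil).
  by rewrite (brDl bil) E'.
rewrite lsum scaler_suml; apply: eq_bigr => i _.
by rewrite (brZl bil) aE scalerA.
Qed.

(** Bracketing with a [t] on which [alpha] and [b] differ, then subtracting [b t] times the vector,
    removes the component of weight [b] and multiplies [v] by a nonzero scalar. *)
Lemma weight_indep Y s alpha : alpha \notin s ->
  (weight_space br T Y alpha :&: \sum_(b <- s) weight_space br T Y b)%VS = 0%VS.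
Proof.
move=> als; apply/eqP; rewrite -subv0; apply/subvP=> v /memv_capP[va vs]; rewrite memv0.
apply/eqP; elim: s v als va vs => [|b s IH] v; first by rewrite big_nil memv0 => _ _ /eqP.
rewrite inE negb_or big_cons => /andP[ab als] va /memv_addP[u ub [w ws vE]].
have [t tab] : exists t : subvs_of T, alpha t != b t.
  by apply: contrapT => no; case/eqP: ab; apply/lfunP=> t; apply: contrapT => /eqP E; case: no; exists t.
have tT := subvsP t; rewrite -(vsvalK t) in tab.
set A : F := alpha _ in tab; set B : F := b _ in tab.
have wsst z : z \in (\sum_(b <- s) weight_space br T Y b)%VS -> br z (vsval t) \in (\sum_(b <- s) weight_space br T Y b)%VS.
  elim: s {IH als ws} z => [|c s IH] z; first by rewrite big_nil !memv0 => /eqP ->; rewrite (br0l bil).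
  rewrite big_cons => /memv_addP[z1 z1c [z2 z2s ->]]; rewrite (brDl bil) memv_add ?IH //.
  by have /weight_spaceP[_ ->] := z1c; rewrite ?memvZ.
have /weight_spaceP[_ vt] := va; have /weight_spaceP[_ ut] := ub.
have E : (A - B) *: v = br w (vsval t) - B *: w.
  rewrite scalerBl -/A -(vt (vsval t)) // {1}vE (brDl bil) (ut (vsval t)) // -/B vE.
  by vring.
have : (A - B) *: v = 0.
  apply: IH => //; first by rewrite memvZ.
  by rewrite E memvB ?memvZ ?wsst.
by move/eqP; rewrite scaler_eq0 subr_eq0 (negbTE tab) => /eqP.
Qed.

Lemma weight_dim Y s : uniq s ->
  \dim (\sum_(b <- s) weight_space br T Y b) = (\sum_(b <- s) \dim (weight_space br T Y b))%N.
Proof.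
elim: s => [|b s IH] /=; first by rewrite !big_nil dimv0.
by move=> /andP[bs us]; rewrite !big_cons dimv_disjoint_sum ?IH // weight_indep.
Qed.

(** Independence bounds the number of weights by the dimension, so a longest list of distinct
    weights with nonzero spaces exists; it is complete because weight vectors span. *)
Lemma weight_decomposition Y : (forall t y, t \in T -> y \in Y -> br t y \in Y) ->
  exists Delta : seq 'Hom(subvs_of T, F^o), [/\ uniq Delta,
    forall alpha, alpha \in Delta -> weight_space br T Y alpha != 0%VS,
    directv (\sum_(alpha <- Delta) weight_space br T Y alpha) &
    Y = (\sum_(alpha <- Delta) weight_space br T Y alpha)%VS].
Proof.
move=> TY; pose P n := `[< exists D : seq 'Hom(subvs_of T, F^o),
  [/\ uniq D, forall alpha, alpha \in D -> weight_space br T Y alpha != 0%VS & size D = n] >].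
have exP : exists n, P n by exists 0%N; apply/asboolP; exists [::].
have bdP n : P n -> (n <= \dim {:V})%N.
  move=> /asboolP[D [uD nD <-]]; apply: leq_trans (dimvS (subvf (\sum_(b <- D) weight_space br T Y b)%VS)).
  rewrite weight_dim // -sum1_size !big_seq; apply: leq_sum => a aD.
  by rewrite lt0n dimv_eq0 nD.
case: (ex_maxnP exP bdP) => n /asboolP[D [uD nD sD]] nmax; exists D.
have YE : Y = (\sum_(alpha <- D) weight_space br T Y alpha)%VS.
  apply/eqP; rewrite eqEsubv; apply/andP; split; last first.
    by elim/big_ind: _ => [|U W UY WY|a _]; rewrite ?sub0v ?subv_add ?UY //; apply/subvP=> x /weight_spaceP[].
  apply/subvP=> y /(weight_span TY); move: y; apply: span_ind => [|c u v Eu Ev|y [al yal]].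
  - exact: mem0v.
  - by rewrite memvD ?memvZ.
  have [alD|alD] := boolP (al \in D).
    rewrite (big_rem al alD) /=; apply: subvP (addvSl _ _) _ _; exact/weight_spaceP.
  have [->|y0] := eqVneq y 0; first exact: mem0v.
  suff: (n.+1 <= n)%N by rewrite ltnn.
  apply: nmax; apply/asboolP; exists (al :: D); split=> /=; [by rewrite alD| |by rewrite sD].
  move=> b; rewrite inE => /orP[/eqP -> |]; last exact: nD.
  apply: contra y0 => /eqP w0; rewrite -memv0 -w0; exact/weight_spaceP.
split=> //; apply/directvP; rewrite /= weight_dim //.
Qed.

Definition fixedT Y : {vspace V} := spanp (fun y => y \in Y /\ forall t, t \in T -> br t y = 0).

Lemma fixedTP Y y : y \in fixedT Y <-> y \in Y /\ forall t, t \in T -> br t y = 0.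
Proof.
apply: mem_spanp => [|c u v [uY uE] [vY vE]].
  by split=> [|t tT]; rewrite ?mem0v // (br0 bil).
split=> [|t tT]; first by rewrite memvD ?memvZ.
by rewrite (brP bil) uE // vE // scaler0 addr0.
Qed.

(** The fixed vectors are those of weight 0, and a vector of nonzero weight is a multiple of its
    bracket with some element of [T]. *)
Lemma torus_fix Y : (forall t y, t \in T -> y \in Y -> br t y \in Y) ->
  Y = (fixedT Y + brv br T Y)%VS /\ (fixedT Y :&: brv br T Y)%VS = 0%VS.
Proof.
move=> TY; split.
  apply/eqP; rewrite eqEsubv; apply/andP; split; last first.
    rewrite subv_add; apply/andP; split; first by apply/subvP=> y /fixedTP[].
    by apply: brv_le => t y; apply: TY.
  apply/subvP=> y /(weight_span TY); move: y; apply: span_ind => [|c u v Eu Ev|y [al [yY yal]]].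
  - exact: mem0v.
  - by rewrite memvD ?memvZ.
  have [[t [tT alt0]]|none] := pselect (exists t, t \in T /\ (al (vsproj T t) : F) != 0).
    apply: subvP (addvSr _ _) _ _; rewrite -[y](scalerK alt0); apply: memvZ.
    by rewrite -yal // (malcC malc) memvN mem_brv.
  apply: subvP (addvSl _ _) _ _; apply/fixedTP; split=> // t tT.
  rewrite (malcC malc) yal //; have [->|nz] := eqVneq (al (vsproj T t) : F) 0; first by rewrite scale0r oppr0.
  by case: none; exists t.
apply/eqP; rewrite -subv0; apply/subvP=> y /memv_capP[/fixedTP[yY yT] yb]; rewrite memv0.
have [D [uD _ _ YE]] := weight_decomposition TY.
pose D' := [seq a <- D | a != 0].
have : y \in (weight_space br T Y (0%R : 'Hom(subvs_of T, F^o)) :&: \sum_(b <- D') weight_space br T Y b)%VS.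
  rewrite memv_cap; apply/andP; split.
    by apply/weight_spaceP; split=> // t tT; rewrite (malcC malc) yT // oppr0 lfE scale0r.
  move: y yb {yY yT}; apply: span_ind => [|c u v Eu Ev|_ [t [y [tT yY ->]]]].
  - exact: mem0v.
  - by rewrite memvD ?memvZ.
  rewrite YE in yY; rewrite /D' big_filter; elim: (D) y yY => [|a s IH] y.
    by rewrite !big_nil memv0 => /eqP ->; rewrite (br0 bil) mem0v.
  rewrite !big_cons => /memv_addP[u ua [v vs ->]]; rewrite (brD bil).
  have /weight_spaceP[uY ut] := ua; rewrite (malcC malc t u) (ut t) //.
  case: eqVneq => [->|_] /=; first by rewrite lfE scale0r oppr0 add0r IH.
  by rewrite memv_add ?memvN ?memvZ ?IH.
by rewrite weight_indep ?memv0 // mem_filter eqxx.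
Qed.

End Torus.

Section SemisimpleSub.
Variables (F : numClosedFieldType) (V : vectType F) (br : V -> V -> V) (k : nat).
Hypotheses (malc : malcev br) (k0 : (0 < k)%N) (HL : (power br fullv k <= Lc br)%VS).
Local Notation bil := (malc_bil malc).
Local Notation alt := (malc_alt malc).
Implicit Types (x y : V) (U S Y : {vspace V}).

Definition incl U : 'Hom(subvs_of U, V) := linfun vsval.

Lemma inclE U (x : subvs_of U) : incl U x = vsval x.
Proof. by rewrite lfunE. Qed.

Lemma incl_morph U : subalg br U -> br_morphism (sub_br br U) br (incl U).
Proof. by move=> sU x y; rewrite !inclE sub_brE. Qed.

Lemma incl_full U : (incl U @: fullv)%VS = U.
Proof.
apply/vspaceP=> x; apply/memv_imgP/idP => [[y _ ->]|xU]; first by rewrite inclE subvsP.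
by exists (vsproj U x); rewrite ?memvf // inclE vsprojK.
Qed.

Lemma incl_img_eq0 U (I : {vspace subvs_of U}) : (incl U @: I)%VS = 0%VS -> I = 0%VS.
Proof.
move=> I0; apply/eqP; rewrite -subv0; apply/subvP=> x xI; rewrite memv0; apply/eqP/val_inj => /=.
by apply/eqP; rewrite -memv0 -I0 -inclE memv_img.
Qed.

Lemma sub_power U n : subalg br U -> (0 < n)%N ->
  (incl U @: power (sub_br br U) fullv n)%VS = power br U n.
Proof. by move=> sU n0; rewrite (power_morph _ (incl_morph sU)) // incl_full. Qed.

Lemma sub_power_Lc U : subalg br U ->
  (power (sub_br br U) fullv k <= Lc (sub_br br U))%VS.
Proof.
move=> sU; apply/subvP=> x xp; apply/(LcP (sub_malcev malc sU)) => y z.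
apply: (can_inj (@vsvalK _ _ _)); rewrite sub_jacE // linear0; apply: (Lc_jac malc); apply: (subvP HL).
apply: (subvP (powerS br k0 (subvf U))); rewrite -sub_power // -inclE; exact: memv_img.
Qed.

Lemma levi_complement_semisimple R S : is_radical br R -> subalg br S ->
  (S + R)%VS = fullv -> (S :&: R)%VS = 0%VS -> semisimple_subalg br S.
Proof.
move=> radR sS SRf SR0; split=> // I [IS iI] [n sI].
have [Q [brq [p [[pm pf kp lieq perfq] ssQ]]]] := radical_quotient malc k0 HL radR.
have pI0 : (p @: I)%VS = 0%VS.
  apply: ssQ; last by exists n; rewrite -(morph_derived pm) sI limg0.
  have [bilq altq _] := lieq.
  apply: (idealI bilq altq) => _ y /memv_imgP[a aI ->].
  have [x ->] := surj_ex pf y; have : x \in (S + R)%VS by rewrite SRf memvf.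
  move=> /memv_addP[s sS' [r rR ->]]; have -> : p (s + r) = p s.
    by move: rR; rewrite -kp memv_ker lfD => /eqP ->; rewrite addr0.
  by rewrite -pm memv_img //; case: (iI a s aI sS').
apply/eqP; rewrite -subv0 -SR0 subv_cap IS; apply/subvP=> x xI.
by rewrite -kp memv_ker -memv0 -pI0 memv_img.
Qed.

Variable S : {vspace V}.
Hypothesis ssS : semisimple_subalg br S.
Let sS : subalg br S := proj1 ssS.

Lemma sub_semisimple I : ideal (sub_br br S) I -> solvable (sub_br br S) I -> I = 0%VS.
Proof.
move=> iI [n sI]; apply: incl_img_eq0; apply: (proj2 ssS).
  split=> [|x y /memv_imgP[a aI ->] yS].
    by apply: subv_trans (limgS _ (subvf I)) _; rewrite incl_full.
  have [E1 E2] := proj2 iI a (vsproj S y) aI (memvf _).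
  by rewrite -{1 2}(vsprojK yS) -inclE -!incl_morph // !memv_img.
by exists n; rewrite -(morph_derived (incl_morph sS)) sI limg0.
Qed.

Lemma semisimple_sub_lie : lie (sub_br br S).
Proof. exact: (semisimple_lie (sub_malcev malc sS) k0 (sub_power_Lc sS) sub_semisimple). Qed.

Lemma semisimple_sub_perfect : ideals_perfect (sub_br br S).
Proof. exact: (semisimple_perfect (sub_malcev malc sS) k0 (sub_power_Lc sS) sub_semisimple). Qed.

(** A semisimple subalgebra is perfect, so it equals its own k-th power. *)
Lemma semisimple_sub_Lc : (S <= Lc br)%VS.
Proof.
apply: subv_trans HL; rewrite -{1}(incl_full S) -(perfect_power semisimple_sub_perfect k0).
by rewrite sub_power // powerS // subvf.
Qed.

Lemma levi_weyl Y : (forall s y, s \in S -> y \in Y -> br s y \in Y) ->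
  (forall y, y \in Y -> exists y0 y1, [/\ y = y0 + y1, y0 \in Y,
     forall s, s \in S -> br s y0 = 0 & y1 \in brv br S Y]) /\
  (forall y, y \in Y -> (forall s, s \in S -> br s y = 0) -> y \in brv br S Y -> y = 0).
Proof.
move=> SY; pose rho : 'Hom(subvs_of S, 'End(V)) := ad br *o incl S.
have rhoA l : rho l = ad br (vsval l) by rewrite /rho comp_lfunE inclE.
have rhoE l y : rho l y = br (vsval l) y by rewrite rhoA (adE bil).
have [|||||W1 W2] := @weyl_action _ _ _ semisimple_sub_lie semisimple_sub_perfect _ _
  (sub_br br S) \1%VF rho Y.
- by move=> x y; rewrite !id_lfunE.
- by rewrite lim1g.
- by move=> l y yY; rewrite rhoE SY // subvsP.
- by move=> l y; rewrite id_lfunE => ->; rewrite (lf0 rho) zero_lfunE.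
- move=> l m y _; rewrite !rhoA sub_brE //.
  by rewrite (ad_Lcl malc) // (subvP semisimple_sub_Lc) // subvsP.
have spE : spanp (fun y1 : V => exists (l : subvs_of S) (z : V), z \in Y /\ y1 = rho l z) = brv br S Y.
  apply/eqP; rewrite eqEsubv; apply/andP; split.
    by apply: span_le => _ [l [z [zY ->]]]; rewrite rhoE mem_brv // subvsP.
  apply: brv_le => u w uS wY; apply: mem_span; exists (vsproj S u), w; split=> //.
  by rewrite rhoE vsprojK.
rewrite spE in W1 W2; split=> [y /W1[y0 [y1 [-> y0Y inv0 y1S]]]|y yY y0].
  exists y0, y1; split=> // s sS'; have := inv0 (vsproj S s).
  by rewrite rhoE vsprojK.
by apply: W2 => // l; rewrite rhoE y0 // subvsP.
Qed.

End SemisimpleSub.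

Section DecompositionExistence.
Variables (F : numClosedFieldType) (V : vectType F) (br : V -> V -> V) (k : nat).
Hypotheses (splA : splitting_alg br) (k0 : (0 < k)%N) (HL : (power br fullv k <= Lc br)%VS).
Let malc : malcev br := proj1 splA.
Local Notation bil := (malc_bil malc).
Local Notation alt := (malc_alt malc).
Implicit Types (x y : V) (U S Y : {vspace V}).

Lemma maximal_torus_ex U : exists T, [/\ (T <= U)%VS,
  forall t u, t \in T -> u \in T -> br t u = 0, forall t, t \in T -> diagble (ad br t) &
  forall t, t \in U -> diagble (ad br t) -> (forall u, u \in T -> br t u = 0) -> t \in T].
Proof.
pose P (T : {vspace V}) := [/\ (T <= U)%VS,
  forall t u, t \in T -> u \in T -> br t u = 0 & forall t, t \in T -> diagble (ad br t)].
have [|T [TU abT ssT] Tmax] := @max_vspace _ _ P 0%VS.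
  split=> [|t u|t]; rewrite ?sub0v ?memv0 // => /eqP ->; first by rewrite (br0l bil).
  by rewrite linear0 -(scale0r (js br 0)); apply/diagble_scale/fcal_diagble.
exists T; split=> // t tU dt tT.
have TL u : u \in T -> u \in Lc br by move=> uT; apply: (semisimple_Lc malc k0 HL); apply: ssT.
have Tt : (\dim (T + <[t]>) <= \dim T)%N.
  apply: Tmax; split.
  - by rewrite subv_add TU -memvE.
  - move=> _ _ /memv_addP[u uT [_ /vlineP[a ->] ->]] /memv_addP[w wT [_ /vlineP[b ->] ->]].
    rewrite !(brE bil) abT // tT // (malcC malc u t) tT // alt.
    by rewrite !(oppr0, scaler0, addr0).
  move=> _ /memv_addP[u uT [_ /vlineP[a ->] ->]]; rewrite lfD lfZ.
  apply: diagble_add; [exact: ssT|exact: diagble_scale|move=> x].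
  rewrite !lfE lfZ; congr (_ *: _); apply: lbr0_comm.
  by rewrite -(ad_Lcl malc) ?TL // (malcC malc) tT // oppr0 linear0.
have /eqP -> : T == (T + <[t]>)%VS by rewrite eqEdim addvSl.
by apply: (subvP (addvSr _ _)); apply: memv_line.
Qed.

(** The torus is taken in the centralizer [C] of [S] in [R], so that it commutes with [S]. Weyl's
    theorem gives [R = C + N] because [[S, R]] lies in [N]. A maximal torus [T1] of [C] splits [C]
    into its fixed vectors and [[T1, C]], which lies in [N]; the fixed vectors are handled by
    [cent]. *)
Theorem splitting_decomposition_ex :
  exists S T N Delta, splitting_decomposition br S T N Delta.
Proof.
have [R radR] := radical_ex bil alt; have [iR _ _] := radR.
have [S [sS SL SRf SR0]] := levi malc k0 HL radR.
have [N [nilN NR NE RN]] := nilradical_ex malc k0 HL radR.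
have ssS := levi_complement_semisimple malc k0 HL radR sS SRf SR0.
have [Q [brq [p [[pm pf kp lieq perfq] ssQ]]]] := radical_quotient malc k0 HL radR.
pose C : {vspace V} := spanp (fun c => c \in R /\ forall s, s \in S -> br s c = 0).
have CP c : c \in C <-> c \in R /\ forall s, s \in S -> br s c = 0.
  apply: mem_spanp => [|a u v [uR u0] [vR v0]].
    by split=> [|s _]; rewrite ?mem0v ?(br0 bil).
  by split=> [|s sS']; rewrite ?memvD ?memvZ // (brP bil) u0 // v0 // scaler0 addr0.
have CR : (C <= R)%VS by apply/subvP=> c /CP[].
have sC : subalg br C.
  move=> x y /CP[xR x0] /CP[yR y0]; apply/CP; split=> [|s sS']; first exact: (ideal_mem _ iR).
  have -> : br s (br x y) = br (br s x) y + br x (br s y).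
    by apply: (jac_leib malc); apply: (Lc_jac malc); apply: (subvP SL).
  by rewrite (x0 _ sS') (y0 _ sS') (br0 bil) (br0l bil) addr0.
have RCN : (R <= C + N)%VS.
  apply/subvP=> r rR; have [|W _] := levi_weyl malc k0 HL ssS (Y := R).
    by move=> s y _; apply: (ideal_memr _ iR).
  have [y0 [y1 [-> y0R inv0 y1S]]] := W r rR.
  apply: memv_add; first exact/CP.
  by apply: subvP y1S; apply: brv_le => s y _; apply: RN.
have [T1 [T1C abT1 ssT1 T1max]] := maximal_torus_ex C.
have T1L : (T1 <= Lc br)%VS by apply/subvP=> t tT; apply: (semisimple_Lc malc k0 HL (ssT1 t tT)).
(* [js g] is [ad t] for some [t] because the algebra is splitting. It maps into [R] as [ad g] does,
   so [t] is central modulo [R] and hence in [R]. It kills [S] and [T1] as [ad g] does, so [t] is in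
   [T1] by maximality, and [g - t] is ad-nilpotent. *)
have cent g : g \in C -> (forall u, u \in T1 -> br g u = 0) -> g \in (T1 + N)%VS.
  move=> gC gT; have [t tE] := (splitting_eltP malc g).1 (proj2 splA g).
  have tb y : br t y = js br g y by rewrite -tE (adE bil).
  have tR : t \in R.
    rewrite -kp memv_ker; apply/eqP/(perfect_centerless lieq perfq) => q.
    have [y ->] := surj_ex pf q; rewrite -pm tb; apply/eqP; rewrite -memv_ker kp.
    apply: (fcal_img (U := fullv) _ _ _ (memvf y)) => // [u _|u _]; first exact: memvf.
    by rewrite (adE bil); apply: (ideal_mem _ iR); apply: (subvP CR).
  have tT : t \in T1.
    apply: T1max => [||u uT].
    - apply/CP; split=> // s sS'; rewrite (malcC malc) tb (ad_eq0_js malc) ?oppr0 //.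
      by rewrite (malcC malc); have [_ ->] := (CP g).1 gC; rewrite ?oppr0.
    - by rewrite tE; apply: fcal_diagble.
    - by rewrite tb (ad_eq0_js malc) // gT.
  rewrite -[g](subrK t) addrC memv_add //; apply/NE; first by rewrite memvB // (subvP CR).
  by move=> x; rewrite lfB tE; apply: fcal_id_nilp.
have RTN : R = (T1 + N)%VS.
  apply/eqP; rewrite eqEsubv subv_add NR (subv_trans T1C CR) !andbT.
  apply: subv_trans RCN _; rewrite subv_add addvSr andbT.
  have [CE _] := torus_fix malc T1L abT1 ssT1 (fun t y tT yC => sC t y (subvP T1C _ tT) yC).
  rewrite CE subv_add; apply/andP; split.
    apply/subvP=> g /(fixedTP malc)[gC gT]; apply: cent => // u uT.
    by rewrite (malcC malc) gT // oppr0.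
  apply: subv_trans (addvSr _ _); apply: brv_le => t y _ yC; apply: RN; exact: (subvP CR).
(* T1 meets N in the annihilator of the algebra, which may be nonzero. *)
pose T := (T1 :\: N)%VS.
have TT1 : (T <= T1)%VS := diffvSl _ _.
have TN0 : (T :&: N)%VS = 0%VS := capv_diff _ _.
have TNR : (T + N)%VS = R by rewrite addv_diff.
have [iN _ _] := nilN.
have [|t u tT uT|||Delta [uD nD dD NDE]] := @weight_decomposition _ _ br malc T _ _ _ N.
- exact: subv_trans TT1 T1L.
- by rewrite abT1 // (subvP TT1).
- by move=> t tT; apply/ssT1/(subvP TT1).
- by move=> t y _; apply: (ideal_memr _ iN).
exists S, T, N, Delta; split=> //.
- split.
  + by rewrite -addvA TNR.
  + have ST0 : (S :&: T)%VS = 0%VS.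
      by apply/eqP; rewrite -subv0 -SR0 capvS // -TNR addvSl.
    apply/directvP; rewrite /= dimv_disjoint_sum ?dimv_disjoint_sum //.
    apply/eqP; rewrite -subv0; apply/subvP=> x /memv_capP[/memv_addP[s sS' [t tT ->]] stN].
    have tR : t \in R by rewrite -TNR; apply: (subvP (addvSl _ _)).
    have s0 : s = 0.
      apply/eqP; rewrite -memv0 -SR0 memv_cap sS' -[s](addrK t) memvB //; exact: (subvP NR).
    by move: stN; rewrite s0 add0r -TN0 memv_cap tT.
  move=> s t sS' tT; have /CP[_ ->] // : t \in C by apply: (subvP T1C); apply: (subvP TT1).
- by split=> //; exists R.
- split=> [t u tT uT|t u tT uT|t tT].
  + by rewrite abT1 ?mem0v // (subvP TT1).
  + by rewrite abT1 // (subvP TT1).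
  by apply/(semisimple_eltP malc)/ssT1/(subvP TT1).
Qed.

End DecompositionExistence.

Section JointlyInjective.
Variables (F : numClosedFieldType) (E V : vectType F) (bre : E -> E -> E) (br : V -> V -> V).
Variables f g : 'Hom(E, V).
Hypotheses (fm : br_morphism bre br f) (gm : br_morphism bre br g).
Hypothesis fg_inj : forall x y, f x = f y -> g x = g y -> x = y.

Lemma morph_paren (h : 'Hom(E, V)) n w : br_morphism bre br h ->
  paren_product bre n w -> paren_product br n (h w).
Proof.
move=> hm; elim=> {n w} [x|i j x y _ IHx _ IHy]; first exact: ParenLeaf.
by rewrite hm; apply: ParenNode.
Qed.

Lemma jointly_injective_NL k : NL br k -> NL bre k.
Proof.
move=> [malc J0]; have bil := malc_bil malc; split.
  split=> [|x|x y z].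
  - by split=> x c u v; apply: fg_inj; rewrite ?lfP ?fm ?gm ?lfP ?(brP bil) ?(brPl bil).
  - by apply: fg_inj; rewrite ?fm ?gm (malc_alt malc) lf0.
  by apply: fg_inj; rewrite ?fm ?gm !(morph_jac fm, morph_jac gm) (malc_id malc) ?fm ?gm.
move=> w y z wk; apply: fg_inj; rewrite ?(morph_jac fm) ?(morph_jac gm) J0 ?lf0 //.
  exact: morph_paren.
exact: morph_paren.
Qed.

End JointlyInjective.

(** * The ideal [M1], the subalgebra [N00] and their decomposable extension *)

Section DecompositionStructure.
Variables (F : numClosedFieldType) (V : vectType F) (br : V -> V -> V) (k : nat).
Hypotheses (k0 : (0 < k)%N) (NLk : NL br k).
Let malc : malcev br := proj1 NLk.
Let HL : (power br fullv k <= Lc br)%VS := proj2 ((NL_power malc k0).1 NLk).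
Local Notation bil := (malc_bil malc).
Local Notation alt := (malc_alt malc).
Variables (S T N : {vspace V}) (Delta : seq 'Hom(subvs_of T, F^o)).
Hypothesis dec : splitting_decomposition br S T N Delta.
Local Notation V0 := (N00 br S T N).
Local Notation L := (M1 br S T N Delta).
Implicit Types x y : V.

Let ssS : semisimple_subalg br S. Proof. by case: dec => _ []. Qed.
Let SL : (S <= Lc br)%VS := semisimple_sub_Lc malc k0 HL ssS.
Let iN : ideal br N. Proof. by case: dec => _ _ _ []. Qed.
Let abT t u : t \in T -> u \in T -> br t u = 0. Proof. by case: dec => _ _ [_ + _] _ _; apply. Qed.
Let ssT t : t \in T -> diagble (ad br t).
Proof. by case: dec => _ _ [_ _ sT] _ _ tT; apply/(semisimple_eltP malc)/sT. Qed.
Let TL : (T <= Lc br)%VS.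
Proof. by apply/subvP=> t tT; apply/(semisimple_Lc malc k0 HL)/ssT. Qed.
Let STL : (S + T <= Lc br)%VS. Proof. by rewrite subv_add SL. Qed.
Let NS y n : n \in N -> br y n \in N. Proof. exact: ideal_memr. Qed.
Let Lder l x y : l \in Lc br -> br l (br x y) = br (br l x) y + br x (br l y).
Proof. by move=> lL; apply: (jac_leib malc); apply: (Lc_jac malc). Qed.
Let ST0 s t : s \in S -> t \in T -> br s t = 0. Proof. by case: dec => [[_ _ +] _ _ _ _]; apply. Qed.

Lemma N00P x : x \in V0 <-> x \in N /\ forall y, y \in (S + T)%VS -> br y x = 0.
Proof.
apply: mem_spanp => [|c u v [uN u0] [vN v0]].
  by split=> [|y _]; rewrite ?mem0v ?(br0 bil).
by split=> [|y yST]; rewrite ?memvD ?memvZ // (brP bil) u0 // v0 // scaler0 addr0.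
Qed.

Local Notation Y := (fixedT br T N).

Let S_T s t n : s \in S -> t \in T -> br s (br t n) = br t (br s n).
Proof.
by move=> sS tT; rewrite (Lder _ _ (subvP SL _ sS)) (ST0 sS tT) (br0l bil) add0r.
Qed.

Let SY s y : s \in S -> y \in Y -> br s y \in Y.
Proof.
move=> sS /(fixedTP malc)[yN y0]; apply/(fixedTP malc); split=> [|t tT]; first exact: NS.
by rewrite -S_T // y0 // (br0 bil).
Qed.

Let N00_fixed y : y \in V0 <-> y \in Y /\ forall s, s \in S -> br s y = 0.
Proof.
split=> [/N00P[yN y0]|[/(fixedTP malc)[yN yT] yS]].
  split=> [|s sS]; last by rewrite y0 // (subvP (addvSl _ _)).
  by apply/(fixedTP malc); split=> // t tT; rewrite y0 // (subvP (addvSr _ _)).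
apply/N00P; split=> // _ /memv_addP[s sS [t tT ->]].
by rewrite (brDl bil) yS // yT // addr0.
Qed.

Let TN := torus_fix malc TL abT ssT (fun t n _ nN => NS t nN).
Let SW := levi_weyl malc k0 HL ssS SY.

Lemma N00_le : (V0 <= N)%VS.
Proof. by apply/subvP=> x /N00P[]. Qed.

Lemma N00_subalg : subalg br V0.
Proof.
move=> x y /N00P[xN x0] /N00P[yN y0]; apply/N00P; split=> [|z zST]; first exact: NS.
by rewrite Lder ?(subvP STL) // (x0 _ zST) (y0 _ zST) (br0 bil) (br0l bil) addr0.
Qed.

Lemma N00_nilpotent : nilpotent br V0.
Proof.
have [_ [n n0 Nn] _] : is_nilradical br N by case: dec.
exists n => //; apply/eqP; rewrite -subv0 -Nn; exact/powerS/N00_le.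
Qed.

(** First [T] splits [N] into fixed vectors and [[T, N]]; the fixed space is stable under [S], which
    commutes with [T], and Weyl's theorem splits it further. *)
Lemma nilradical_decomp : N = (V0 + brv br (S + T) N)%VS.
Proof.
apply/eqP; rewrite eqEsubv subv_add N00_le andTb; apply/andP; split; last first.
  by apply: brv_le => u n _; apply: NS.
have [E _] := TN; rewrite {1}E subv_add; apply/andP; split; last first.
  by apply: subv_trans (addvSr _ _); apply: brvS; rewrite ?addvSr.
apply/subvP=> y /(proj1 SW)[y0 [y1 [-> y0Y inv0 y1S]]].
apply: memv_add; first exact/N00_fixed.
apply: subvP y1S; apply: brvS; first exact: addvSl.
by apply/subvP=> z /(fixedTP malc)[].
Qed.

(** Since [S] and [T] commute, [[S, [T, N]]] lies in [[T, N]], so [[S + T, N]] lies in [[S, Y] +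
    [T, N]], with [Y] the vectors fixed by [T]. The two direct decompositions, for [T] and then for
    [S] on [Y], exclude an intersection. *)
Lemma nilradical_decomp_direct : directv (V0 + brv br (S + T) N).
Proof.
apply/directv_addP/eqP; rewrite -subv0; apply/subvP=> v /memv_capP[/N00_fixed[vY vS] vST].
have {vST}: v \in (brv br S Y + brv br T N)%VS.
  apply: subvP vST; apply: brv_le => _ n /memv_addP[s sS [t tT ->]] nN.
  rewrite (brDl bil) memvD //; last by apply: (subvP (addvSr _ _)); apply: mem_brv.
  have [E _] := TN; rewrite {1}E in nN; have /memv_addP[y yY [z zTN ->]] := nN.
  rewrite (brD bil); apply: memv_add; first exact: mem_brv.
  move: z {nN} zTN; apply: span_ind => [|c u w IHu IHw|_ [u [w [uT wN ->]]]].
  - by rewrite (br0 bil) mem0v.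
  - by rewrite (brP bil) memvD ?memvZ.
  by rewrite S_T // mem_brv // NS.
move=> /memv_addP[a aS [b bT vE]]; rewrite memv0; apply/eqP.
have aY : a \in Y by apply: subvP aS; apply: brv_le => s y; apply: SY.
have b0 : b = 0.
  have [_ T0] := TN; apply/eqP; rewrite -memv0 -T0 memv_cap bT andbT.
  by rewrite -[b](addKr a) -vE memvD ?memvN.
by rewrite b0 addr0 in vE; rewrite vE; apply: (proj2 SW _ aY _ aS); rewrite -vE.
Qed.

Let LgenP := ideal_genP br (fun x => x \in
  (S + T + \sum_(alpha <- Delta | alpha != 0%R) weight_space br T N alpha + brv br S N)%VS).

Lemma M1_ideal : ideal br L.
Proof. by case: LgenP. Qed.

Lemma ST_M1 : (S + T <= L)%VS.
Proof.
apply/subvP=> x xST; have [_ + _] := LgenP; apply.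
by rewrite -addvA (subvP (addvSl _ _)).
Qed.

(** The Lie center is an ideal containing [S] and [T], so only generators matter; one of nonzero
    weight is a multiple of its bracket with some [t] in [T]. *)
Lemma M1_Lc : (L <= Lc br)%VS.
Proof.
have [_ _] := LgenP; apply; first exact: Lc_ideal.
apply/subvP; rewrite subv_add subv_add STL; apply/andP; split; last first.
  apply: brv_le => s n sS _; apply: (ideal_mem _ (Lc_ideal malc)); exact: (subvP SL).
rewrite andTb; elim/big_ind: _ => [|U W UL WL|al al0]; rewrite ?sub0v ?subv_add ?UL //.
apply/subvP=> x /(weight_spaceP malc)[xN xE].
have [t alt0] : exists t : subvs_of T, (al t : F) != 0.
  apply: contrapT => no; case/eqP: al0; apply/lfunP=> t; rewrite zero_lfunE.
  by apply: contrapT => /eqP at0; case: no; exists t.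
have tT := subvsP t; rewrite -(vsvalK t) in alt0.
rewrite -[x](scalerK alt0) -xE //; apply/memvZ.
by apply: (ideal_memr _ (Lc_ideal malc)); apply: (subvP TL).
Qed.

Lemma N00_M1_full : (V0 + L)%VS = fullv.
Proof.
apply/eqP; rewrite eqEsubv subvf /=; have [[<- _ _] _ _ _ _] := dec.
rewrite subv_add (subv_trans ST_M1 (addvSr _ _)) [X in (X <= _)%VS]nilradical_decomp.
apply: addvS => //; apply: brv_le => y n yST _.
apply: (ideal_mem _ M1_ideal); exact: (subvP ST_M1).
Qed.

Lemma M1_lie : lie (sub_br br L).
Proof. apply: (Lc_sub_lie malc) => //; [exact: ideal_subalg M1_ideal|exact: M1_Lc]. Qed.

(** On the Lie center brackets act as commutators of operators, so a Jacobian acts by a cyclic sum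
    of double commutators, which is zero. *)
Lemma jac_acts_trivially l x y z : l \in Lc br -> br (jac br x y z) l = 0.
Proof.
move=> lL; have Ll a b : b \in Lc br -> br a b \in Lc br by apply: (ideal_memr _ (Lc_ideal malc)).
rewrite /jac !(brDl bil) !(ad_Lcr malc) //; try by do ?apply: Ll.
rewrite !(brB bil); vring.
Qed.

Lemma M1_dext_conditions : dext_conditions br V0 L.
Proof.
have sV0 := N00_subalg; have mV0 := sub_malcev malc sV0.
(* The ideal demanded by a decomposable extension is taken to be the annihilator of [L] in [V0]; it
   contains the Jacobians by [jac_acts_trivially]. *)
pose I : {vspace subvs_of V0} := spanp (fun b : subvs_of V0 => forall l, l \in L -> br (vsval b) l = 0).
have IP (b : subvs_of V0) : b \in I <-> forall l, l \in L -> br (vsval b) l = 0.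
  apply: mem_spanp => [l _|c u v u0 v0 l lL]; first by rewrite linear0 (br0l bil).
  by rewrite linearP /= (brPl bil) u0 // v0 // scaler0 addr0.
have iI : ideal (sub_br br V0) I.
  apply: (idealI (malc_bil mV0) (malc_alt mV0)) => x y /IP x0; apply/IP => l lL.
  have ylL := ideal_memr (vsval y) M1_ideal lL.
  by rewrite sub_brE // (ad_Lcr malc) ?(subvP M1_Lc) // (x0 _ ylL) (x0 _ lL) (br0 bil) subr0.
split=> //; [exact: M1_ideal|exact: N00_M1_full|move=> l lL|].
  by apply/(LcP malc)/(subvP M1_Lc).
exists I; split=> // [|b l /IP + lL]; last exact.
have [_ _] := ideal_genP (sub_br br V0) (fun w : subvs_of V0 => exists x y z : subvs_of V0, w = jac (sub_br br V0) x y z).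
apply=> // _ [x [y [z ->]]]; apply/IP => l lL.
by rewrite sub_jacE // jac_acts_trivially // (subvP M1_Lc).
Qed.

Definition dext_sum : 'Hom((subvs_of V0 * subvs_of L)%type, V) :=
  linfun (fun q : subvs_of V0 * subvs_of L => vsval q.1 + vsval q.2).
Definition dext_fst : 'Hom((subvs_of V0 * subvs_of L)%type, V) :=
  linfun (fun q : subvs_of V0 * subvs_of L => vsval q.1).

Lemma dext_sumE q : dext_sum q = vsval q.1 + vsval q.2.
Proof. by rewrite linfun_linE // => c u v; vring. Qed.

Lemma dext_fstE q : dext_fst q = vsval q.1.
Proof. by rewrite linfun_linE // => c u v /=; rewrite !linearP. Qed.

Lemma dext_sum_morph : br_morphism (dext_br br V0 L) br dext_sum.
Proof.
move=> [a l] [b r]; rewrite !dext_sumE /= sub_brE; last exact: N00_subalg.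
have iL x (q : subvs_of L) : br (vsval q) x \in L by apply: (ideal_mem _ M1_ideal); apply: subvsP.
rewrite vsprojK; last by apply: rpredD; [apply: rpredB|]; apply: iL.
by rewrite !(brD bil) !(brDl bil) (malcC malc (vsval a) (vsval r)); vring.
Qed.

Lemma dext_fst_morph : br_morphism (dext_br br V0 L) br dext_fst.
Proof. by move=> [a l] [b r]; rewrite !dext_fstE /= sub_brE //; apply: N00_subalg. Qed.

Lemma dext_NL : NL (dext_br br V0 L) k.
Proof.
apply: (jointly_injective_NL dext_sum_morph dext_fst_morph _ NLk) => -[a l] [b r].
rewrite !dext_sumE !dext_fstE /= => E1 E2; rewrite E2 in E1.
by congr (_, _); apply: (can_inj (@vsvalK _ _ _)) => //; apply: (addrI _ E1).
Qed.

Lemma dext_epimorphism : epimorphism (dext_br br V0 L) br dext_sum.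
Proof.
split; first exact: dext_sum_morph.
apply/eqP; rewrite eqEsubv subvf -N00_M1_full; apply/subvP=> _ /memv_addP[a aV [l lL ->]].
apply/memv_imgP; exists (vsproj V0 a, vsproj L l); rewrite ?memvf // dext_sumE /=.
by rewrite !vsprojK.
Qed.

Theorem decomposition_structure :
  [/\ [/\ semisimple_subalg br S, lie (sub_br br S), toroidal br T, ideal br N & nilpotent br N],
      [/\ N = (V0 + brv br (S + T) N)%VS, directv (V0 + brv br (S + T) N),
          (V0 <= N)%VS, subalg br V0 & forall x, x \in L -> lie_center br x] &
      [/\ malcev (sub_br br V0) /\ nilpotent br V0, subalg br L /\ lie (sub_br br L),
          dext_conditions br V0 L, NL (dext_br br V0 L) k &
          exists pi : 'Hom((subvs_of V0 * subvs_of L)%type, V),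
            epimorphism (dext_br br V0 L) br pi]].
Proof.
have [_ _ torT [_ nilN _] _] := dec; split.
- by split=> //; apply: (semisimple_sub_lie malc k0 HL).
- split; [exact: nilradical_decomp|exact: nilradical_decomp_direct|exact: N00_le|exact: N00_subalg|].
  by move=> x /(subvP M1_Lc)/(LcP malc).
split.
- by split; [apply/(sub_malcev malc)/N00_subalg|exact: N00_nilpotent].
- by split; [apply: ideal_subalg M1_ideal|exact: M1_lie].
- exact: M1_dext_conditions.
- exact: dext_NL.
by exists dext_sum; apply: dext_epimorphism.
Qed.

End DecompositionStructure.

(** * Existence of splittings *)

Section TraceForm.
Variables (F : numClosedFieldType) (V : vectType F).
Implicit Types f g h : 'End(V).

(** If [f v] is nonzero, the projection onto its line has the form [f *o g], and its trace is its
    rank, which is positive. *)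
Lemma trl_eq0 f : (forall g, trl (f *o g) = 0) -> f = 0.
Proof.
move=> f0; apply/lfunP=> v; rewrite zero_lfunE; apply: contrapT => /eqP fv0.
pose e := projv <[f v]>; have fE : f *o (f^-1%VF *o e) = e.
  apply/lfunP=> x; rewrite !comp_lfunE /= limg_lfunVK //.
  by have : e x \in <[f v]>%VS := memv_proj _ _; apply: subvP; rewrite -memvE memv_img ?memvf.
have e_id : (e \o e)%VF = e.
  by apply/lfunP=> x; rewrite comp_lfunE /= projv_id // memv_proj.
have [r rE r0] := trl_idem e_id; have := f0 (f^-1%VF *o e); rewrite fE rE => /eqP.
rewrite pnatr_eq0 => /eqP/r0 e0; have : e (f v) = f v by rewrite projv_id // memv_line.
by rewrite e0 zero_lfunE => E; rewrite -E eqxx in fv0.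
Qed.

(** On the part of [U] for a nonzero eigenvalue [f] is bijective; on the null part the semisimple
    part vanishes. *)
Lemma image_lift f (U : {vspace V}) u : stab f U -> u \in U ->
  exists2 y, y \in U & f y = fcal id f u.
Proof.
move=> fU; move: u; apply: (genE_ind fU) => [|c u v [y yU yE] [z zU zE]|mu u uU umu].
- by exists 0; rewrite ?mem0v ?lf0.
- by exists (c *: y + z); rewrite ?memvD ?memvZ // !lfP yE zE.
rewrite (fcalE _ umu) /=; have [->|mu0] := eqVneq mu 0.
  by exists 0; rewrite ?mem0v ?lf0 ?scale0r.
pose K := (U :&: genE f mu)%VS; have fK : (f @: K <= K)%VS.
  apply/subvP=> _ /memv_imgP[x + ->]; rewrite !memv_cap => /andP[xU xmu].
  by rewrite fU // genE_stab.
have /eqP KE : (f @: K)%VS == K.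
  rewrite eqEdim fK limg_dim_eq ?leqnn //; apply/eqP; rewrite -subv0; apply/subvP=> x.
  rewrite !memv_cap memv_ker memv0 => /andP[/andP[_ xmu] /eqP fx]; apply/eqP.
  by apply: (genE_shift_inj mu0 xmu); rewrite fx scale0r.
have : mu *: u \in (f @: K)%VS by rewrite KE memvZ // memv_cap uU.
by move=> /memv_imgP[y + ->]; rewrite memv_cap => /andP[yU _]; exists y.
Qed.

End TraceForm.

(** * Jordan decomposition inside a semisimple subalgebra *)

Section SemisimpleJordan.
Variables (F : numClosedFieldType) (V : vectType F) (br : V -> V -> V) (k : nat).
Hypotheses (malc : malcev br) (k0 : (0 < k)%N) (HL : (power br fullv k <= Lc br)%VS).
Local Notation bil := (malc_bil malc).
Variable S : {vspace V}.
Hypothesis ssS : semisimple_subalg br S.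
Let sS : subalg br S := proj1 ssS.
Let SL := semisimple_sub_Lc malc k0 HL ssS.
Let lieS := semisimple_sub_lie malc k0 HL ssS.
Let perfS := semisimple_sub_perfect malc k0 HL ssS.
Local Notation rho := (ad br *o incl S).

Let rhoE l : rho l = ad br (vsval l).
Proof. by rewrite comp_lfunE inclE. Qed.

Let rho_rep : lie_rep (sub_br br S) rho.
Proof. by move=> x y; rewrite !rhoE sub_brE // (ad_Lcl malc) // (subvP SL) // subvsP. Qed.

Let GP (g : 'End(V)) : g \in limg rho -> exists2 s, s \in S & g = ad br s.
Proof. by move=> /memv_imgP[l _ ->]; exists (vsval l); rewrite ?subvsP ?rhoE. Qed.

Let adG s : s \in S -> ad br s \in limg rho.
Proof. by move=> sS'; rewrite -(vsprojK sS') -rhoE memv_img ?memvf. Qed.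

(** The trace form is nondegenerate on [ad S], so [js s] is [ad s'] plus an [E] orthogonal to
    [ad S]. As [js s] is a derivation preserving [S], brackets of [E] with [ad S] lie in [ad S] and
    are orthogonal to it: [E] commutes with [ad S]. *)
Theorem semisimple_jordan s : s \in S -> exists2 s', s' \in S & ad br s' = js br s.
Proof.
pose B (f g : 'End(V)) := trl (f *o g).
have BP x c y z : B x (c *: y + z) = c * B x y + B x z by rewrite /B compP trlP.
have BPl z c x y : B (c *: x + y) z = c * B x z + B y z by rewrite /B compPl trlP.
pose G := limg rho; have nd := rep_trace_nondegenerate lieS perfS rho_rep.
have G0 g : g \in G -> g \in perp B G -> g = 0.
  by move=> gG /(perpP BP) gp; apply: nd => // h hG; rewrite trl_comp; apply: gp.
have GD : (G + perp B G)%VS = fullv.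
  apply/eqP; rewrite eqEdim subvf dimv_disjoint_sum ?dim_perp //.
  by apply/eqP; rewrite -subv0; apply/subvP=> g /memv_capP[gG gp]; rewrite memv0 (G0 g).
move=> sSs; have : js br s \in (G + perp B G)%VS by rewrite GD memvf.
move=> /memv_addP[_ /GP[s' s'S ->] [E /(perpP BP) EG jsE]]; exists s' => //.
(* E is trace-orthogonal to the centralizer of [ad S] and to [[ad S, End V]],
   which together span [End V]. *)
suff E0 : E = 0 by rewrite jsE E0 addr0.
have SjS u : u \in S -> js br s u \in S.
  by apply: fcal_stab => v vS; rewrite (adE bil) sS.
have Eu u : u \in S -> lbr E (ad br u) = 0.
  move=> uS; have EE : E = js br s - ad br s' by rewrite jsE addrC addKr.
  have lE : lbr E (ad br u) = ad br (js br s u - br s' u).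
    rewrite EE lfB (derivation_ad malc) ?(ad_Lcl malc) ?(subvP SL) //; last exact: (js_derivation malc k0 HL).
    by apply/lfunP=> x; rewrite /lbr !(add_lfunE, opp_lfunE, comp_lfunE) lfB; vring.
  apply: G0; first by rewrite lE adG // memvB ?SjS ?sS.
  apply/(perpP BP) => _ /GP[v vS ->]; rewrite /B lbrC comp_lfunNr trlN trl_comm -(ad_Lcl malc) ?(subvP SL) //.
  by have := EG _ (adG (sS vS uS)); rewrite /B => ->; rewrite oppr0.
have SS : brv br S S = S.
  have fi : ideal (sub_br br S) fullv by split=> [|x y]; rewrite ?subvf ?memvf.
  by have := morph_brv (incl_morph sS) fullv fullv; rewrite (perfS fi) incl_full => <-.
(* A [Y] commuting with [ad S] is orthogonal to [[ad S, ad S]], which is [ad S]. It is then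
   orthogonal to [js s] too, because the nilpotent part of [ad s] times a commuting operator has
   trace zero. *)
have adY Y u : u \in S -> (forall u, u \in S -> lbr (ad br u) Y = 0) -> trl (ad br u *o Y) = 0.
  move=> uS YS; rewrite -SS in uS; move: u uS; apply: span_ind => [|c u v u0 v0|_ [a [b [aS bS ->]]]].
  - by rewrite linear0 comp_lfun0l trl0.
  - by rewrite lfP compPl trlP u0 v0 mulr0 addr0.
  by rewrite (ad_Lcl malc) ?(subvP SL) // -trl_comm YS // comp_lfun0r trl0.
have EY Y : (forall u, u \in S -> lbr (ad br u) Y = 0) -> trl (E *o Y) = 0.
  move=> YS; have EE : E = -1 *: ad br s' + js br s by rewrite jsE scaleN1r addKr.
  rewrite EE compPl trlP adY // -trl_semisimple ?adY ?mulr0 ?addr0 // => x.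
  by apply: lbr0_comm; apply: YS.
pose rho2 : 'Hom(subvs_of S, 'End('End(V))) := linfun (fun l => lad (rho l)).
have rho2E l f : rho2 l f = lbr (ad br (vsval l)) f.
  rewrite linfun_linE ?ladE ?rhoE // => c x y; apply/lfunP=> h.
  by rewrite add_lfunE scale_lfunE !ladE lfP lbrPl.
have rep2 : lie_rep (sub_br br S) rho2.
  move=> x y; apply/lfunP=> h; rewrite lbrE !rho2E sub_brE // (ad_Lcl malc) ?(subvP SL) ?subvsP //.
  by rewrite lbr_jacobi addrK.
have [W _] := weyl lieS perfS rep2.
apply: trl_eq0 => Z; have : Z \in fullv := memvf Z.
rewrite -W => /memv_addP[Y /invsP Y0 [{}Z Z1 ->]]; rewrite -[Y]scale1r compP trlP EY ?mulr0 ?add0r; last first.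
  move=> u uS; rewrite -(vsprojK uS) -rho2E; apply: Y0; exact: memv_img (memvf _).
move: Z Z1; apply: span_ind => [|c X Y' X0 Y'0|_ [_ [Z [/memv_imgP[l _ ->] _ ->]]]].
- by rewrite comp_lfun0r trl0.
- by rewrite compP trlP X0 Y'0 mulr0 addr0.
by rewrite rho2E trl_comm Eu ?subvsP // comp_lfun0l trl0.
Qed.

End SemisimpleJordan.

(** * Exponentials of nilpotent derivations *)

Section Exponential.
Variables (F : numClosedFieldType) (V : vectType F) (br : V -> V -> V).
Hypothesis bil : bilinear_br br.
Variables (d : 'End(V)) (m : nat).
Hypotheses (dD : forall x y, d (br x y) = br (d x) y + br x (d y)).
Hypothesis d0 : forall x, iter m d x = 0.
Implicit Types x y : V.

Definition dpow n x : V := n`!%:R^-1 *: iter n d x.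

Lemma dpowS n x : d (dpow n x) = n.+1%:R *: dpow n.+1 x.
Proof.
rewrite /dpow lfZ -iterS scalerA; congr (_ *: _).
by rewrite factS natrM invfM mulrA divff ?mul1r // pnatr_eq0.
Qed.

Lemma dpow_eq0 n x : (m <= n)%N -> dpow n x = 0.
Proof. by move=> mn; rewrite /dpow (iter_eq0_leq (d0 x) mn) scaler0. Qed.

Lemma dpow_lin n : linear (dpow n).
Proof. by move=> c x y; rewrite /dpow iter_lin scalerDr !scalerA mulrC. Qed.

Lemma br_suml I (r : seq I) (P : pred I) (E : I -> V) y :
  br (\sum_(i <- r | P i) E i) y = \sum_(i <- r | P i) br (E i) y.
Proof. by elim/big_rec2: _ => [|i u v _ <-]; rewrite ?(br0l bil) ?(brDl bil). Qed.

Lemma br_sumr I (r : seq I) (P : pred I) (E : I -> V) y :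
  br y (\sum_(i <- r | P i) E i) = \sum_(i <- r | P i) br y (E i).
Proof. by elim/big_rec2: _ => [|i u v _ <-]; rewrite ?(br0 bil) ?(brD bil). Qed.

Lemma dpow_br n x y : dpow n (br x y) = \sum_(i < n.+1) br (dpow i x) (dpow (n - i) y).
Proof.
elim: n => [|n IH].
  by rewrite big_ord1 /dpow /= fact0 invr1 !scale1r.
have n1 : n.+1%:R != 0 :> F by rewrite pnatr_eq0.
apply: (scalerI n1); rewrite -dpowS IH lf_sum.
under eq_bigr => i _ do rewrite dD !dpowS (brZl bil) (brZ bil).
rewrite scaler_sumr [RHS](eq_bigr (fun i : 'I_n.+2 => i%:R *: br (dpow i x) (dpow (n.+1 - i) y) +
  (n.+1 - i)%:R *: br (dpow i x) (dpow (n.+1 - i) y))) => [|i _]; last first.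
  by rewrite -scalerDl -natrD subnKC // -ltnS.
rewrite !big_split /=; congr (_ + _).
  by rewrite [RHS]big_ord_recl /= scale0r add0r; apply: eq_bigr => i _; rewrite /bump add1n subSS.
rewrite [RHS]big_ord_recr /= subnn scale0r addr0; apply: eq_bigr => i _.
by rewrite subSn // -ltnS.
Qed.

(** The triangle [i + j < m + m] contains the square of indices below [m], outside which [H]
    vanishes. *)
Lemma sum_antidiagonal (H : nat -> nat -> V) : (forall i j, (m <= i)%N || (m <= j)%N -> H i j = 0) ->
  \sum_(n < m + m) \sum_(i < n.+1) H i (n - i)%N = \sum_(i < m) \sum_(j < m) H i j.
Proof.
move=> H0; under eq_bigr => n _ do rewrite (big_ord_widen (m + m) (fun i => H i (n - i)%N)) ?ltn_ord //.
rewrite (exchange_big_dep predT) //= big_split_ord /= [X in _ + X]big1 ?addr0 => [|i _]; last first.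
  by rewrite big1 // => n _; rewrite H0 ?leq_addr.
apply: eq_bigr => i _; rewrite -(big_mkord (fun n => i < n.+1)%N (fun n => H i (n - i)%N)).
have im : (i <= m + m)%N by apply: leq_trans (ltnW (ltn_ord i)) (leq_addr _ _).
rewrite (big_cat_nat (leq0n i) im) /= big_nat_cond big1 ?add0r => [|n]; last by rewrite ltnS => /andP[/andP[_ +] +]; lia.
rewrite -{1}[nat_of_ord i]add0n big_addn big_mkord.
have mi : (m <= m + m - i)%N by have := ltn_ord i; lia.
rewrite [LHS](eq_bigl predT) => [|j]; last exact: leq_addl.
rewrite [LHS](eq_bigr (fun j : 'I_(m + m - i) => H i j)) => [|j _]; last by rewrite addnK.
rewrite -(subnKC mi) big_split_ord /= [X in _ + X]big1 ?addr0 // => j _.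
by rewrite H0 // leq_addr orbT.
Qed.

Definition expd : 'End(V) := linfun (fun x => \sum_(i < m) dpow i x).

Lemma expdE M x : (m <= M)%N -> expd x = \sum_(i < M) dpow i x.
Proof.
move=> mM; rewrite linfun_linE => [|c u v].
  rewrite -(subnKC mM) big_split_ord /= [X in _ + X]big1 ?addr0 // => i _.
  by rewrite dpow_eq0 ?leq_addr.
rewrite scaler_sumr -big_split; apply: eq_bigr => i _; exact: dpow_lin.
Qed.

Lemma expd_morph : br_morphism br br expd.
Proof.
move=> x y; rewrite (expdE (M := (m + m)%N)) ?leq_addr //.
under eq_bigr => n _ do rewrite dpow_br.
rewrite (sum_antidiagonal (H := fun i j => br (dpow i x) (dpow j y))) => [|i j].
  by rewrite !(expdE _ (leqnn m)) br_suml; apply: eq_bigr => i _; rewrite br_sumr.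
by case/orP=> mi; rewrite (dpow_eq0 _ mi) ?(br0 bil) ?(br0l bil).
Qed.

(** If [d^(r+1)] is the first power to kill a nonzero [x], then [d^r] applied to the exponential
    leaves only [d^r x], which is nonzero. *)
Lemma expd_inj x : expd x = 0 -> x = 0.
Proof.
move=> ex0; apply: contrapT => /eqP x0.
have exr : exists r, iter r d x == 0 by exists m; rewrite d0.
case: (ex_minnP exr) => -[|r] /eqP dr rmin; first by move: x0; rewrite -dr eqxx.
have : iter r d (expd x) = iter r d x.
  rewrite (expdE _ (leqnSn m)) (big_morph _ (iterD_lin d r) (iter0 d r)) big_ord_recl big1.
    by rewrite addr0 /dpow /= fact0 invr1 scale1r.
  move=> i _; rewrite /dpow iterZ_lin -iterD /= /bump add1n addnS -addSn addnC iterD dr iter0.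
  by rewrite scaler0.
by rewrite ex0 iter0 => /esym/eqP/rmin; rewrite ltnn.
Qed.

End Exponential.

Section SplittingAutomorphism.
Variables (F : numClosedFieldType) (V : vectType F) (br : V -> V -> V).
Hypothesis malc : malcev br.
Local Notation bil := (malc_bil malc).

Lemma splitting_automorphism (e : 'End(V)) x : br_morphism br br e -> (forall x, e x = 0 -> x = 0) ->
  splitting_elt br (e x) -> splitting_elt br x.
Proof.
move=> em e0 /(splitting_eltP malc)[t tE].
have kere : lker e == 0%VS.
  by rewrite -subv0; apply/subvP=> u; rewrite memv_ker memv0 => /eqP/e0 ->.
have [t' tE'] := surj_ex (lker0_limgf kere) t.
apply/(splitting_eltP malc); exists t'; apply: fcal_uniq => mu v vmu.
apply: (lker0P kere); rewrite lfZ (adE bil) em -tE' -(adE bil) tE; apply: fcalE.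
have [n nv] := (genEP _ _ _).1 vmu; apply/genEP; exists n.
have E u : (ad br (e x) - mu *: \1%VF) (e u) = e ((ad br x - mu *: \1%VF) u).
  by rewrite !shiftE !(adE bil) -em lfB lfZ.
have -> : iter n (ad br (e x) - mu *: \1%VF) (e v) = e (iter n (ad br x - mu *: \1%VF) v).
  by elim: (n) => // i IH; rewrite !iterS IH E.
by rewrite nv lf0.
Qed.

End SplittingAutomorphism.

(** * A criterion for splitting algebras *)

Section SplittingCriterion.
Variables (F : numClosedFieldType) (V : vectType F) (br : V -> V -> V) (k : nat).
Hypotheses (malc : malcev br) (k0 : (0 < k)%N) (HL : (power br fullv k <= Lc br)%VS).
Local Notation bil := (malc_bil malc).
Local Notation alt := (malc_alt malc).
Variables S T N : {vspace V}.
Hypothesis ssS : semisimple_subalg br S.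
Hypotheses (abT : forall t u, t \in T -> u \in T -> br t u = 0)
  (ssT : forall t, t \in T -> diagble (ad br t))
  (ST0 : forall s t, s \in S -> t \in T -> br s t = 0).
Variables (n : nat) (W : nat -> {vspace V}).
Hypotheses (iN : ideal br N) (W0 : W 0%N = Lc br) (Wn : W n = 0%VS)
  (iW : forall i, ideal br (W i)) (Wdec : forall i, (W i.+1 <= W i)%VS)
  (NW : forall i r w, r \in N -> w \in W i -> br r w \in W i.+1).
Hypothesis STN : (S + T + N)%VS = fullv.

(** Modulo the next term of the flag, [r] acts by zero and powers of [ad (a + r)] agree with those
    of [ad a]; the first k-1 applications bring any vector into the Lie center. *)
Lemma ad_nilpotent_flag a r : ad_nilpotent br a -> r \in N -> ad_nilpotent br (a + r).
Proof.
move=> na rN; pose f := ad br (a + r).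
have stW i : stab f (W i) by move=> w wW; rewrite (adE bil); apply: (ideal_memr _ (iW i)).
have step i w : w \in W i -> exists m, iter m f w \in W i.+1.
  move=> wW; have [m am] := na w; exists m.
  suff : iter m f w - iter m (ad br a) w \in W i.+1 by rewrite am subr0.
  elim: (m) => [|j IH]; first by rewrite subrr mem0v.
  have -> : iter j.+1 f w - iter j.+1 (ad br a) w =
      br r (iter j f w) + br a (iter j f w - iter j (ad br a) w).
    by rewrite !iterS /f !(adE bil) (brDl bil) (brB bil); vring.
  by apply: memvD; [apply/NW/iter_stab|apply: (ideal_memr _ (iW _))].
have go j i w : w \in W i -> exists m, iter m f w \in W (i + j)%N.
  elim: j i w => [|j IH] i w wW; first by exists 0%N; rewrite addn0.
  have [m1 /IH[m2 m2W]] := step i w wW; exists (m2 + m1)%N.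
  by rewrite iterD addnS -addSn.
move=> x; have : iter k.-1 f x \in W 0%N.
  rewrite W0; apply: (subvP HL); rewrite -{2}(prednK k0); exact: iter_ad_power.
move=> /(go n)[m]; rewrite add0n Wn memv0 -iterD => /eqP; by exists (m + k.-1)%N.
Qed.

Section JordanStep.
Variables s s' t : V.
Hypotheses (sS : s \in S) (s'S : s' \in S) (tT : t \in T) (sE : ad br s' = js br s).
Local Notation w := (s + t).
Local Notation tau := (s' + t).

Let SL := semisimple_sub_Lc malc k0 HL ssS.
Let tauL : tau \in Lc br.
Proof. by apply: memvD; [exact: (subvP SL)|exact/(semisimple_Lc malc k0 HL)/ssT]. Qed.

Let diag_tau : diagble (ad br tau).
Proof.
rewrite lfD; apply: diagble_add; [rewrite sE; exact: fcal_diagble|exact: ssT|move=> x].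
by apply: lbr0_comm; rewrite -(ad_Lcl malc) ?(subvP SL) // ST0 // linear0.
Qed.

Let tau_comm x : br tau x = 0 -> forall y, ad br x (ad br tau y) = ad br tau (ad br x y).
Proof.
by move=> tx y; apply: lbr0_comm; rewrite lbrC -(ad_Lcl malc x tauL) tx linear0 oppr0.
Qed.

Let tau_w : br tau w = 0.
Proof.
rewrite (brDl bil) !(brD bil) (abT tT tT) (ST0 s'S tT) (malcC malc t s) (ST0 sS tT).
by rewrite -(adE bil s') sE (js_self malc) oppr0 !addr0.
Qed.

Let diff_nilpotent : ad_nilpotent br (s - s').
Proof. by move=> x; rewrite lfB sE; apply: fcal_id_nilp. Qed.

Let js_add r : r \in N -> br tau r = 0 -> js br (w + r) = ad br tau.
Proof.
move=> rN tr; apply/esym/fcal_id_uniq => // [x|].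
  by apply: tau_comm; rewrite (brD bil) tau_w tr addr0.
have -> : ad br (w + r) - ad br tau = ad br (s - s' + r).
  by rewrite -lfB; congr (ad br _); vring.
exact: ad_nilpotent_flag.
Qed.

(* Exponentials of [ad y], y in [W i :&: N], push [br tau r] down the flag W
   until tau commutes with r. *)
Lemma splitting_add r : r \in N -> splitting_elt br (w + r).
Proof.
suff claim j : forall i r, (i + j = n)%N -> r \in N -> br tau r \in W i -> splitting_elt br (w + r).
  move=> rN; apply: (claim n 0%N) => //; by rewrite W0; apply: (ideal_mem _ (Lc_ideal malc)).
elim: j => [|j IH] i {}r ij rN trW.
  apply/(splitting_eltP malc); exists tau; apply/esym/js_add => //.
  by apply/eqP; move: trW; rewrite -(addn0 i) ij Wn memv0.
pose U := (W i :&: N)%VS; have UP x : x \in U <-> x \in W i /\ x \in N by rewrite memv_cap; split=> /andP.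
(* Since [0^-1 = 0], [g] inverts the diagonalizable [f] on its nonzero eigenspaces and vanishes on
   its kernel. *)
pose f := ad br tau; pose g := fcal (fun mu : F => mu^-1) f.
have fU a : stab (ad br a) U.
  by move=> x /UP[xW xN]; rewrite (adE bil); apply/UP; rewrite (ideal_memr _ (iW i)) ?(ideal_memr _ iN).
have gU : stab g U by apply: fcal_stab; apply: fU.
have inv_on x : f (g (f x)) = f x /\ f (g (g (f x))) = g (f x).
  have := memvf x; move: x; apply: (genE_ind (f := f) (U := fullv)) => [x _|| c x y [x1 x2] [y1 y2]|mu x _ xmu].
  - exact: memvf.
  - by rewrite !lf0.
  - by rewrite !lfP x1 x2 y1 y2.
  have gx : g x = mu^-1 *: x := fcalE _ xmu.
  rewrite (diag_tau xmu) !lfZ gx !lfZ gx !lfZ (diag_tau xmu) !scalerA.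
  have [->|mu0] := eqVneq mu 0; first by rewrite !(mul0r, mulr0) scale0r.
  by rewrite divff // !mul1r mulVf.
have vU : f r \in U by apply/UP; rewrite /f (adE bil) trW (ideal_memr _ iN).
have [fg fgg] := inv_on r; set r1 := g (f r) in fg fgg; have r1U : r1 \in U := gU _ vU.
(* By [js_add] at [r = 0] the semisimple part of [ad w] is [f], so [image_lift] at [g r1] solves
   [br w y = f (g r1) = r1] inside [U]. *)
have [y yU yE] := image_lift (fU w) (gU _ r1U).
have wy : br w y = r1.
  rewrite -(adE bil) yE -/(js br w) -[w]addr0 js_add ?mem0v ?(br0 bil) //; exact: fgg.
have [yW yN] := (UP y).1 yU.
have yL : y \in Lc br.
  by rewrite -W0; elim: (i) yW => // i' IH' /(subvP (Wdec _))/IH'.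
have [|m ynil] := @nilp_uniform _ _ (ad br y) fullv.
  move=> u _; have := @ad_nilpotent_flag 0 y; rewrite add0r; apply=> // x.
  by exists 1%N; rewrite /= linear0 zero_lfunE.
(* The exponent is padded so that the sum defining the exponential has terms of degree 0 and 1 to
   split off. *)
have {}ynil x : iter m.+2 (ad br y) x = 0.
  by rewrite -addn2 addnC iterD ynil ?memvf // !iterS !lf0.
have yder a b : ad br y (br a b) = br (ad br y a) b + br a (ad br y b).
  exact: (Lc_derivation malc yL).
pose e := expd (ad br y) m.+2.
have rem z : exists2 q, q \in (W i.+1 :&: N)%VS & e z = z + br y z + q.
  exists (\sum_(l < m) dpow (ad br y) l.+2 z).
    apply: memv_suml => l _; apply: memvZ; rewrite -addn2 iterD; apply: iter_stab.
      move=> q; rewrite !memv_cap (adE bil) => /andP[qW qN].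
      by rewrite (ideal_memr _ (iW _)) // (ideal_memr _ iN).
    by rewrite /= !(adE bil) memv_cap NW ?(ideal_mem _ (iW i)) ?(ideal_mem _ iN).
  rewrite /e (expdE ynil _ (leqnn _)) big_ord_recl big_ord_recl /dpow /= fact0 invr1 !scale1r.
  by rewrite (adE bil) addrA.
have [q qU eE] := rem (w + r); have [qW qN] := memv_capP qU.
apply: (splitting_automorphism malc (expd_morph bil yder ynil)).
  by move=> x; apply: (expd_inj ynil).
rewrite -/e eE.
(* The exponential adds [br y w = - r1] to [r]. As [tau] kills [r - r1], and both [br y r] and [q]
   lie one step further down the flag, so does [br tau r']. *)
pose r' := r - r1 + br y r + q.
have -> : w + r + br y (w + r) + q = w + r'.
  by rewrite (brD bil) (malcC malc y w) wy /r'; vring.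
have yr : br y r \in W i.+1 by rewrite (malcC malc) memvN NW.
apply: (IH i.+1); first by rewrite addSnnS.
  rewrite !memvD // ?(ideal_memr _ iN) // memvN; by case: ((UP r1).1 r1U).
have -> : br tau r' = br tau (br y r) + br tau q.
  rewrite /r' !(brD bil) (brN bil) -!(adE bil) -/f fg subrr add0r; by [].
by apply: memvD; apply: (ideal_memr _ (iW _)).
Qed.

End JordanStep.

Theorem splitting_criterion : splitting_alg br.
Proof.
split=> // g; have : g \in (S + T + N)%VS by rewrite STN memvf.
move=> /memv_addP[_ /memv_addP[s sS [t tT ->]] [r rN ->]].
have [s' s'S sE] := semisimple_jordan malc k0 HL ssS sS.
exact: splitting_add s'S tT sE _ rN.
Qed.

End SplittingCriterion.

(** * Semidirect extension by a torus of derivations *)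

Section TorusExtension.
Variables (F : numClosedFieldType) (V : vectType F) (br : V -> V -> V) (k : nat).
Hypotheses (malc : malcev br) (k0 : (0 < k)%N) (HL : (power br fullv k <= Lc br)%VS).
Local Notation bil := (malc_bil malc).
Local Notation alt := (malc_alt malc).
Variable T : {vspace 'End(V)}.
Hypotheses (TD : forall D : 'End(V), D \in T -> derivation br D)
  (TL : forall (D : 'End(V)) x, D \in T -> D x \in Lc br)
  (TC : forall (D E : 'End(V)) x, D \in T -> E \in T -> D (E x) = E (D x)).
Local Notation A := (V * subvs_of T)%type.
Local Notation op := (incl T).
Implicit Types (p q r : A).

(** The semidirect product with [T] taken as an abelian algebra acting from the left, whence the
    zero second component. *)
Definition ext_br p q : A := (br p.1 q.1 + op p.2 q.1 - op q.2 p.1, 0).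

Let opP c (D E : subvs_of T) x : op (c *: D + E) x = c *: op D x + op E x.
Proof. by rewrite lfP add_lfunE scale_lfunE. Qed.

Let op0 x : op 0 x = 0.
Proof. by rewrite lf0 zero_lfunE. Qed.

Let opT (D : subvs_of T) : op D \in T.
Proof. by rewrite inclE subvsP. Qed.

Lemma ext_bilinear : bilinear_br ext_br.
Proof.
split=> p c q r; congr (_, _); rewrite /= ?scaler0 ?addr0 //.
  by rewrite (brP bil) opP lfP; vring.
by rewrite (brPl bil) opP lfP; vring.
Qed.

Lemma ext_alt p : ext_br p p = 0.
Proof. by congr (_, _); rewrite alt add0r subrr. Qed.

Lemma ext_jac p q r : jac ext_br p q r = (jac br p.1 q.1 r.1, 0).
Proof.
move: p q r => [x D] [y E] [z G]; congr (_, _); last by rewrite /= !addr0.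
rewrite /= !op0 /jac !(brDl bil, brNl bil) !(lfD, lfN).
rewrite !(TD (opT _)) (TC x (opT G) (opT E)) (TC y (opT G) (opT D)) (TC z (opT D) (opT E)).
rewrite (malcC malc x (op G y)) (malcC malc y (op D z)) (malcC malc z (op E x)).
by vring.
Qed.

(** Jacobians do not see the components in [T]. In the Malcev identity these contribute a derivation
    applied to a Jacobian and Jacobians with an entry in the image of [T]; all vanish because that
    image is Lie central. *)
Lemma ext_malcev : malcev ext_br.
Proof.
split; [exact: ext_bilinear|exact: ext_alt|move=> p q r].
rewrite !ext_jac; congr (_, _) => /=.
have -> : op p.2 (jac br p.1 q.1 r.1) = 0.
  rewrite (derivation_jac malc _ _ _ (TD (opT _))) (Lc_jac malc _ _ (TL _ (opT _))).
  by rewrite (Lc_jac2 malc _ _ (TL _ (opT _))) (Lc_jac3 malc _ _ (TL _ (opT _))) !addr0.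
have zL : op p.2 r.1 - op r.2 p.1 \in Lc br by apply: rpredB; apply: TL.
rewrite op0 addr0 subr0 (malc_id malc) -addrA -[br p.1 r.1]scale1r (jacP malc).
by rewrite !scale1r (Lc_jac3 malc _ _ zL) addr0.
Qed.

Lemma ext_Lc p : p.1 \in Lc br -> p \in Lc ext_br.
Proof. by move=> pL; apply/(LcP ext_malcev) => q r; rewrite ext_jac (Lc_jac malc). Qed.

Definition ext_fst : 'Hom(A, V) := linfun (fun p : A => p.1).
Definition ext_inl : 'Hom(V, A) := linfun (fun x => (x, 0) : A).
Definition ext_inr : 'Hom(subvs_of T, A) := linfun (fun D => (0, D) : A).

Lemma ext_fstE p : ext_fst p = p.1.
Proof. by rewrite linfun_linE. Qed.

Lemma ext_inlE x : ext_inl x = (x, 0).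
Proof. by rewrite linfun_linE // => c u v; congr (_, _); rewrite /= scaler0 addr0. Qed.

Lemma ext_inrE D : ext_inr D = (0, D).
Proof. by rewrite linfun_linE // => c u v; congr (_, _); rewrite /= scaler0 addr0. Qed.

Lemma ext_inl_morph : br_morphism br ext_br ext_inl.
Proof. by move=> x y; rewrite !ext_inlE /ext_br /= !op0 addr0 subr0. Qed.

Lemma ext_inl_inj x y : ext_inl x = ext_inl y -> x = y.
Proof. by rewrite !ext_inlE => -[]. Qed.

(** The terms involving [T] have values in the Lie center, which is an ideal, so powers change by
    Lie central elements only. *)
Lemma ext_power n : (0 < n)%N ->
  (ext_fst @: power ext_br fullv n <= power br fullv n + Lc br)%VS.
Proof.
elim/ltn_ind: n => n IH n0; have [n1|n1] := leqP n 1.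
  have -> : n = 1%N by lia.
  by apply: subv_trans (addvSl _ _); rewrite power1 subvf.
suff le : (power ext_br fullv n <= ext_fst @^-1: (power br fullv n + Lc br))%VS.
  by apply/subvP=> _ /memv_imgP[p /(subvP le) + ->]; rewrite -memv_preim.
apply: power_le => // i j p q i0 j0 ij pi qj; rewrite -memv_preim ext_fstE /=.
have /memv_addP[a ai [l lL pE]] : p.1 \in (power br fullv i + Lc br)%VS.
  by apply: (subvP (IH i _ i0)); [lia|rewrite -ext_fstE memv_img].
have /memv_addP[b bj [m mL qE]] : q.1 \in (power br fullv j + Lc br)%VS.
  by apply: (subvP (IH j _ j0)); [lia|rewrite -ext_fstE memv_img].
have -> : br p.1 q.1 = br a b + (br a m + br l q.1).
  by rewrite pE {1}qE (brDl bil) (brD bil) addrA -qE.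
rewrite -!addrA; apply: memv_add; first by rewrite -ij; apply: mem_power.
apply: memvD; first exact: (ideal_memr _ (Lc_ideal malc)).
apply: memvD; first exact: (ideal_mem _ (Lc_ideal malc)).
by apply: rpredB; apply: TL.
Qed.

Lemma ext_NL : (power ext_br fullv k <= Lc ext_br)%VS.
Proof.
apply/subvP=> p pk; apply: ext_Lc; rewrite -ext_fstE.
have : ext_fst p \in (power br fullv k + Lc br)%VS by apply: (subvP (ext_power k0)); apply: memv_img.
by apply: subvP; rewrite subv_add HL subvv.
Qed.

Lemma ext_ad_nilpotent p : (forall x, exists m, iter m (ad br p.1 + op p.2) x = 0) ->
  ad_nilpotent ext_br p.
Proof.
move=> nil q; have aE r : r.2 = 0 -> ad ext_br p r = ((ad br p.1 + op p.2) r.1, 0).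
  by move=> r2; rewrite (adE ext_bilinear) /ext_br r2 op0 subr0 add_lfunE (adE bil).
(* The extra application makes the component in [T] zero; from there on only [ad p.1 + op p.2]
   acts. *)
have [m mE] := nil (ad ext_br p q).1; exists m.+1.
rewrite iterSr; set r := ad _ _ q in mE *; have r2 : r.2 = 0 by rewrite /r (adE ext_bilinear).
have -> : iter m (ad ext_br p) r = (iter m (ad br p.1 + op p.2) r.1, 0).
  elim: (m) => [|i IH]; first by rewrite /= -r2; case: (r).
  by rewrite iterS IH aE.
by rewrite mE.
Qed.

Lemma ext_diagble (D : subvs_of T) : diagble (op D) -> diagble (ad ext_br (0, D)).
Proof.
move=> dD mu [y E] /genEP[n nE]; rewrite (adE ext_bilinear) /ext_br /= (br0l bil) lf0 subr0 add0r.
have it i : iter i (ad ext_br (0, D) - mu *: \1%VF) (y, E) =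
    (iter i (op D - mu *: \1%VF) y, (- mu) ^+ i *: E).
  elim: i => [|i IH]; first by rewrite expr0 scale1r.
  rewrite !iterS IH shiftE (adE ext_bilinear) shiftE; congr (_, _) => /=.
    by rewrite (br0l bil) lf0 subr0 add0r.
  by rewrite exprS add0r scalerA mulNr scaleNr.
move: nE; rewrite it => -[nD nE].
have -> : op D y = mu *: y by apply: dD; apply/genEP; exists n.
congr (_, _) => /=; have [->|E0] := eqVneq E 0; first by rewrite scaler0.
have {}E0 : vsval E != 0.
  by apply: contra E0 => /eqP E0; apply/eqP/(can_inj (@vsvalK _ _ _)); rewrite E0 linear0.
have := scaler_eq0 ((- mu) ^+ n) (vsval E); rewrite nE eqxx (negPf E0) orbF expf_eq0 oppr_eq0.
by move=> /esym/andP[_ /eqP ->]; rewrite scale0r.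
Qed.

Lemma ext_embedding : embedding br ext_br ext_inl.
Proof.
split; first exact: ext_inl_morph.
apply/eqP; rewrite -subv0; apply/subvP=> x; rewrite memv_ker memv0 => /eqP x0.
by apply/eqP/ext_inl_inj; rewrite x0 lf0.
Qed.

End TorusExtension.

Lemma morph_semisimple (F : numClosedFieldType) (A B : vectType F) (brA : A -> A -> A)
    (brB : B -> B -> B) (f : 'Hom(A, B)) S : br_morphism brA brB f -> lker f = 0%VS ->
  semisimple_subalg brA S -> semisimple_subalg brB (f @: S).
Proof.
move=> fm kf [sS ssS]; have inj : injective f by apply/lker0P/eqP.
split=> [_ _ /memv_imgP[x xS ->] /memv_imgP[y yS ->]|I [IS iI] [n sI]].
  by rewrite -fm memv_img // sS.
have IE : (f @: (f @^-1: I))%VS = I.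
  apply/vspaceP=> y; apply/memv_imgP/idP => [[x + ->]|yI]; first by rewrite -memv_preim.
  by have /memv_imgP[x _ yE] := subvP IS _ yI; exists x; rewrite // -memv_preim -yE.
rewrite -IE (ssS (f @^-1: I)%VS) ?limg0 //.
  split=> [|x y]; first by apply/subvP=> x; rewrite -memv_preim => /(subvP IS)/memv_imgP[z zS /inj ->].
  by rewrite -!memv_preim !fm => xI yS; apply: iI => //; apply: memv_img.
exists n; apply/eqP; rewrite -subv0; apply/subvP=> x xD; rewrite memv0 -(inj_eq inj) lf0 -memv0.
by rewrite -sI -IE -(morph_derived fm) memv_img.
Qed.

Section SplittingExistence.
Variables (F : numClosedFieldType) (V : vectType F) (br : V -> V -> V) (k : nat).
Hypotheses (malc : malcev br) (k0 : (0 < k)%N) (HL : (power br fullv k <= Lc br)%VS).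
Local Notation bil := (malc_bil malc).
Local Notation alt := (malc_alt malc).

Definition derivation_torus (S N : {vspace V}) (T : {vspace 'End(V)}) :=
  [/\ forall D : 'End(V), D \in T -> derivation br D,
      forall (D : 'End(V)) x, D \in T -> D x \in (Lc br :&: N)%VS,
      forall (D : 'End(V)) s, D \in T -> s \in S -> D s = 0,
      forall (D E : 'End(V)) x, D \in T -> E \in T -> D (E x) = E (D x) &
      forall D : 'End(V), D \in T -> diagble D].

Lemma derivation_torus_ex S N : exists T, derivation_torus S N T /\
  forall D, derivation br D -> (forall x, D x \in (Lc br :&: N)%VS) ->
    (forall s, s \in S -> D s = 0) -> (forall (E : 'End(V)) x, E \in T -> D (E x) = E (D x)) ->
    diagble D -> D \in T.
Proof.
have [|T T_torus Tmax] := @max_vspace _ _ (derivation_torus S N) 0%VS.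
  split=> [D|D x|D s|D E x|D]; rewrite memv0 => /eqP ->.
  - by move=> x y; rewrite !zero_lfunE (br0 bil) (br0l bil) addr0.
  - by rewrite zero_lfunE mem0v.
  - by rewrite zero_lfunE.
  - by rewrite memv0 => /eqP ->; rewrite !zero_lfunE.
  by rewrite -(scale0r (fcal id \1%VF)); apply/diagble_scale/fcal_diagble.
exists T; split=> // D dD DL DS DT ssD; have [TD TL TS TC Tss] := T_torus.
suff le : (\dim (T + <[D]>) <= \dim T)%N.
  have /eqP -> : T == (T + <[D]>)%VS by rewrite eqEdim addvSl.
  by apply: (subvP (addvSr _ _)); apply: memv_line.
apply: Tmax; split.
- move=> _ /memv_addP[E ET [_ /vlineP[a ->] ->]] x y; rewrite !add_lfunE !scale_lfunE TD // dD.
  by rewrite !(brE bil); vring.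
- move=> _ x /memv_addP[E ET [_ /vlineP[a ->] ->]]; rewrite add_lfunE scale_lfunE.
  by apply: memvD; [apply: TL|apply: memvZ].
- move=> _ s /memv_addP[E ET [_ /vlineP[a ->] ->]] sS; rewrite add_lfunE scale_lfunE.
  by rewrite TS // DS // scaler0 addr0.
- move=> _ _ x /memv_addP[E ET [_ /vlineP[a ->] ->]] /memv_addP[G GT [_ /vlineP[b ->] ->]].
  rewrite !add_lfunE !scale_lfunE !lfD !lfZ (TC E G) // -(DT E) // -(DT G) //; vring.
move=> _ /memv_addP[E ET [_ /vlineP[a ->] ->]].
apply: diagble_add; [exact: Tss|exact: diagble_scale|move=> x].
by rewrite !scale_lfunE lfZ DT.
Qed.

(** By [splitting_criterion] the extension must be the sum of [S'], [T'] and [N']. An element of [V]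
    is split along [S] and [R], its part in [R] into an [S]-invariant part and one in [[S, R]], and
    the invariant part into one fixed by the torus and one moved into the nilradical. *)
Lemma splitting_embedding_ex :
  exists (A : vectType F) (brA : A -> A -> A) (iota : 'Hom(V, A)),
    splitting_alg brA /\ embedding br brA iota.
Proof.
have [R radR] := radical_ex bil alt; have [iR sR _] := radR.
have [S [sS SL SRf SR0]] := levi malc k0 HL radR.
have [N [nilN NR NE RN]] := nilradical_ex malc k0 HL radR.
have ssS := levi_complement_semisimple malc k0 HL radR sS SRf SR0.
have [T [[TD TLN TS TC Tss] Tmax]] := derivation_torus_ex S N.
have TL (D : 'End(V)) x : D \in T -> D x \in Lc br by move=> /(TLN D x)/memv_capP[].
have TN (D : 'End(V)) x : D \in T -> D x \in N by move=> /(TLN D x)/memv_capP[].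
pose A := (V * subvs_of T)%type; pose brA : A -> A -> A := @ext_br _ _ br T.
have mA : malcev brA := ext_malcev malc TD TL TC.
have HLA : (power brA fullv k <= Lc brA)%VS := ext_NL malc k0 HL TD TL TC.
have [inl_m inl_k] := ext_embedding br T.
pose inl := @ext_inl _ _ T; pose inr := @ext_inr _ _ T; pose fst1 := @ext_fst _ _ T.
exists A, brA, inl; split; last by split.
have brAE p q : brA p q = (br p.1 q.1 + incl T p.2 q.1 - incl T q.2 p.1, 0) by [].
have opT D : incl T D \in T by rewrite inclE subvsP.
(* [R'] contains the whole torus; it is a solvable ideal because its derived algebra lies in the
   image of [R]. *)
pose R' := (fst1 @^-1: R)%VS.
have R'P (p : A) : p \in R' <-> p.1 \in R by rewrite -memv_preim ext_fstE.
have iR' : ideal brA R'.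
  apply: (idealI (malc_bil mA) (malc_alt mA)) => p q /R'P pR; apply/R'P => /=.
  apply: memvB; last by apply: (subvP NR); apply: TN.
  by apply: memvD; [apply: (ideal_mem _ iR)|apply: (subvP NR); apply: TN].
have sR' : solvable brA R'.
  apply: (@solvable_derived _ _ _ 1%N); have [m Rm] := sR.
  apply: (solvableS (U' := (inl @: R)%VS)); last by exists m; rewrite -(morph_derived inl_m) Rm limg0.
  apply: brv_le => p q pR qR; have /R'P bR := ideal_mem q iR' pR.
  by apply/memv_imgP; exists (brA p q).1; rewrite // ext_inlE.
have [N' [iN' N'R N'E _ [_ [n [W [W0 Wn iW Wdec NW]]]]]] := nil_ideal mA k0 HLA iR' sR'.
pose S' := (inl @: S)%VS; pose T' := (inr @: fullv)%VS.
have ssS' : semisimple_subalg brA S' := morph_semisimple inl_m inl_k ssS.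
have abT' t u : t \in T' -> u \in T' -> brA t u = 0.
  move=> /memv_imgP[D _ ->] /memv_imgP[E _ ->]; rewrite !ext_inrE brAE /=.
  by rewrite (br0 bil) !lf0 addr0 subr0.
have ssT' t : t \in T' -> diagble (ad brA t).
  by move=> /memv_imgP[D _ ->]; rewrite ext_inrE; apply: (ext_diagble malc); apply: Tss.
have ST0' s t : s \in S' -> t \in T' -> brA s t = 0.
  move=> /memv_imgP[s1 s1S ->] /memv_imgP[D _ ->]; rewrite ext_inlE ext_inrE brAE /=.
  by rewrite (br0 bil) lf0 TS // addr0 subr0.
apply: (splitting_criterion mA k0 HLA ssS' abT' ssT' ST0' iN' W0 Wn iW Wdec NW).
have nil_mem p : p.1 \in R -> (forall x, exists m, iter m (ad br p.1 + incl T p.2) x = 0) -> p \in N'.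
  by move=> pR nil; apply: N'E; [exact/R'P|exact: ext_ad_nilpotent].
have N_mem x : x \in N -> inl x \in N'.
  move=> xN; rewrite ext_inlE; have xR := subvP NR _ xN; apply: nil_mem => //=.
  by rewrite lf0 addr0; apply/NE.
have T_mem D : inr D \in (S' + T' + N')%VS.
  by rewrite -addvA (subvP (addvSr _ _)) // (subvP (addvSl _ _)) // memv_img ?memvf.
have N'_mem p : p \in N' -> p \in (S' + T' + N')%VS by apply: subvP; rewrite addvSr.
pose C : {vspace V} := spanp (fun c => c \in R /\ forall s, s \in S -> br s c = 0).
have CP c : c \in C <-> c \in R /\ forall s, s \in S -> br s c = 0.
  apply: mem_spanp => [|a u v [uR u0] [vR v0]].
    by split=> [|s _]; rewrite ?mem0v ?(br0 bil).
  by split=> [|s sS']; rewrite ?memvD ?memvZ // (brP bil) u0 // v0 // scaler0 addr0.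
(* By maximality T contains [js br c], and [(c, - js br c)] is ad-nilpotent. *)
have cent c : c \in C -> (forall D, D \in T -> (D : 'End(V)) c = 0) -> inl c \in (S' + T' + N')%VS.
  move=> /CP[cR cS] cT; have jsT : js br c \in T.
    apply: Tmax => [|x|s sS'|E x ET|].
    - exact: (js_derivation malc k0 HL).
    - rewrite memv_cap (js_Lc malc k0 HL) /=; apply: (fcal_img (U := fullv)) (memvf x) => // [u _|u _].
        exact: memvf.
      by rewrite (adE bil) (malcC malc) memvN RN.
    - by apply: (ad_eq0_js malc); rewrite (malcC malc) cS // oppr0.
    - apply: fcal_commute => y; apply/esym/lbr0_comm.
      by rewrite -(derivation_ad malc) ?cT ?linear0 //; apply: TD.
    - exact: fcal_diagble.
  pose D := vsproj T (js br c); have DE : incl T D = js br c by rewrite inclE vsprojK.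
  have -> : inl c = inr D + (c, - D).
    by rewrite ext_inlE ext_inrE; congr (_, _); rewrite /= ?add0r ?subrr.
  apply: memvD (T_mem D) (N'_mem _ (nil_mem _ _ _)) => //= x.
  by rewrite lfN DE; apply: fcal_id_nilp.
apply/eqP; rewrite eqEsubv subvf; apply/subvP=> -[x D] _.
have -> : (x, D) = inl x + inr D.
  by rewrite ext_inlE ext_inrE; congr (_, _); rewrite /= ?addr0 ?add0r.
apply: memvD (T_mem D).
have : x \in (S + R)%VS by rewrite SRf memvf.
move=> /memv_addP[s sS' [r rR ->]]; rewrite lfD; apply: memvD.
  by rewrite -addvA (subvP (addvSl _ _)) // memv_img.
have [|Wl _] := levi_weyl malc k0 HL ssS (Y := R).
  by move=> s1 y _; apply: (ideal_memr _ iR).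
have [c [n1 [-> cR inv0 n1S]]] := Wl r rR; rewrite lfD; apply: memvD; last first.
  by apply/N'_mem/N_mem; apply: subvP n1S; apply: brv_le => s1 y _; apply: RN.
have cC : inl c \in (inl @: C)%VS by apply: memv_img; apply/CP.
have T'L : (T' <= Lc brA)%VS.
  by apply/subvP=> t tT; apply: (semisimple_Lc mA k0 HLA (ssT' t tT)).
have [|CE _] := torus_fix mA T'L abT' ssT' (Y := (inl @: C)%VS).
  move=> _ _ /memv_imgP[E _ ->] /memv_imgP[z /CP[zR zS] ->].
  apply/memv_imgP; exists (incl T E z).
    apply/CP; split=> [|s1 s1S]; first by apply: (subvP NR); apply: TN.
    have := TD _ (opT E) s1 z; rewrite (zS _ s1S) lf0 (TS _ s1) // (br0l bil) add0r; exact: esym.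
  by rewrite !ext_inlE ext_inrE brAE /= (br0l bil) !lf0 add0r subr0.
rewrite CE in cC; have /memv_addP[p /(fixedTP mA)[/memv_imgP[z zC ->] zT] [q qT ->]] := cC.
apply: memvD.
  apply: cent => // E ET; have := zT (inr (vsproj T E)) (memv_img _ (memvf _)).
  by rewrite ext_inlE ext_inrE brAE /= inclE vsprojK // (br0l bil) !lf0 add0r subr0 => -[].
apply: subvP qT; apply: subv_trans (addvSr _ _); apply: brv_le => _ _ /memv_imgP[E _ ->] /memv_imgP[u _ ->].
rewrite ext_inlE ext_inrE brAE /= (br0l bil) !lf0 add0r subr0 -ext_inlE.
by apply: N_mem; apply: TN.
Qed.

(** Among the splitting algebras containing [V] take one of least dimension: a splitting subalgebra
    between would be such an algebra of no smaller dimension. *)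
Theorem splitting_ex : exists (A : vectType F) (brA : A -> A -> A) (iota : 'Hom(V, A)),
  splitting_of br brA iota.
Proof.
pose P n := `[< exists (A : vectType F) (brA : A -> A -> A) (iota : 'Hom(V, A)),
  [/\ splitting_alg brA, embedding br brA iota & \dim {:A} = n] >].
have exP : exists n, P n.
  have [A [brA [iota [sA eA]]]] := splitting_embedding_ex.
  by exists (\dim {:A}); apply/asboolP; exists A, brA, iota.
case: (ex_minnP exP) => n /asboolP[A [brA [iota [sA [im ik] dA]]]] nmin.
exists A, brA, iota; split=> // U sU iU splU; apply/eqP; rewrite eqEdim subvf dA.
have -> : \dim U = \dim {:subvs_of U} by rewrite dimvf.
apply: nmin; apply/asboolP; exists (subvs_of U), (sub_br brA U), (linfun (vsproj U) *o iota).
have iE x : vsval ((linfun (vsproj U) *o iota) x) = iota x.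
  by rewrite comp_lfunE lfunE /= vsprojK // (subvP iU) // memv_img ?memvf.
split=> //; split=> [x y|].
  by apply: (can_inj (@vsvalK _ _ _)); rewrite sub_brE // !iE im.
apply/eqP; rewrite -subv0 -ik; apply/subvP=> x; rewrite !memv_ker => /eqP x0.
by rewrite -iE x0 linear0.
Qed.

End SplittingExistence.

Lemma embedding_NL (F : numClosedFieldType) (A B : vectType F) (brA : A -> A -> A)
    (brB : B -> B -> B) (iota : 'Hom(A, B)) k : (2 <= k)%N -> NL brA k ->
  splitting_of brA brB iota -> NL brB k.
Proof.
move=> k2 nlA [sB [im _] minB]; have k0 : (0 < k)%N by apply: leq_trans k2.
have malcA : malcev brA := proj1 nlA; have [_ HL] := (NL_power malcA k0).1 nlA.
apply: (minimal_splitting_NL sB k2 (U0 := limg iota)) minB.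
  by move=> _ _ /memv_imgP[x _ ->] /memv_imgP[y _ ->]; rewrite -im memv_img ?memvf.
move=> w _ _ wk /memv_imgP[y _ ->] /memv_imgP[z _ ->].
move: wk; rewrite -(power_morph _ im k0) => /memv_imgP[w' w'k ->].
by rewrite -(morph_jac im) (Lc_jac malcA) ?lf0 // (subvP HL).
Qed.

Theorem theorem1 (R : realType) (k : nat) (hk : (2 <= k)%N)
    (M : vectType R[i]) (br : M -> M -> M) (hM : NL br k) :
  (exists (Mh : vectType R[i]) (brh : Mh -> Mh -> Mh) (iota : 'Hom(M, Mh)),
     splitting_of br brh iota) /\
  forall (Mh : vectType R[i]) (brh : Mh -> Mh -> Mh) (iota : 'Hom(M, Mh)),
    splitting_of br brh iota ->
    [/\ NL brh k,
        exists (S T N : {vspace Mh}) (Delta : seq 'Hom(subvs_of T, R[i]^o)),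
          splitting_decomposition brh S T N Delta &
        forall (S T N : {vspace Mh}) (Delta : seq 'Hom(subvs_of T, R[i]^o)),
          splitting_decomposition brh S T N Delta ->
          let V0 := N00 brh S T N in
          let L := M1 brh S T N Delta in
          [/\ (* (1) *)
              [/\ semisimple_subalg brh S, lie (sub_br brh S),
                  toroidal brh T, ideal brh N & nilpotent brh N],
              (* (2) *)
              [/\ N = (V0 + brv brh (S + T) N)%VS,
                  directv (V0 + brv brh (S + T) N),
                  (V0 <= N)%VS, subalg brh V0 &
                  forall x, x \in L -> lie_center brh x] &
              (* (3) *)
              [/\ malcev (sub_br brh V0) /\ nilpotent brh V0,
                  subalg brh L /\ lie (sub_br brh L),
                  dext_conditions brh V0 L,
                  NL (dext_br brh V0 L) k &
                  exists pi : 'Hom((subvs_of V0 * subvs_of L)%type, Mh),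
                    epimorphism (dext_br brh V0 L) brh pi]]].
Proof.
have k0 : (0 < k)%N by apply: leq_trans hk.
split; first exact: (splitting_ex (proj1 hM) k0 ((NL_power (proj1 hM) k0).1 hM).2).
move=> Mh brh iota spl; have nlh := embedding_NL hk hM spl; split=> //.
  have [sB _ _] := spl; apply: (splitting_decomposition_ex sB k0).
  exact: ((NL_power (proj1 nlh) k0).1 nlh).2.
by move=> S T N Delta dec; apply: (decomposition_structure k0 nlh dec).
Qed.
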